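(* Let $f(z)$ be analytic for $\Re(z)>0$ and have no extension that is meromorphic at $z=0$. Suppose $g(z)=f(z+1)$ satisfies $g(z)=O(\exp(\alpha|z|))$ for $\Re(z)\ge0$ and $g(\pm ix)=O(\exp((\pi-\varepsilon)x))$ for $x>0$, for some positive constants $\alpha,\varepsilon$. Then the sequence $(f(n))_{n\ge1}$ is not holonomic.
   Context: A sequence $(a_n)_{n\ge1}$ of complex numbers is holonomic if there exist polynomials $p_0,\dots,p_d\in\mathbb{C}[x]$, not all zero, such that $p_0(n)a_n+p_1(n)a_{n+1}+\dots+p_d(n)a_{n+d}=0$ for all integers $n\ge1$ (equivalently, for all $n\ge n_0$ for some $n_0$). *)

(* Defs.v *)
From Stdlib Require Import Reals List.
From Coquelicot Require Import Coquelicot.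

Open Scope R_scope.

Definition analytic_at (f : C -> C) (z0 : C) : Prop :=
  exists a : nat -> C,
    locally z0 (fun z : C =>
      is_pseries (K := C_AbsRing) (V := C_NormedModule) a (z - z0)%C (f z)).

(* The value of [f] at [z0] itself is irrelevant: [f] need only be meaningful
   on a punctured neighbourhood of [z0].  Removable singularities ([m = 0])
   and poles are both allowed. *)
Definition meromorphic_at (f : C -> C) (z0 : C) : Prop :=
  exists (m : nat) (h : C -> C),
    analytic_at h z0 /\
    locally' z0 (fun z : C => ((z - z0) ^ m * f z)%C = h z).

(* [f] is only meaningful on the open right half-plane; total functions play
   the role of partial ones, so an extension must agree with [f] there and is
   otherwise free. *)
Definition has_meromorphic_extension_at_0 (f : C -> C) : Prop :=
  exists F : C -> C,
    (forall z : C, 0 < Re z -> F z = f z) /\ meromorphic_at F (RtoC 0).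

Definition big_O_on {T : Type} (D : T -> Prop) (g : T -> C) (b : T -> R)
  : Prop :=
  exists K : R, forall t : T, D t -> Cmod (g t) <= K * b t.

(* Polynomials in C[x] are lists of coefficients, constant term first;
   trailing zeros are allowed, so the zero polynomial is any list of zeros. *)
Definition Cpoly : Type := list C.

Definition Cpoly_eval (p : Cpoly) (z : C) : C :=
  fold_right (fun c r => (c + z * r)%C) (RtoC 0) p.

Definition Cpoly_nonzero (p : Cpoly) : Prop :=
  exists c : C, In c p /\ c <> RtoC 0.

(* The sequence is (a_n) for n >= 1; the value [a 0] is never used.
   [sum_n u d] is u 0 + ... + u d. *)
Definition holonomic (a : nat -> C) : Prop :=
  exists (d : nat) (p : nat -> Cpoly),
    (exists j : nat, (j <= d)%nat /\ Cpoly_nonzero (p j)) /\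
    forall n : nat, (1 <= n)%nat ->
      sum_n (fun j : nat => (Cpoly_eval (p j) (RtoC (INR n)) * a (n + j)%nat)%C)
        d = RtoC 0.

(* Main.v *)
(** Suppose the sequence satisfies a recurrence and let [H z] be the sum of the [p_j z * f (z + j)].
   By a Phragmen-Lindelof argument in each quadrant, the hypotheses on [g] give
   [|g (x + i y)| <= K exp (alpha x + b |y|)] with [b < pi], so that [z |-> H (z + 1)] is of
   exponential type on a right half-plane, with type less than [pi] along vertical lines, and it
   vanishes at the positive integers: it is zero by Carlson's theorem. By the identity theorem
   [H = 0] on [Re z > - j0], where [j0] is least with [p_j0 <> 0]; translating by [j0] and dividing
   by [p_j0] expresses [f], on [Re z > 0] near 0, as an analytic function over a
   polynomial, i.e. as the restriction of a function meromorphic at 0.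

   Both growth theorems reduce to the maximum modulus principle on a rectangle, after
   multiplication by an exponential of [zeta log (1 + zeta)]. *)

(* The maximum principle is drawn from the mean value property, itself obtained by differentiating
   under the integral sign. Carlson's theorem applies it to [H z / sin (pi z)], where the zeros of
   the sine leave removable singularities at which only continuity is established. Hence the
   principle is stated for functions that are continuous at each point and holomorphic on a
   punctured disc around it.

   With [zeta = xi + i eta], the real part of [zeta log (1 + zeta)] is
   [xi log |1 + zeta| - eta arg (1 + zeta)]. The first term outgrows every linear function of [xi];
   the second is at most [(pi / 2) |eta|]. In the quadrant, after a rotation giving [|eta| <= xi], a
   linear correction absorbs the second term. In Carlson's theorem it is paid for by the decay
   [exp ((b - pi) |y|)] left after division by the sine, and this is where a type below [pi] is
   consumed. Half of the gap [pi - b] is spent beforehand on the polynomial coefficients.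

   The minimality of [j0] matters because, after translation by [j0], the other terms contain
   [f (z + j - j0)] with [j - j0 >= 1], which is analytic at 0. *)
Require Import Defs.
From Stdlib Require Import Reals List Arith Wf_nat Classical Lra Lia ClassicalEpsilon ZArith.
From Coquelicot Require Import Coquelicot.

Open Scope R_scope.

(** * Strict complex differentiability *)

(* Strict differentiability, asked for at every point of an open set, encodes "continuously
   complex differentiable" in one notion that is stable under the usual operations. *)
Definition sderiv (F : C -> C) (z d : C) : Prop :=
  forall e, 0 < e -> exists del, 0 < del /\
    forall u v : C, Cmod (u - z)%C < del -> Cmod (v - z)%C < del ->
      Cmod (F u - F v - d * (u - v))%C <= e * Cmod (u - v)%C.

Definition hol_at (F : C -> C) (z : C) : Prop := exists d, sderiv F z d.

Definition cont_at (F : C -> C) (z : C) : Prop :=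
  forall e, 0 < e -> exists del, 0 < del /\
    forall u : C, Cmod (u - z)%C < del -> Cmod (F u - F z)%C < e.

Lemma Cmod_minus_self (z : C) : Cmod (z - z)%C = 0.
Proof. replace (z - z)%C with (RtoC 0) by ring. apply Cmod_0. Qed.

Lemma Cmod_triangle_sub (a b c : C) : Cmod (a - c)%C <= Cmod (a - b)%C + Cmod (b - c)%C.
Proof. replace (a - c)%C with ((a - b) + (b - c))%C by ring. apply Cmod_triangle. Qed.

Lemma Cmod_sub_sym (a b : C) : Cmod (a - b)%C = Cmod (b - a)%C.
Proof. rewrite <- Cmod_opp. f_equal. ring. Qed.

Lemma Cmod_sub_ge (a b : C) : Cmod a - Cmod b <= Cmod (a - b)%C.
Proof.
  assert (H := Cmod_triangle (a - b) b).
  replace (a - b + b)%C with a in H by ring. lra.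
Qed.

Lemma sderiv_lip (F : C -> C) (z d : C) : sderiv F z d ->
  exists del, 0 < del /\ forall u v, Cmod (u - z)%C < del -> Cmod (v - z)%C < del ->
    Cmod (F u - F v)%C <= (Cmod d + 1) * Cmod (u - v)%C.
Proof.
  intros H. destruct (H 1 Rlt_0_1) as [del [Hd Hu]]. exists del; split; [exact Hd|].
  intros u v Hu1 Hv1. specialize (Hu u v Hu1 Hv1).
  replace (F u - F v)%C with ((F u - F v - d * (u - v)) + d * (u - v))%C by ring.
  eapply Rle_trans; [apply Cmod_triangle|]. rewrite Cmod_mult. lra.
Qed.

Lemma hol_cont (F : C -> C) (z : C) : hol_at F z -> cont_at F z.
Proof.
  intros [d Hd] e He. destruct (sderiv_lip F z d Hd) as [del [Hdel HL]].
  assert (Hk : 0 < Cmod d + 1) by (pose proof (Cmod_ge_0 d); lra).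
  exists (Rmin del (e / (Cmod d + 1))). split.
  { apply Rmin_glb_lt; [exact Hdel|]. apply Rdiv_lt_0_compat; lra. }
  intros u Hu.
  assert (H1 : Cmod (u - z)%C < del) by (eapply Rlt_le_trans; [exact Hu|apply Rmin_l]).
  assert (H2 : Cmod (u - z)%C < e / (Cmod d + 1))
    by (eapply Rlt_le_trans; [exact Hu|apply Rmin_r]).
  eapply Rle_lt_trans.
  - apply HL; [exact H1|]. rewrite Cmod_minus_self. exact Hdel.
  - apply Rlt_div_r in H2; lra.
Qed.

Lemma sderiv_local (F G : C -> C) (z d : C) (r : R) : 0 < r ->
  (forall u, Cmod (u - z)%C < r -> F u = G u) -> sderiv F z d -> sderiv G z d.
Proof.
  intros Hr E H e He. destruct (H e He) as [del [Hdel Hu]].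
  exists (Rmin del r). split; [apply Rmin_glb_lt; assumption|].
  intros u v Hu1 Hv1.
  pose proof (Rmin_l del r). pose proof (Rmin_r del r).
  rewrite <- !E by lra. apply Hu; lra.
Qed.

Lemma hol_local (F G : C -> C) (z : C) (r : R) : 0 < r ->
  (forall u, Cmod (u - z)%C < r -> F u = G u) -> hol_at F z -> hol_at G z.
Proof. intros Hr E [d H]. exists d. exact (sderiv_local F G z d r Hr E H). Qed.

Lemma sderiv_const (c z : C) : sderiv (fun _ => c) z 0%C.
Proof.
  intros e He. exists 1; split; [lra|]. intros u v _ _.
  replace (c - c - 0 * (u - v))%C with (RtoC 0) by ring. rewrite Cmod_0.
  apply Rmult_le_pos; [lra|apply Cmod_ge_0].
Qed.

Lemma sderiv_id (z : C) : sderiv (fun u => u) z 1%C.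
Proof.
  intros e He. exists 1; split; [lra|]. intros u v _ _.
  replace (u - v - 1 * (u - v))%C with (RtoC 0) by ring. rewrite Cmod_0.
  apply Rmult_le_pos; [lra|apply Cmod_ge_0].
Qed.

Lemma sderiv_plus (F G : C -> C) (z d d' : C) :
  sderiv F z d -> sderiv G z d' -> sderiv (fun u => F u + G u)%C z (d + d')%C.
Proof.
  intros HF HG e He.
  destruct (HF (e / 2) ltac:(lra)) as [d1 [Hd1 H1]].
  destruct (HG (e / 2) ltac:(lra)) as [d2 [Hd2 H2]].
  exists (Rmin d1 d2); split; [apply Rmin_glb_lt; assumption|].
  intros u v Hu Hv. pose proof (Rmin_l d1 d2). pose proof (Rmin_r d1 d2).
  specialize (H1 u v ltac:(lra) ltac:(lra)). specialize (H2 u v ltac:(lra) ltac:(lra)).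
  replace (F u + G u - (F v + G v) - (d + d') * (u - v))%C
    with ((F u - F v - d * (u - v)) + (G u - G v - d' * (u - v)))%C by ring.
  eapply Rle_trans; [apply Cmod_triangle|]. lra.
Qed.

Lemma sderiv_mult (F G : C -> C) (z d d' : C) :
  sderiv F z d -> sderiv G z d' -> sderiv (fun u => F u * G u)%C z (d * G z + F z * d')%C.
Proof.
  intros HF HG e He.
  (* [K] dominates [Cmod d], [Cmod d'] and, because [k <= 1], also [Cmod (G u)] and [Cmod (F v)]
     near [z]. Each of the four terms of the splitting below is then at most [k * K * m], which
     explains the 4. *)
  set (K := Cmod d + Cmod d' + Cmod (F z) + Cmod (G z) + 2).
  assert (HK : 0 < K) by (unfold K; pose proof (Cmod_ge_0 d); pose proof (Cmod_ge_0 d');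
    pose proof (Cmod_ge_0 (F z)); pose proof (Cmod_ge_0 (G z)); lra).
  assert (Hk1 : 0 < e / (4 * K)) by (apply Rdiv_lt_0_compat; lra).
  set (k := Rmin 1 (e / (4 * K))).
  assert (Hk : 0 < k) by (apply Rmin_glb_lt; lra).
  assert (HkK : 4 * (k * K) <= e).
  { replace e with (4 * (e / (4 * K) * K)) by (field; lra).
    apply Rmult_le_compat_l; [lra|]. apply Rmult_le_compat_r; [lra|]. apply Rmin_r. }
  assert (Hk2 : k <= 1) by apply Rmin_l.
  destruct (HF k Hk) as [d1 [Hd1 H1]].
  destruct (HG k Hk) as [d2 [Hd2 H2]].
  destruct (hol_cont F z (ex_intro _ _ HF) k Hk) as [d3 [Hd3 H3]].
  destruct (hol_cont G z (ex_intro _ _ HG) k Hk) as [d4 [Hd4 H4]].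
  exists (Rmin (Rmin d1 d2) (Rmin d3 d4)).
  split; [repeat apply Rmin_glb_lt; assumption|].
  intros u v Hu Hv.
  pose proof (Rmin_l d1 d2). pose proof (Rmin_r d1 d2).
  pose proof (Rmin_l d3 d4). pose proof (Rmin_r d3 d4).
  pose proof (Rmin_l (Rmin d1 d2) (Rmin d3 d4)). pose proof (Rmin_r (Rmin d1 d2) (Rmin d3 d4)).
  specialize (H1 u v ltac:(lra) ltac:(lra)). specialize (H2 u v ltac:(lra) ltac:(lra)).
  specialize (H3 v ltac:(lra)). specialize (H4 u ltac:(lra)).
  replace (F u * G u - F v * G v - (d * G z + F z * d') * (u - v))%C
    with ((F u - F v - d * (u - v)) * G u + d * (u - v) * (G u - G z)
          + (F v * (G u - G v - d' * (u - v)) + (F v - F z) * d' * (u - v)))%C by ring.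
  eapply Rle_trans; [apply Cmod_triangle|].
  eapply Rle_trans; [apply Rplus_le_compat; apply Cmod_triangle|].
  rewrite !Cmod_mult.
  assert (HGu : Cmod (G u) <= K).
  { pose proof (Cmod_sub_ge (G u) (G z)). unfold K.
    pose proof (Cmod_ge_0 d); pose proof (Cmod_ge_0 d'); pose proof (Cmod_ge_0 (F z)). lra. }
  assert (HFv : Cmod (F v) <= K).
  { pose proof (Cmod_sub_ge (F v) (F z)). unfold K.
    pose proof (Cmod_ge_0 d); pose proof (Cmod_ge_0 d'); pose proof (Cmod_ge_0 (G z)). lra. }
  assert (HdK : Cmod d <= K /\ Cmod d' <= K) by (unfold K; pose proof (Cmod_ge_0 d);
    pose proof (Cmod_ge_0 d'); pose proof (Cmod_ge_0 (F z)); pose proof (Cmod_ge_0 (G z)); lra).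
  destruct HdK as [HdK HdK'].
  set (m := Cmod (u - v)%C) in *.
  assert (Hm : 0 <= m) by apply Cmod_ge_0.
  assert (A1 : Cmod (F u - F v - d * (u - v))%C * Cmod (G u) <= k * m * K)
    by (apply Rmult_le_compat; auto using Cmod_ge_0).
  assert (A2 : Cmod d * m * Cmod (G u - G z)%C <= K * m * k).
  { apply Rmult_le_compat; try apply Cmod_ge_0; try lra.
    - apply Rmult_le_pos; [apply Cmod_ge_0|lra].
    - apply Rmult_le_compat_r; lra. }
  assert (A3 : Cmod (F v) * Cmod (G u - G v - d' * (u - v))%C <= K * (k * m))
    by (apply Rmult_le_compat; auto using Cmod_ge_0).
  assert (A4 : Cmod (F v - F z)%C * Cmod d' * m <= k * K * m).
  { apply Rmult_le_compat_r; [lra|]. apply Rmult_le_compat; try apply Cmod_ge_0; lra. }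
  eapply Rle_trans; [apply Rplus_le_compat; apply Rplus_le_compat; eassumption|].
  apply Rle_trans with (4 * (k * K) * m); [apply Req_le; ring|].
  apply Rmult_le_compat_r; lra.
Qed.

Lemma sderiv_comp (F G : C -> C) (z d d' : C) :
  sderiv G z d' -> sderiv F (G z) d -> sderiv (fun u => F (G u)) z (d * d')%C.
Proof.
  intros HG HF e He.
  set (K := Cmod d + Cmod d' + 1).
  assert (HK : 0 < K) by (unfold K; pose proof (Cmod_ge_0 d); pose proof (Cmod_ge_0 d'); lra).
  set (k := e / (2 * K)).
  assert (Hk : 0 < k) by (apply Rdiv_lt_0_compat; lra).
  assert (HkK : 2 * (k * K) = e) by (unfold k; field; lra).
  destruct (HF k Hk) as [d1 [Hd1 H1]].
  destruct (HG k Hk) as [d2 [Hd2 H2]].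
  destruct (hol_cont G z (ex_intro _ _ HG) d1 Hd1) as [d3 [Hd3 H3]].
  destruct (sderiv_lip G z d' HG) as [d4 [Hd4 H4]].
  exists (Rmin d2 (Rmin d3 d4)); split; [repeat apply Rmin_glb_lt; assumption|].
  intros u v Hu Hv.
  pose proof (Rmin_l d2 (Rmin d3 d4)). pose proof (Rmin_r d2 (Rmin d3 d4)).
  pose proof (Rmin_l d3 d4). pose proof (Rmin_r d3 d4).
  specialize (H1 (G u) (G v) (H3 u ltac:(lra)) (H3 v ltac:(lra))).
  specialize (H2 u v ltac:(lra) ltac:(lra)). specialize (H4 u v ltac:(lra) ltac:(lra)).
  replace (F (G u) - F (G v) - d * d' * (u - v))%C
    with ((F (G u) - F (G v) - d * (G u - G v)) + d * (G u - G v - d' * (u - v)))%C by ring.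
  eapply Rle_trans; [apply Cmod_triangle|]. rewrite Cmod_mult.
  set (m := Cmod (u - v)%C) in *.
  assert (Hm : 0 <= m) by apply Cmod_ge_0.
  assert (A1 : k * Cmod (G u - G v)%C <= k * (K * m)).
  { apply Rmult_le_compat_l; [lra|]. eapply Rle_trans; [exact H4|].
    apply Rmult_le_compat_r; [lra|]. unfold K. pose proof (Cmod_ge_0 d); lra. }
  assert (A2 : Cmod d * Cmod (G u - G v - d' * (u - v))%C <= K * (k * m)).
  { apply Rmult_le_compat; auto using Cmod_ge_0. unfold K. pose proof (Cmod_ge_0 d'); lra. }
  apply Rle_trans with (2 * (k * K) * m); [|rewrite HkK; lra]. lra.
Qed.

Lemma sderiv_inv (z : C) : z <> 0%C -> sderiv Cinv z (- (/ z * / z))%C.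
Proof.
  intros Hz e He.
  assert (Hm : 0 < Cmod z) by (apply Cmod_gt_0; exact Hz).
  set (m := Cmod z) in *.
  assert (Hm3 : 0 < m * m * m) by (repeat apply Rmult_lt_0_compat; lra).
  set (del := Rmin (m / 2) (e * (m * m * m) / 20)).
  assert (Hdel : 0 < del).
  { apply Rmin_glb_lt; [lra|]. apply Rdiv_lt_0_compat; [|lra]. apply Rmult_lt_0_compat; lra. }
  exists del; split; [exact Hdel|].
  intros u v Hu Hv.
  assert (Hd1 : del <= m / 2) by apply Rmin_l.
  assert (Hd2 : del <= e * (m * m * m) / 20) by apply Rmin_r.
  assert (Hu1 : m / 2 <= Cmod u).
  { pose proof (Cmod_sub_ge z u). rewrite Cmod_sub_sym in H. fold m in H. lra. }
  assert (Hv1 : m / 2 <= Cmod v).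
  { pose proof (Cmod_sub_ge z v). rewrite Cmod_sub_sym in H. fold m in H. lra. }
  assert (Hu0 : u <> 0%C) by (apply Cmod_gt_0; lra).
  assert (Hv0 : v <> 0%C) by (apply Cmod_gt_0; lra).
  (* The remainder is [(u v - z^2) (u - v) / (u v z^2)], and [u v - z^2 = (u - z) v + (v - z) z] is
     small with [del]. *)
  replace (/ u - / v - - (/ z * / z) * (u - v))%C
    with (((u - z) * v + (v - z) * z) * / (u * v * (z * z)) * (u - v))%C
    by (field; auto).
  rewrite !Cmod_mult, Cmod_inv by (repeat apply Cmult_neq_0; assumption).
  apply Rmult_le_compat_r; [apply Cmod_ge_0|].
  rewrite !Cmod_mult. fold m.
  assert (Hv2 : Cmod v <= 3 / 2 * m).
  { pose proof (Cmod_sub_ge v z). fold m in H. lra. }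
  assert (HN : Cmod ((u - z) * v + (v - z) * z)%C <= 5 / 2 * m * del).
  { eapply Rle_trans; [apply Cmod_triangle|]. rewrite !Cmod_mult. fold m.
    assert (Cmod (u - z)%C * Cmod v <= del * (3 / 2 * m))
      by (apply Rmult_le_compat; auto using Cmod_ge_0; lra).
    assert (Cmod (v - z)%C * m <= del * m) by (apply Rmult_le_compat_r; lra).
    lra. }
  assert (HD : m * m / 4 <= Cmod u * Cmod v).
  { replace (m * m / 4) with (m / 2 * (m / 2)) by field. apply Rmult_le_compat; lra. }
  apply Rle_div_l.
  { repeat apply Rmult_lt_0_compat; lra. }
  eapply Rle_trans; [exact HN|].
  apply Rle_trans with (e * (m * m / 4 * (m * m))).
  - apply Rle_trans with (5 / 2 * m * (e * (m * m * m) / 20)).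
    + apply Rmult_le_compat_l; lra.
    + assert (0 < e * (m * m * m * m)) by (repeat apply Rmult_lt_0_compat; lra). lra.
  - apply Rmult_le_compat_l; [lra|]. apply Rmult_le_compat_r; [|exact HD].
    apply Rmult_le_pos; lra.
Qed.

Lemma hol_const (c z : C) : hol_at (fun _ => c) z.
Proof. eexists; apply sderiv_const. Qed.

Lemma hol_id (z : C) : hol_at (fun u => u) z.
Proof. eexists; apply sderiv_id. Qed.

Lemma hol_plus (F G : C -> C) (z : C) :
  hol_at F z -> hol_at G z -> hol_at (fun u => F u + G u)%C z.
Proof. intros [d H] [d' H']. eexists; apply sderiv_plus; eassumption. Qed.

Lemma hol_mult (F G : C -> C) (z : C) :
  hol_at F z -> hol_at G z -> hol_at (fun u => F u * G u)%C z.
Proof. intros [d H] [d' H']. eexists; apply sderiv_mult; eassumption. Qed.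

Lemma hol_comp (F G : C -> C) (z : C) :
  hol_at G z -> hol_at F (G z) -> hol_at (fun u => F (G u)) z.
Proof. intros [d H] [d' H']. eexists; eapply sderiv_comp; eassumption. Qed.

Lemma hol_opp (F : C -> C) (z : C) : hol_at F z -> hol_at (fun u => - F u)%C z.
Proof.
  intros H. apply (hol_local (fun u => (-(1)) * F u)%C _ z 1 Rlt_0_1).
  - intros; ring.
  - apply hol_mult; [apply hol_const|exact H].
Qed.

Lemma hol_minus (F G : C -> C) (z : C) :
  hol_at F z -> hol_at G z -> hol_at (fun u => F u - G u)%C z.
Proof. intros. apply hol_plus; [assumption|apply hol_opp; assumption]. Qed.

Lemma hol_div (F G : C -> C) (z : C) :
  hol_at F z -> hol_at G z -> G z <> 0%C -> hol_at (fun u => F u / G u)%C z.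
Proof.
  intros HF HG Hz. apply hol_mult; [assumption|].
  apply (hol_comp Cinv G); [assumption|]. eexists; apply sderiv_inv; exact Hz.
Qed.

Lemma cont_mult (F G : C -> C) (z : C) :
  cont_at F z -> cont_at G z -> cont_at (fun u => F u * G u)%C z.
Proof.
  intros HF HG e He.
  set (K := Cmod (F z) + Cmod (G z) + 1).
  assert (HK : 0 < K) by (unfold K; pose proof (Cmod_ge_0 (F z)); pose proof (Cmod_ge_0 (G z)); lra).
  set (k := Rmin 1 (e / (2 * K))).
  assert (Hk : 0 < k) by (apply Rmin_glb_lt; [lra|apply Rdiv_lt_0_compat; lra]).
  assert (Hk1 : k <= 1) by apply Rmin_l.
  assert (HkK : k * K <= e / 2).
  { replace (e / 2) with (e / (2 * K) * K) by (field; lra).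
    apply Rmult_le_compat_r; [lra|apply Rmin_r]. }
  destruct (HF k Hk) as [d1 [Hd1 H1]]. destruct (HG k Hk) as [d2 [Hd2 H2]].
  exists (Rmin d1 d2). split; [apply Rmin_glb_lt; assumption|]. intros u Hu.
  pose proof (Rmin_l d1 d2). pose proof (Rmin_r d1 d2).
  specialize (H1 u ltac:(lra)). specialize (H2 u ltac:(lra)).
  replace (F u * G u - F z * G z)%C
    with ((F u - F z) * (G u - G z) + (F u - F z) * G z + F z * (G u - G z))%C by ring.
  eapply Rle_lt_trans; [apply Cmod_triangle|].
  eapply Rle_lt_trans; [apply Rplus_le_compat_r, Cmod_triangle|]. rewrite !Cmod_mult.
  pose proof (Cmod_ge_0 (F u - F z)%C). pose proof (Cmod_ge_0 (G u - G z)%C).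
  assert (Cmod (F u - F z)%C * Cmod (G u - G z)%C <= k * 1) by (apply Rmult_le_compat; lra).
  assert (Cmod (F u - F z)%C * Cmod (G z) <= k * Cmod (G z))
    by (apply Rmult_le_compat_r; [apply Cmod_ge_0|lra]).
  assert (Cmod (F z) * Cmod (G u - G z)%C <= Cmod (F z) * k)
    by (apply Rmult_le_compat_l; [apply Cmod_ge_0|lra]).
  assert (k * 1 + k * Cmod (G z) + Cmod (F z) * k = k * K) by (unfold K; ring).
  lra.
Qed.

(** * Complex exponential and logarithm *)

Definition cexp (z : C) : C := (exp (Re z) * cos (Im z), exp (Re z) * sin (Im z)).

(* Principal branch, meaningful for [0 < Re z] only. *)
Definition clog (z : C) : C := (ln (Cmod z), atan (Im z / Re z)).

Lemma cexp_plus (a b : C) : cexp (a + b)%C = (cexp a * cexp b)%C.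
Proof.
  destruct a as [x y], b as [x' y']. unfold cexp, Cmult, Cplus; simpl.
  rewrite exp_plus, cos_plus, sin_plus. f_equal; ring.
Qed.

Lemma Cmod_cexp (z : C) : Cmod (cexp z) = exp (Re z).
Proof.
  unfold Cmod, cexp; simpl.
  replace (exp (Re z) * cos (Im z) * (exp (Re z) * cos (Im z) * 1)
     + exp (Re z) * sin (Im z) * (exp (Re z) * sin (Im z) * 1))
    with (exp (Re z) * exp (Re z) * ((sin (Im z))² + (cos (Im z))²)) by (unfold Rsqr; ring).
  rewrite sin2_cos2, Rmult_1_r. apply sqrt_square. left; apply exp_pos.
Qed.

Lemma cexp_neq_0 (z : C) : cexp z <> 0%C.
Proof. apply Cmod_gt_0. rewrite Cmod_cexp. apply exp_pos. Qed.

Lemma Im_le_Cmod (z : C) : Rabs (Im z) <= Cmod z.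
Proof. eapply Rle_trans; [apply Rmax_r|apply Rmax_Cmod]. Qed.

Lemma Cmod_le_Re_Im (z : C) : Cmod z <= Rabs (Re z) + Rabs (Im z).
Proof.
  replace z with (RtoC (Re z) + Ci * RtoC (Im z))%C at 1
    by (destruct z; unfold Ci, RtoC, Cplus, Cmult; simpl; f_equal; ring).
  eapply Rle_trans; [apply Cmod_triangle|].
  rewrite Cmod_mult, Cmod_Ci, !Cmod_R. lra.
Qed.

Lemma derivable_pt_lim_0_littleo (f : R -> R) (l : R) : derivable_pt_lim f 0 l ->
  forall e, 0 < e -> exists del, 0 < del /\
    forall h, Rabs h < del -> Rabs (f h - f 0 - l * h) <= e * Rabs h.
Proof.
  intros H e He. destruct (H e He) as [del Hd]. exists del; split; [apply cond_pos|].
  intros h Hh. destruct (Req_dec h 0) as [->|Hn].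
  - replace (f 0 - f 0 - l * 0) with 0 by ring. rewrite Rabs_R0. lra.
  - specialize (Hd h Hn Hh). rewrite Rplus_0_l in Hd.
    replace (f h - f 0 - l * h) with (((f h - f 0) / h - l) * h) by (field; exact Hn).
    rewrite Rabs_mult. apply Rmult_le_compat_r; [apply Rabs_pos|lra].
Qed.

(** Both components of the remainder are combinations of the first-order remainders of the real
    [exp], [sin] and [cos] at 0, apart from the cross term [(exp x - 1) * y], which is small because
    [exp x - 1] is. *)
Lemma cexp_littleo (e : R) : 0 < e -> exists del, 0 < del /\
  forall h : C, Cmod h < del -> Cmod (cexp h - 1 - h)%C <= e * Cmod h.
Proof.
  intros He. set (k := Rmin 1 (e / 10)).
  assert (Hk : 0 < k) by (apply Rmin_glb_lt; lra).
  assert (Hk1 : k <= 1) by apply Rmin_l. assert (Hke : k <= e / 10) by apply Rmin_r.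
  destruct (derivable_pt_lim_0_littleo exp 1 derivable_pt_lim_exp_0 k Hk) as [d1 [Hd1 H1]].
  destruct (derivable_pt_lim_0_littleo sin 1 derivable_pt_lim_sin_0 k Hk) as [d2 [Hd2 H2]].
  destruct (derivable_pt_lim_0_littleo cos 0 derivable_pt_lim_cos_0 k Hk) as [d3 [Hd3 H3]].
  exists (Rmin (Rmin d1 d2) (Rmin d3 k)).
  split; [repeat first [assumption|apply Rmin_glb_lt]|].
  intros h Hh.
  pose proof (Rmin_l d1 d2). pose proof (Rmin_r d1 d2).
  pose proof (Rmin_l d3 k). pose proof (Rmin_r d3 k).
  pose proof (Rmin_l (Rmin d1 d2) (Rmin d3 k)). pose proof (Rmin_r (Rmin d1 d2) (Rmin d3 k)).
  pose proof (re_le_Cmod h) as Hre. pose proof (Im_le_Cmod h) as Him.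
  destruct h as [x y]. simpl in Hre, Him. set (m := Cmod (x, y)) in *.
  specialize (H1 x ltac:(lra)). specialize (H2 y ltac:(lra)). specialize (H3 y ltac:(lra)).
  rewrite exp_0 in H1. rewrite sin_0 in H2. rewrite cos_0 in H3.
  replace (sin y - 0 - 1 * y) with (sin y - y) in H2 by ring.
  replace (cos y - 1 - 0 * y) with (cos y - 1) in H3 by ring.
  assert (Hm : 0 <= m) by apply Cmod_ge_0.
  assert (A : Rabs (exp x - 1) <= 2 * k).
  { replace (exp x - 1) with ((exp x - 1 - 1 * x) + x) by ring.
    eapply Rle_trans; [apply Rabs_triang|].
    assert (k * Rabs x <= 1 * Rabs x) by (apply Rmult_le_compat_r; [apply Rabs_pos|lra]). lra. }
  assert (B : exp x <= 3).
  { pose proof (Rle_abs (exp x - 1)). lra. }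
  eapply Rle_trans; [apply Cmod_le_Re_Im|]. simpl.
  replace (exp x * cos y + - (1) + - x) with ((exp x - 1 - 1 * x) + exp x * (cos y - 1)) by ring.
  replace (exp x * sin y + - 0 + - y) with (exp x * (sin y - y) + (exp x - 1) * y) by ring.
  eapply Rle_trans; [apply Rplus_le_compat; apply Rabs_triang|]. rewrite !Rabs_mult.
  rewrite (Rabs_pos_eq (exp x)) by (left; apply exp_pos).
  assert (E1 : Rabs (exp x - 1 - 1 * x) <= k * m)
    by (eapply Rle_trans; [exact H1|]; apply Rmult_le_compat_l; lra).
  assert (E0 : k * Rabs y <= k * m) by (apply Rmult_le_compat_l; lra).
  assert (E2 : exp x * Rabs (cos y - 1) <= 3 * (k * m))
    by (apply Rmult_le_compat; try (left; apply exp_pos); try apply Rabs_pos; lra).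
  assert (E3 : exp x * Rabs (sin y - y) <= 3 * (k * m))
    by (apply Rmult_le_compat; try (left; apply exp_pos); try apply Rabs_pos; lra).
  assert (E4 : Rabs (exp x - 1) * Rabs y <= 2 * k * m)
    by (apply Rmult_le_compat; try apply Rabs_pos; lra).
  assert (0 <= k * m) by (apply Rmult_le_pos; lra).
  apply Rle_trans with (10 * k * m); [lra|]. apply Rmult_le_compat_r; lra.
Qed.

(** The addition formula gives [cexp u - cexp v = cexp v * (cexp (u - v) - 1)], so the expansion at
    0 is used twice: for the increment [u - v], and for [v - z] to replace the factor [cexp v] by
    [cexp z]. *)
Lemma sderiv_cexp (z : C) : sderiv cexp z (cexp z).
Proof.
  intros e He. set (E := exp (Re z)). assert (HE : 0 < E) by apply exp_pos.
  set (k := Rmin 1 (e / (8 * E))).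
  assert (Hk : 0 < k) by (apply Rmin_glb_lt; [lra|]; apply Rdiv_lt_0_compat; lra).
  assert (Hk1 : k <= 1) by apply Rmin_l.
  assert (HkE : 8 * (E * k) <= e).
  { replace e with (8 * (E * (e / (8 * E)))) by (field; lra).
    apply Rmult_le_compat_l; [lra|]. apply Rmult_le_compat_l; [lra|]. apply Rmin_r. }
  destruct (cexp_littleo k Hk) as [d1 [Hd1 H1]].
  exists (Rmin (d1 / 2) (k / 2)). split; [apply Rmin_glb_lt; lra|].
  intros u v Hu Hv. pose proof (Rmin_l (d1 / 2) (k / 2)). pose proof (Rmin_r (d1 / 2) (k / 2)).
  assert (Huv : Cmod (u - v)%C < d1).
  { pose proof (Cmod_triangle_sub u z v). rewrite (Cmod_sub_sym z v) in H2. lra. }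
  pose proof (H1 _ Huv) as Ha. pose proof (H1 (v - z)%C ltac:(lra)) as Hb.
  replace (cexp u - cexp v - cexp z * (u - v))%C
    with (cexp v * (cexp (u - v) - 1 - (u - v)) + cexp z * (cexp (v - z) - 1) * (u - v))%C.
  2:{ replace (cexp u) with (cexp v * cexp (u - v))%C by (rewrite <- cexp_plus; f_equal; ring).
      replace (cexp v) with (cexp z * cexp (v - z))%C by (rewrite <- cexp_plus; f_equal; ring).
      ring. }
  assert (Hc : Cmod (cexp (v - z) - 1)%C <= k).
  { replace (cexp (v - z) - 1)%C with ((cexp (v - z) - 1 - (v - z)) + (v - z))%C by ring.
    eapply Rle_trans; [apply Cmod_triangle|].
    pose proof (Cmod_ge_0 (v - z)%C).
    assert (k * Cmod (v - z)%C <= 1 * Cmod (v - z)%C) by (apply Rmult_le_compat_r; lra). lra. }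
  assert (Hev : Cmod (cexp v) <= 2 * E).
  { replace (cexp v) with (cexp z * (cexp (v - z) - 1) + cexp z)%C.
    2:{ replace (cexp v) with (cexp z * cexp (v - z))%C by (rewrite <- cexp_plus; f_equal; ring). ring. }
    eapply Rle_trans; [apply Cmod_triangle|]. rewrite Cmod_mult, Cmod_cexp. fold E.
    assert (E * Cmod (cexp (v - z) - 1)%C <= E * 1) by (apply Rmult_le_compat_l; lra). lra. }
  eapply Rle_trans; [apply Cmod_triangle|]. rewrite !Cmod_mult.
  rewrite (Cmod_cexp z). fold E.
  set (m := Cmod (u - v)%C) in *. assert (Hm : 0 <= m) by apply Cmod_ge_0.
  assert (B1 : Cmod (cexp v) * Cmod (cexp (u - v) - 1 - (u - v))%C <= 2 * E * (k * m))
    by (apply Rmult_le_compat; auto using Cmod_ge_0).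
  assert (B2 : E * Cmod (cexp (v - z) - 1)%C * m <= E * k * m).
  { apply Rmult_le_compat_r; [lra|]. apply Rmult_le_compat_l; lra. }
  apply Rle_trans with (8 * (E * k) * m).
  - assert (0 <= E * k * m) by (repeat apply Rmult_le_pos; lra). lra.
  - apply Rmult_le_compat_r; lra.
Qed.

Lemma hol_cexp (F : C -> C) (z : C) : hol_at F z -> hol_at (fun u => cexp (F u)) z.
Proof. intros H. apply (hol_comp cexp F); [exact H|]. eexists; apply sderiv_cexp. Qed.

Lemma cexp_clog (z : C) : 0 < Re z -> cexp (clog z) = z.
Proof.
  intros Hz. destruct z as [x y]. unfold clog, cexp. simpl in *.
  assert (Hm : 0 < Cmod (x, y)).
  { pose proof (re_le_Cmod (x, y)). simpl in H. pose proof (Rle_abs x). lra. }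
  rewrite exp_ln by exact Hm. rewrite cos_atan, sin_atan.
  assert (Hs : Cmod (x, y) = x * sqrt (1 + (y / x)²)).
  { unfold Cmod; simpl.
    replace (x * (x * 1) + y * (y * 1)) with (x * x * (1 + (y / x)²)) by (unfold Rsqr; field; lra).
    rewrite sqrt_mult_alt by nra. rewrite sqrt_square by lra. reflexivity. }
  assert (0 < sqrt (1 + (y / x)²)).
  { apply sqrt_lt_R0. pose proof (Rle_0_sqr (y / x)). lra. }
  rewrite Hs. f_equal; field; lra.
Qed.

Lemma cont_clog (z : C) : 0 < Re z -> cont_at clog z.
Proof.
  intros Hz e He. destruct z as [x y]. simpl in Hz.
  assert (H1 : continuity_2d_pt (fun x y => ln (Cmod (x, y))) x y).
  { unfold Cmod; simpl.
    apply (continuity_1d_2d_pt_comp (fun t => ln (sqrt t))).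
    - apply (continuity_pt_comp sqrt ln).
      + apply continuity_pt_sqrt. nra.
      + apply derivable_continuous_pt. exists (/ sqrt (x * (x * 1) + y * (y * 1))).
        apply derivable_pt_lim_ln. apply sqrt_lt_R0. nra.
    - repeat first [apply continuity_2d_pt_plus | apply continuity_2d_pt_mult
        | apply continuity_2d_pt_const | apply continuity_2d_pt_id1 | apply continuity_2d_pt_id2]. }
  assert (H2 : continuity_2d_pt (fun x y => atan (y / x)) x y).
  { apply (continuity_1d_2d_pt_comp atan).
    - apply derivable_continuous_pt, derivable_pt_atan.
    - apply continuity_2d_pt_mult; [apply continuity_2d_pt_id2|].
      apply continuity_2d_pt_inv; [apply continuity_2d_pt_id1|lra]. }
  destruct (H1 (mkposreal (e / 2) ltac:(lra))) as [d1 K1].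
  destruct (H2 (mkposreal (e / 2) ltac:(lra))) as [d2 K2].
  exists (Rmin d1 d2); split; [apply Rmin_glb_lt; apply cond_pos|].
  intros [a b] Hu. pose proof (Rmin_l d1 d2). pose proof (Rmin_r d1 d2).
  pose proof (re_le_Cmod ((a, b) - (x, y))%C) as Ra. pose proof (Im_le_Cmod ((a, b) - (x, y))%C) as Ia.
  simpl in Ra, Ia.
  assert (Ra' : Rabs (a - x) < Rmin d1 d2) by (unfold Rminus; lra).
  assert (Ia' : Rabs (b - y) < Rmin d1 d2) by (unfold Rminus; lra).
  specialize (K1 a b ltac:(lra) ltac:(lra)). specialize (K2 a b ltac:(lra) ltac:(lra)).
  simpl in K1, K2.
  eapply Rle_lt_trans; [apply Cmod_le_Re_Im|]. simpl. unfold Rminus in *. lra.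
Qed.

(** Inverse function argument: the strict estimate for [cexp] at [clog z], evaluated at [clog u] and
    [clog v], compares [u - v] with [z * L]. Continuity of [clog] puts these two points within the
    radius where that estimate holds. *)
Lemma sderiv_clog (z : C) : 0 < Re z -> sderiv clog z (/ z)%C.
Proof.
  intros Hz e He.
  assert (Hm : 0 < Cmod z) by (pose proof (re_le_Cmod z); pose proof (Rle_abs (Re z)); lra).
  assert (Hz0 : z <> 0%C) by (apply Cmod_gt_0; exact Hm).
  set (m := Cmod z) in *.
  set (k := Rmin (m / 2) (e * (m * m) / 2)).
  assert (Hk : 0 < k).
  { apply Rmin_glb_lt; [lra|]. apply Rdiv_lt_0_compat; [|lra]. repeat apply Rmult_lt_0_compat; lra. }
  assert (Hk1 : k <= m / 2) by apply Rmin_l. assert (Hk2 : k <= e * (m * m) / 2) by apply Rmin_r.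
  destruct (sderiv_cexp (clog z) k Hk) as [d1 [Hd1 H1]]. rewrite cexp_clog in H1 by exact Hz.
  destruct (cont_clog z Hz d1 Hd1) as [d2 [Hd2 H2]].
  exists (Rmin d2 (Re z)); split; [apply Rmin_glb_lt; lra|].
  intros u v Hu Hv. pose proof (Rmin_l d2 (Re z)). pose proof (Rmin_r d2 (Re z)).
  assert (Hre : forall w, Cmod (w - z)%C < Re z -> 0 < Re w).
  { intros w Hw. pose proof (re_le_Cmod (w - z)%C) as Q.
    replace (Re (w - z)%C) with (Re w - Re z) in Q by (destruct w, z; simpl; ring).
    apply Rabs_le_between in Q. lra. }
  specialize (H1 _ _ (H2 u ltac:(lra)) (H2 v ltac:(lra))).
  rewrite !cexp_clog in H1 by (apply Hre; lra).
  set (L := (clog u - clog v)%C) in *.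
  (* As [k <= m / 2], the error [k * Cmod L] is absorbed by half of [m * Cmod L]. This makes [clog]
     Lipschitz near [z], so an error relative to [L] becomes one relative to [u - v]. *)
  assert (HL : m * Cmod L <= 2 * Cmod (u - v)%C).
  { pose proof (Cmod_sub_ge (z * L)%C (u - v)%C) as Q. rewrite (Cmod_sub_sym (z * L)%C) in Q.
    rewrite Cmod_mult in Q. fold m in Q.
    assert (k * Cmod L <= m / 2 * Cmod L) by (apply Rmult_le_compat_r; [apply Cmod_ge_0|lra]). lra. }
  apply Rmult_le_reg_l with (m * m); [apply Rmult_lt_0_compat; lra|].
  replace (L - / z * (u - v))%C with (- / z * (u - v - z * L))%C by (field; exact Hz0).
  rewrite Cmod_mult, Cmod_opp, Cmod_inv by exact Hz0. fold m.
  replace (m * m * (/ m * Cmod (u - v - z * L)%C)) with (m * Cmod (u - v - z * L)%C) by (field; lra).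
  apply Rle_trans with (m * (k * Cmod L)); [apply Rmult_le_compat_l; lra|].
  apply Rle_trans with (k * (2 * Cmod (u - v)%C)).
  { replace (m * (k * Cmod L)) with (k * (m * Cmod L)) by ring. apply Rmult_le_compat_l; lra. }
  replace (m * m * (e * Cmod (u - v)%C)) with (e * (m * m) / 2 * (2 * Cmod (u - v)%C)) by field.
  apply Rmult_le_compat_r; [|lra]. pose proof (Cmod_ge_0 (u - v)%C). lra.
Qed.

Lemma hol_clog (F : C -> C) (z : C) : hol_at F z -> 0 < Re (F z) -> hol_at (fun u => clog (F u)) z.
Proof. intros H H'. apply (hol_comp clog F); [exact H|]. eexists; apply sderiv_clog; exact H'. Qed.

(** * Power series *)

Definition psum (a : nat -> C) (w : C) (n : nat) : C :=
  sum_n (fun k => (w ^ k * a k)%C) n.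

Lemma psum_S (a : nat -> C) (w : C) (n : nat) :
  psum a w (S n) = (psum a w n + w ^ S n * a (S n))%C.
Proof. unfold psum. rewrite sum_Sn. reflexivity. Qed.

Lemma psum_0 (a : nat -> C) (w : C) : psum a w 0 = a 0%nat.
Proof. unfold psum. rewrite sum_O. simpl. ring. Qed.

Lemma is_pseries_Cmod (a : nat -> C) (w l : C) :
  is_pseries (K := C_AbsRing) (V := C_NormedModule) a w l <->
  forall e, 0 < e -> exists N, forall n, (N <= n)%nat -> Cmod (psum a w n - l)%C < e.
Proof.
  assert (E : forall n, sum_n (fun k => scal (pow_n (K := C_AbsRing) w k) (a k : C_NormedModule)) n
     = psum a w n).
  { intros n. unfold psum. apply sum_n_ext. intros k. unfold scal; simpl. unfold mult; simpl.
    f_equal. }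
  unfold is_pseries, is_series.
  rewrite (filterlim_locally_ball_norm (K := C_AbsRing) (U := C_NormedModule)). split.
  - intros H e He. destruct (H (mkposreal e He)) as [N HN]. exists N. intros n Hn.
    specialize (HN n Hn). unfold ball_norm in HN. rewrite E in HN. exact HN.
  - intros H e. destruct (H e (cond_pos e)) as [N HN]. exists N. intros n Hn.
    unfold ball_norm. rewrite E. exact (HN n Hn).
Qed.

(** The uniform structure on [C] is that of a product, whose balls are squares; the factor [sqrt 2]
    compares them with discs. *)
Lemma locally_Cmod (z : C) (P : C -> Prop) :
  locally z P <-> exists r, 0 < r /\ forall u : C, Cmod (u - z)%C < r -> P u.
Proof.
  split.
  - intros [e H]. exists e; split; [apply cond_pos|]. intros u Hu. apply H.
    apply C_NormedModule_mixin_compat1. exact Hu.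
  - intros [r [Hr H]].
    assert (H2 : 0 < sqrt 2) by (apply sqrt_lt_R0; lra).
    exists (mkposreal (r / sqrt 2) ltac:(apply Rdiv_lt_0_compat; assumption)).
    intros u Hu. apply H. apply C_NormedModule_mixin_compat2 in Hu. simpl in Hu.
    replace (sqrt 2 * (r / sqrt 2)) with r in Hu by (field; lra). exact Hu.
Qed.

Lemma analytic_at_Cmod (f : C -> C) (z0 : C) : analytic_at f z0 <->
  exists a r, 0 < r /\ forall z, Cmod (z - z0)%C < r ->
    is_pseries (K := C_AbsRing) (V := C_NormedModule) a (z - z0)%C (f z).
Proof.
  split.
  - intros [a H]. apply locally_Cmod in H. destruct H as [r H]. exists a, r. exact H.
  - intros [a [r H]]. exists a. apply locally_Cmod. exists r. exact H.
Qed.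

Lemma finite_bound (u : nat -> R) (N : nat) : exists M, 0 < M /\ forall n, (n <= N)%nat -> u n <= M.
Proof.
  induction N as [|N [M [HM IH]]].
  - exists (Rabs (u 0%nat) + 1). split; [pose proof (Rabs_pos (u 0%nat)); lra|].
    intros n Hn. replace n with 0%nat by lia. pose proof (Rle_abs (u 0%nat)); lra.
  - exists (Rmax M (u (S N))). split; [eapply Rlt_le_trans; [exact HM|apply Rmax_l]|].
    intros n Hn. destruct (Nat.eq_dec n (S N)) as [->|]; [apply Rmax_r|].
    eapply Rle_trans; [apply IH; lia|apply Rmax_l].
Qed.

(** Terms of a convergent series are bounded: beyond [N] a term is the difference of two partial
    sums within 1 of [l], hence at most 2. Such geometric bounds are the form in which convergence
    is used from here on. *)
Lemma pseries_coef_bound (a : nat -> C) (w l : C) : w <> 0%C ->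
  is_pseries (K := C_AbsRing) (V := C_NormedModule) a w l ->
  exists M, 0 < M /\ forall n, Cmod (a n) <= M * (/ Cmod w) ^ n.
Proof.
  intros Hw H. rewrite is_pseries_Cmod in H. destruct (H 1 Rlt_0_1) as [N HN].
  destruct (finite_bound (fun n => Cmod (w ^ n * a n)%C) N) as [M [HM HMb]].
  apply Cmod_gt_0 in Hw.
  exists (M + 2). split; [lra|]. intros n.
  assert (A : Cmod (w ^ n * a n)%C <= M + 2).
  { destruct (Nat.le_gt_cases n N) as [Hn|Hn]; [specialize (HMb n Hn); simpl in HMb; lra|].
    destruct n as [|n]; [lia|].
    replace (w ^ S n * a (S n))%C with ((psum a w (S n) - l) - (psum a w n - l))%C
      by (rewrite psum_S; ring).
    pose proof (HN (S n) ltac:(lia)). pose proof (HN n ltac:(lia)).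
    pose proof (Cmod_triangle (psum a w (S n) - l)%C (- (psum a w n - l))%C).
    rewrite Cmod_opp in H2. unfold Cminus at 1. lra. }
  rewrite Cmod_mult, Cmod_pow in A.
  rewrite pow_inv. apply Rle_div_r; [apply pow_lt; exact Hw|]. lra.
Qed.

Lemma INR_le_pow2 (n : nat) : INR n <= 2 ^ n.
Proof.
  induction n as [|n IH]; [simpl; lra|].
  rewrite S_INR. simpl. assert (1 <= 2 ^ n) by (apply pow_R1_Rle; lra). lra.
Qed.

(** The factor [rho] on the left turns the usual [n * rho ^ (n - 1)] into [INR n * rho ^ n] and so
    avoids a truncated subtraction. *)
Lemma Cpow_lip (rho : R) (u v : C) (n : nat) : Cmod u <= rho -> Cmod v <= rho ->
  rho * Cmod (u ^ n - v ^ n)%C <= INR n * rho ^ n * Cmod (u - v)%C.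
Proof.
  intros Hu Hv. assert (Hr : 0 <= rho) by (eapply Rle_trans; [apply Cmod_ge_0|exact Hu]).
  induction n as [|n IH].
  - simpl. replace (1 - 1)%C with (RtoC 0) by ring. rewrite Cmod_0. lra.
  - replace (u ^ S n - v ^ S n)%C with (u * (u ^ n - v ^ n) + v ^ n * (u - v))%C
      by (rewrite !Cpow_S; ring).
    eapply Rle_trans; [apply Rmult_le_compat_l; [exact Hr|apply Cmod_triangle]|].
    rewrite !Cmod_mult, Cmod_pow, S_INR.
    assert (A : rho * (Cmod u * Cmod (u ^ n - v ^ n)%C) <= rho * (INR n * rho ^ n * Cmod (u - v)%C)).
    { replace (rho * (Cmod u * Cmod (u ^ n - v ^ n)%C))
        with (Cmod u * (rho * Cmod (u ^ n - v ^ n)%C)) by ring.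
      apply Rmult_le_compat; try apply Cmod_ge_0; try assumption.
      apply Rmult_le_pos; [exact Hr|apply Cmod_ge_0]. }
    assert (B : Cmod v ^ n * Cmod (u - v)%C <= rho ^ n * Cmod (u - v)%C).
    { apply Rmult_le_compat_r; [apply Cmod_ge_0|]. apply pow_incr. split; [apply Cmod_ge_0|exact Hv]. }
    apply Rmult_le_compat_l with (r := rho) in B; [|exact Hr]. simpl. lra.
Qed.

(** The terms of degree 0 and 1 cancel, and [INR n <= 2 ^ n] bounds the others by a geometric series
    of ratio [q = 2 * B * rho], whose leading term is quadratic in [rho]. *)
Lemma psum_lip (a : nat -> C) (M B rho : R) (u v : C) (n : nat) :
  0 < M -> 0 < B -> 0 < rho -> 2 * B * rho <= / 2 ->
  (forall n, Cmod (a n) <= M * B ^ n) -> Cmod u <= rho -> Cmod v <= rho ->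
  Cmod (psum a u (S n) - psum a v (S n) - a 1%nat * (u - v))%C
    <= 8 * M * B ^ 2 * rho * Cmod (u - v)%C.
Proof.
  intros HM HB Hr Hq Ha Hu Hv. set (q := 2 * B * rho) in *.
  assert (Hq0 : 0 < q) by (unfold q; repeat apply Rmult_lt_0_compat; lra).
  set (m := Cmod (u - v)%C). assert (Hm : 0 <= m) by apply Cmod_ge_0.
  (* The negative term makes the induction close: adding [q ^ k] is allowed because
     [q ^ k <= 2 * q ^ k - 2 * q ^ S k] when [q <= 1 / 2]. *)
  assert (S1 : rho * Cmod (psum a u (S n) - psum a v (S n) - a 1%nat * (u - v))%C
    <= M * m * (2 * q ^ 2 - 2 * q ^ S (S n))).
  { induction n as [|n IH].
    - rewrite !psum_S, !psum_0.
      replace (a 0%nat + u ^ 1 * a 1%nat - (a 0%nat + v ^ 1 * a 1%nat) - a 1%nat * (u - v))%C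
        with (RtoC 0) by (rewrite !Cpow_1_r; ring).
      rewrite Cmod_0. simpl. lra.
    - rewrite (psum_S a u (S n)), (psum_S a v (S n)). set (k := S (S n)) in *.
      replace (psum a u (S n) + u ^ k * a k - (psum a v (S n) + v ^ k * a k) - a 1%nat * (u - v))%C
        with ((psum a u (S n) - psum a v (S n) - a 1%nat * (u - v)) + a k * (u ^ k - v ^ k))%C by ring.
      eapply Rle_trans; [apply Rmult_le_compat_l; [lra|apply Cmod_triangle]|]. rewrite Cmod_mult.
      pose proof (Cpow_lip rho u v k Hu Hv) as L. fold m in L.
      assert (A : Cmod (a k) * (rho * Cmod (u ^ k - v ^ k)%C) <= M * B ^ k * (2 ^ k * rho ^ k * m)).
      { apply Rmult_le_compat; try apply Cmod_ge_0; [|apply Ha|].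
        - apply Rmult_le_pos; [lra|apply Cmod_ge_0].
        - eapply Rle_trans; [exact L|]. apply Rmult_le_compat_r; [exact Hm|].
          apply Rmult_le_compat_r; [apply pow_le; lra|]. apply INR_le_pow2. }
      replace (M * B ^ k * (2 ^ k * rho ^ k * m)) with (M * m * q ^ k) in A
        by (unfold q; rewrite !Rpow_mult_distr; ring).
      assert (0 <= M * m * (q ^ k * (1 - 2 * q))).
      { apply Rmult_le_pos; [apply Rmult_le_pos; lra|]. apply Rmult_le_pos; [apply pow_le; lra|lra]. }
      replace (q ^ S k) with (q * q ^ k) by reflexivity. lra. }
  apply Rmult_le_reg_l with rho; [exact Hr|].
  eapply Rle_trans; [exact S1|].
  apply Rle_trans with (M * m * (2 * q ^ 2)).
  - apply Rmult_le_compat_l; [apply Rmult_le_pos; lra|].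
    assert (0 < q ^ S (S n)) by (apply pow_lt; exact Hq0). lra.
  - unfold q. apply Req_le. ring.
Qed.

Lemma pseries_conv_bound (a b : nat -> C) (u v lu lv c : C) (K : R) :
  is_pseries (K := C_AbsRing) (V := C_NormedModule) a u lu ->
  is_pseries (K := C_AbsRing) (V := C_NormedModule) b v lv ->
  (forall n, Cmod (psum a u (S n) - psum b v (S n) - c)%C <= K) ->
  Cmod (lu - lv - c)%C <= K.
Proof.
  rewrite !is_pseries_Cmod. intros Hu Hv H. apply Rnot_lt_le. intros HK.
  set (e := (Cmod (lu - lv - c)%C - K) / 2).
  assert (He : 0 < e) by (unfold e; lra).
  destruct (Hu e He) as [N1 H1]. destruct (Hv e He) as [N2 H2].
  set (n := (N1 + N2)%nat). specialize (H n). specialize (H1 (S n) ltac:(lia)).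
  specialize (H2 (S n) ltac:(lia)).
  assert (Q : Cmod (lu - lv - c)%C <= Cmod (psum a u (S n) - psum b v (S n) - c)%C
     + Cmod (psum a u (S n) - lu)%C + Cmod (psum b v (S n) - lv)%C).
  { replace (lu - lv - c)%C with ((psum a u (S n) - psum b v (S n) - c)
      + - (psum a u (S n) - lu) + (psum b v (S n) - lv))%C by ring.
    eapply Rle_trans; [apply Cmod_triangle|]. apply Rplus_le_compat_r.
    eapply Rle_trans; [apply Cmod_triangle|]. rewrite Cmod_opp. lra. }
  unfold e in *. lra.
Qed.

Lemma analytic_coef_bound (f : C -> C) (z0 : C) (a : nat -> C) (r : R) : 0 < r ->
  (forall z, Cmod (z - z0)%C < r ->
    is_pseries (K := C_AbsRing) (V := C_NormedModule) a (z - z0)%C (f z)) ->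
  exists M B, 0 < M /\ 0 < B /\ forall n, Cmod (a n) <= M * B ^ n.
Proof.
  intros Hr H.
  assert (Hw : Cmod (RtoC (r / 2)) = r / 2) by (rewrite Cmod_R; apply Rabs_pos_eq; lra).
  destruct (pseries_coef_bound a (RtoC (r / 2)) (f (z0 + RtoC (r / 2))%C)) as [M [HM Ha]].
  - apply Cmod_gt_0. lra.
  - replace (RtoC (r / 2)) with (z0 + RtoC (r / 2) - z0)%C at 1 by ring. apply H.
    replace (z0 + RtoC (r / 2) - z0)%C with (RtoC (r / 2)) by ring. lra.
  - exists M, (/ Cmod (RtoC (r / 2))). repeat split; try assumption.
    apply Rinv_0_lt_compat. lra.
Qed.

(** The constant [8 * M * B ^ 2 * rho] of [psum_lip] tends to 0 with [rho], so the derivative is the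
    coefficient [a 1]. Only the centre of the expansion is treated; at other points
    differentiability comes from their own expansions. *)
Lemma analytic_hol (f : C -> C) (z0 : C) : analytic_at f z0 -> hol_at f z0.
Proof.
  intros H. apply analytic_at_Cmod in H. destruct H as [a [r [Hr H]]].
  destruct (analytic_coef_bound f z0 a r Hr H) as [M [B [HM [HB Ha]]]].
  exists (a 1%nat). intros e He.
  set (rho := Rmin r (Rmin (/ (4 * B)) (e / (8 * M * B ^ 2)))).
  assert (HB2 : 0 < 8 * M * B ^ 2) by (repeat apply Rmult_lt_0_compat; try lra; apply pow_lt; lra).
  assert (Hrho : 0 < rho).
  { repeat apply Rmin_glb_lt; [exact Hr| |].
    - apply Rinv_0_lt_compat. lra.
    - apply Rdiv_lt_0_compat; assumption. }
  assert (R1 : rho <= r) by apply Rmin_l.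
  assert (R2 : rho <= / (4 * B)) by (eapply Rle_trans; [apply Rmin_r|apply Rmin_l]).
  assert (R3 : rho <= e / (8 * M * B ^ 2)) by (eapply Rle_trans; [apply Rmin_r|apply Rmin_r]).
  exists rho; split; [exact Hrho|]. intros u v Hu Hv.
  replace (a 1%nat * (u - v))%C with (a 1%nat * ((u - z0) - (v - z0)))%C by ring.
  replace (Cmod (u - v)%C) with (Cmod ((u - z0) - (v - z0))%C) by (f_equal; ring).
  apply (pseries_conv_bound a a (u - z0) (v - z0)); [apply H; lra|apply H; lra|].
  intros n. eapply Rle_trans; [apply (psum_lip a M B rho); try assumption; try lra|].
  - apply Rle_trans with (2 * B * / (4 * B)); [apply Rmult_le_compat_l; lra|].
    apply Req_le. field. lra.
  - apply Rmult_le_compat_r; [apply Cmod_ge_0|]. apply Rle_div_r in R3; lra.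
Qed.

(** * Analytic functions: identity theorem, division by a polynomial *)

Lemma analytic_at_ext (f g : C -> C) (z0 : C) (r : R) : 0 < r ->
  (forall z, Cmod (z - z0)%C < r -> f z = g z) -> analytic_at f z0 -> analytic_at g z0.
Proof.
  rewrite !analytic_at_Cmod. intros Hr E [a [r' [Hr' H]]].
  exists a, (Rmin r r'). split; [apply Rmin_glb_lt; assumption|].
  intros z Hz. pose proof (Rmin_l r r'). pose proof (Rmin_r r r').
  rewrite <- E by lra. apply H. lra.
Qed.

Lemma analytic_translate (f : C -> C) (z0 c : C) :
  analytic_at f (z0 + c)%C -> analytic_at (fun z => f (z + c)%C) z0.
Proof.
  rewrite !analytic_at_Cmod. intros [a [r [Hr H]]]. exists a, r. split; [exact Hr|].
  intros z Hz. replace (z - z0)%C with (z + c - (z0 + c))%C in * by ring. apply H. exact Hz.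
Qed.

Lemma analytic_plus (f g : C -> C) (z0 : C) :
  analytic_at f z0 -> analytic_at g z0 -> analytic_at (fun z => f z + g z)%C z0.
Proof.
  rewrite !analytic_at_Cmod. intros [a [r [Hr H]]] [b [r' [Hr' H']]].
  exists (PS_plus (K := C_AbsRing) (V := C_NormedModule) a b), (Rmin r r').
  split; [apply Rmin_glb_lt; assumption|].
  intros z Hz. pose proof (Rmin_l r r'). pose proof (Rmin_r r r').
  apply (is_pseries_plus (K := C_AbsRing) (V := C_NormedModule)); [apply H; lra|apply H'; lra].
Qed.

Lemma analytic_0 (z0 : C) : analytic_at (fun _ => RtoC 0) z0.
Proof.
  apply analytic_at_Cmod. exists (fun _ => RtoC 0), 1. split; [lra|]. intros z _.
  apply is_pseries_Cmod. intros e He. exists 0%nat. intros n _.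
  replace (psum (fun _ => RtoC 0) (z - z0)%C n) with (RtoC 0).
  - replace (0 - 0)%C with (RtoC 0) by ring. rewrite Cmod_0. exact He.
  - induction n as [|n IH]; [now rewrite psum_0|]. rewrite psum_S, <- IH. ring.
Qed.

Lemma is_pseries_mul_scal (a : nat -> C) (c w l : C) :
  is_pseries (K := C_AbsRing) (V := C_NormedModule) a w l ->
  is_pseries (K := C_AbsRing) (V := C_NormedModule) (fun n => c * a n)%C w (c * l)%C.
Proof.
  intros H. apply (is_pseries_scal (K := C_AbsRing) (V := C_NormedModule)); [|exact H].
  apply Cmult_comm.
Qed.

Lemma analytic_scal (c : C) (f : C -> C) (z0 : C) :
  analytic_at f z0 -> analytic_at (fun z => c * f z)%C z0.
Proof.
  rewrite !analytic_at_Cmod. intros [a [r [Hr H]]].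
  exists (fun n => c * a n)%C, r. split; [exact Hr|]. intros z Hz.
  apply is_pseries_mul_scal, H, Hz.
Qed.

(** Write [z = z0 + (z - z0)]: the first summand scales the coefficients, the second shifts them. *)
Lemma analytic_mul_var (f : C -> C) (z0 : C) :
  analytic_at f z0 -> analytic_at (fun z => z * f z)%C z0.
Proof.
  intros Hf. apply (analytic_at_ext (fun z => z0 * f z + (z - z0) * f z)%C _ z0 1 Rlt_0_1).
  { intros; ring. }
  apply analytic_plus; [apply analytic_scal, Hf|].
  apply analytic_at_Cmod in Hf. destruct Hf as [a [r [Hr H]]]. apply analytic_at_Cmod.
  exists (PS_incr_1 (K := C_AbsRing) (V := C_NormedModule) a), r. split; [exact Hr|].
  intros z Hz.
  apply (is_pseries_incr_1 (K := C_AbsRing) (V := C_NormedModule) a (z - z0)%C (f z)), H, Hz.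
Qed.

(** Horner's scheme reduces the product to scalings and multiplications by the variable. *)
Lemma analytic_Cpoly_mul (p : Cpoly) (f : C -> C) (z0 : C) :
  analytic_at f z0 -> analytic_at (fun z => Cpoly_eval p z * f z)%C z0.
Proof.
  intros Hf. induction p as [|c p IH].
  - apply (analytic_at_ext (fun _ => RtoC 0) _ z0 1 Rlt_0_1); [|apply analytic_0].
    intros z _. simpl. ring.
  - apply (analytic_at_ext (fun z => c * f z + z * (Cpoly_eval p z * f z))%C _ z0 1 Rlt_0_1).
    + intros z _. simpl. unfold Cpoly_eval. ring.
    + apply analytic_plus; [apply analytic_scal, Hf|apply analytic_mul_var, IH].
Qed.

Lemma analytic_sum_n (F : nat -> C -> C) (z0 : C) (d : nat) :
  (forall j, (j <= d)%nat -> analytic_at (F j) z0) ->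
  analytic_at (fun z => sum_n (fun j => F j z) d) z0.
Proof.
  induction d as [|d IH]; intros H.
  - apply (analytic_at_ext (F 0%nat) _ z0 1 Rlt_0_1); [|apply H; lia].
    intros z _. rewrite sum_O. reflexivity.
  - apply (analytic_at_ext (fun z => sum_n (fun j => F j z) d + F (S d) z)%C _ z0 1 Rlt_0_1).
    + intros z _. rewrite sum_Sn. reflexivity.
    + apply analytic_plus; [apply IH; intros; apply H; lia|apply H; lia].
Qed.

(** The terms after the lowest one form a geometric tail of ratio [B * Cmod w <= 1 / 2], uniformly
    in [N]. The lowest term therefore dominates near the centre. *)
Lemma psum_lowest (a : nat -> C) (M B : R) (w : C) (n N : nat) :
  0 < M -> 0 < B -> (forall k, Cmod (a k) <= M * B ^ k) -> B * Cmod w <= / 2 ->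
  (forall k, (k < n)%nat -> a k = 0%C) ->
  Cmod (psum a w (n + N) - w ^ n * a n)%C <= 2 * M * (B * Cmod w) ^ S n.
Proof.
  intros HM HB Ha Hq Hz. set (q := B * Cmod w) in *.
  assert (Hq0 : 0 <= q) by (apply Rmult_le_pos; [lra|apply Cmod_ge_0]).
  assert (Z : forall k, (k < n)%nat -> psum a w k = 0%C).
  { intros k Hk. induction k as [|k IH]; [rewrite psum_0; apply Hz; lia|].
    rewrite psum_S, IH, Hz by lia. ring. }
  assert (A : Cmod (psum a w (n + N) - w ^ n * a n)%C <= M * (2 * q ^ S n - 2 * q ^ S (n + N))).
  { induction N as [|N IH].
    - rewrite Nat.add_0_r.
      replace (psum a w n) with (w ^ n * a n)%C.
      + rewrite Cmod_minus_self. lra.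
      + destruct n as [|n]; [rewrite psum_0; simpl; ring|]. rewrite psum_S, Z by lia. ring.
    - rewrite Nat.add_succ_r, psum_S.
      set (k := S (n + N)) in *.
      replace (psum a w (n + N) + w ^ k * a k - w ^ n * a n)%C
        with ((psum a w (n + N) - w ^ n * a n) + w ^ k * a k)%C by ring.
      eapply Rle_trans; [apply Cmod_triangle|]. rewrite Cmod_mult, Cmod_pow.
      assert (T : Cmod w ^ k * Cmod (a k) <= Cmod w ^ k * (M * B ^ k))
        by (apply Rmult_le_compat_l; [apply pow_le, Cmod_ge_0|apply Ha]).
      replace (Cmod w ^ k * (M * B ^ k)) with (M * q ^ k) in T
        by (unfold q; rewrite Rpow_mult_distr; ring).
      assert (0 <= M * (q ^ k * (1 - 2 * q)))
        by (apply Rmult_le_pos; [lra|]; apply Rmult_le_pos; [apply pow_le; lra|lra]).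
      change (q ^ S k) with (q * q ^ k). lra. }
  eapply Rle_trans; [exact A|].
  assert (0 <= M * q ^ S (n + N)) by (apply Rmult_le_pos; [lra|apply pow_le; lra]). lra.
Qed.

(** If [a n] were the first nonzero coefficient, its term [t ^ n * a n] would be bounded by a
    multiple of [t ^ S n] for all small [t]. Zeros on a segment to the right of the centre are
    enough, which is what the sweep in [identity_half_plane] provides. *)
Lemma pseries_zero_coefs (f : C -> C) (z0 : C) (a : nat -> C) (r del : R) : 0 < r -> 0 < del ->
  (forall z, Cmod (z - z0)%C < r ->
    is_pseries (K := C_AbsRing) (V := C_NormedModule) a (z - z0)%C (f z)) ->
  (forall t : R, 0 < t < del -> f (z0 + RtoC t)%C = 0%C) ->
  forall n, a n = 0%C.
Proof.
  intros Hr Hdel H Hf. destruct (analytic_coef_bound f z0 a r Hr H) as [M [B [HM [HB Ha]]]].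
  intros n. induction n as [n IH] using lt_wf_ind.
  apply Cmod_eq_0. apply Rle_antisym; [|apply Cmod_ge_0]. apply Rnot_lt_le. intros Hn.
  assert (HMB : 0 < 2 * M * B ^ S n) by (repeat apply Rmult_lt_0_compat; try lra; apply pow_lt; lra).
  (* The first two bounds keep the point in the disc and on the segment of zeros, the third is the
     condition of [psum_lowest], and the last makes the tail strictly smaller than the term of
     degree [n] once [t < t0]. *)
  set (t0 := Rmin (Rmin r del) (Rmin (/ (2 * B)) (Cmod (a n) / (2 * M * B ^ S n)))).
  assert (Ht0 : 0 < t0).
  { repeat apply Rmin_glb_lt; try assumption.
    - apply Rinv_0_lt_compat. lra.
    - apply Rdiv_lt_0_compat; assumption. }
  assert (T1 : t0 <= r) by (eapply Rle_trans; apply Rmin_l).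
  assert (T2 : t0 <= del) by (eapply Rle_trans; [apply Rmin_l|apply Rmin_r]).
  assert (T3 : t0 <= / (2 * B)) by (eapply Rle_trans; [apply Rmin_r|apply Rmin_l]).
  assert (T4 : t0 <= Cmod (a n) / (2 * M * B ^ S n)) by (eapply Rle_trans; [apply Rmin_r|apply Rmin_r]).
  set (t := t0 / 2). assert (Ht : 0 < t < t0) by (unfold t; lra).
  assert (Hct : Cmod (RtoC t) = t) by (rewrite Cmod_R; apply Rabs_pos_eq; lra).
  assert (P : is_pseries (K := C_AbsRing) (V := C_NormedModule) a (RtoC t) (RtoC 0)).
  { rewrite <- (Hf t) by lra. replace (RtoC t) with (z0 + RtoC t - z0)%C at 1 by ring.
    apply H. replace (z0 + RtoC t - z0)%C with (RtoC t) by ring. lra. }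
  assert (Q : Cmod (RtoC t ^ n * a n)%C <= 2 * M * (B * t) ^ S n).
  { apply Rnot_lt_le. intros Hc. rewrite is_pseries_Cmod in P.
    destruct (P (Cmod (RtoC t ^ n * a n)%C - 2 * M * (B * t) ^ S n)) as [N HN]; [lra|].
    specialize (HN (n + N)%nat ltac:(lia)).
    pose proof (psum_lowest a M B (RtoC t) n N HM HB Ha) as L. rewrite Hct in L.
    assert (Bt : B * t <= / 2).
    { apply Rle_trans with (B * / (2 * B)); [apply Rmult_le_compat_l; lra|].
      apply Req_le. field. lra. }
    specialize (L Bt IH).
    pose proof (Cmod_sub_ge (RtoC t ^ n * a n)%C (psum a (RtoC t) (n + N))) as G.
    rewrite (Cmod_sub_sym (RtoC t ^ n * a n)%C) in G.
    replace (psum a (RtoC t) (n + N) - 0)%C with (psum a (RtoC t) (n + N)) in HN by ring. lra. }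
  rewrite Cmod_mult, Cmod_pow, Hct, Rpow_mult_distr in Q.
  replace (2 * M * (B ^ S n * t ^ S n)) with (t ^ n * (2 * M * B ^ S n * t)) in Q by (simpl; ring).
  apply Rmult_le_reg_l in Q; [|apply pow_lt; lra].
  apply Rle_div_r in T4; [|exact HMB].
  assert (2 * M * B ^ S n * t < 2 * M * B ^ S n * t0) by (apply Rmult_lt_compat_l; lra).
  lra.
Qed.

Lemma is_pseries_unique_Cmod (a : nat -> C) (w l l' : C) :
  is_pseries (K := C_AbsRing) (V := C_NormedModule) a w l ->
  is_pseries (K := C_AbsRing) (V := C_NormedModule) a w l' -> l = l'.
Proof.
  intros H H'. assert (Q : Cmod (l - l' - 0)%C <= 0).
  { apply (pseries_conv_bound a a w w); try assumption. intros n.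
    replace (psum a w (S n) - psum a w (S n) - 0)%C with (RtoC 0) by ring. rewrite Cmod_0. lra. }
  assert (Z : (l - l' - 0)%C = 0%C)
    by (apply Cmod_eq_0, Rle_antisym; [exact Q|apply Cmod_ge_0]).
  replace l with ((l - l' - 0) + l')%C by ring. rewrite Z. ring.
Qed.

(** The zeros are pushed leftwards along the horizontal line through [z1]. At the leftmost abscissa
    reached, the expansion vanishes to the right of its centre, so all coefficients are 0 and the
    zeros extend further left. *)
Lemma identity_half_plane (H : C -> C) (s0 s1 : R) :
  (forall z, s0 < Re z -> analytic_at H z) -> (forall z, s1 < Re z -> H z = 0%C) ->
  forall z, s0 < Re z -> H z = 0%C.
Proof.
  intros Han Hz z1 Hz1. set (y := Im z1).
  (* The abscissa is [- m], so that the least upper bound of [E] gives the leftmost abscissa. *)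
  set (E := fun m => forall x, s0 < x -> - m < x -> H (x, y) = 0%C).
  destruct (Rle_or_lt (Re z1) s1) as [Hc|Hc]; [|apply Hz; exact Hc].
  apply NNPP. intros Hne.
  destruct (completeness E) as [m [Hub Hlub]].
  - exists (- Re z1). intros m Hm. apply Rnot_lt_le. intros Hlt. apply Hne.
    replace z1 with (Re z1, y) by (destruct z1; reflexivity). apply Hm; lra.
  - exists (- s1). intros x _ Hx. apply Hz. simpl. lra.
  - assert (Em : E m).
    { intros x Hx0 Hx. destruct (classic (exists m', E m' /\ - x < m')) as [[m' [Hm' Hl]]|Hn].
      - apply Hm'; lra.
      - exfalso. assert (m <= - x); [|lra]. apply Hlub. intros m' Hm'.
        apply Rnot_lt_le. intros Hl. apply Hn. exists m'. split; assumption. }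
    assert (Hm1 : m <= - Re z1).
    { apply Hlub. intros m' Hm'. apply Rnot_lt_le. intros Hlt. apply Hne.
      replace z1 with (Re z1, y) by (destruct z1; reflexivity). apply Hm'; lra. }
    set (z2 := (- m, y) : C).
    assert (HA : analytic_at H z2) by (apply Han; simpl; lra).
    apply analytic_at_Cmod in HA. destruct HA as [a [r [Hr Hs]]].
    assert (Hc0 : forall n, a n = RtoC 0).
    { apply (pseries_zero_coefs H z2 a r 1 Hr Rlt_0_1 Hs). intros t Ht.
      unfold z2, Cplus, RtoC; simpl. rewrite Rplus_0_r. apply Em; lra. }
    assert (Hball : forall z, Cmod (z - z2)%C < r -> H z = 0%C).
    { intros z Hzr. apply (is_pseries_unique_Cmod a (z - z2)%C); [apply Hs, Hzr|].
      apply is_pseries_Cmod. intros e He. exists 0%nat. intros n _.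
      replace (psum a (z - z2)%C n) with (RtoC 0).
      - replace (0 - 0)%C with (RtoC 0) by ring. rewrite Cmod_0. exact He.
      - induction n as [|n IH]; [now rewrite psum_0, Hc0|]. rewrite psum_S, <- IH, Hc0. ring. }
    (* The disc of zeros around [z2] reaches beyond abscissa [- m - r / 2], against [m] being an
       upper bound of [E]. *)
    assert (Ebig : E (m + r / 2)).
    { intros x Hx0 Hx. destruct (Rlt_or_le (- m) x) as [Hl|Hl]; [apply Em; assumption|].
      apply Hball. replace (((x, y) : C) - z2)%C with (RtoC (x + m))
        by (unfold z2, RtoC, Cminus, Cplus, Copp; simpl; f_equal; ring).
      rewrite Cmod_R. apply Rabs_def1; lra. }
    specialize (Hub _ Ebig). lra.
Qed.

(* Coefficients of the product of the polynomial [p] and the power series [c]. *)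
Fixpoint polyact (p : Cpoly) (c : nat -> C) (n : nat) : C :=
  match p with
  | nil => 0%C
  | (a :: p')%list => (a * c n + match n with O => 0 | S m => polyact p' c m end)%C
  end.

Lemma is_pseries_polyact (p : Cpoly) (c : nat -> C) (w l : C) :
  is_pseries (K := C_AbsRing) (V := C_NormedModule) c w l ->
  is_pseries (K := C_AbsRing) (V := C_NormedModule) (polyact p c) w (Cpoly_eval p w * l)%C.
Proof.
  intros H. induction p as [|a p IH].
  - simpl. replace (0 * l)%C with (RtoC 0) by ring.
    apply is_pseries_Cmod. intros e He. exists 0%nat. intros n _.
    replace (psum (fun _ => RtoC 0) w n) with (RtoC 0).
    + replace (0 - 0)%C with (RtoC 0) by ring. rewrite Cmod_0. exact He.
    + induction n as [|n IH]; [now rewrite psum_0|]. rewrite psum_S, <- IH. ring.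
  - replace (Cpoly_eval (a :: p) w * l)%C with (a * l + w * (Cpoly_eval p w * l))%C
      by (simpl; unfold Cpoly_eval; ring).
    apply (is_pseries_ext (K := C_AbsRing) (V := C_NormedModule)
      (PS_plus (K := C_AbsRing) (V := C_NormedModule) (fun n => a * c n)%C
        (PS_incr_1 (K := C_AbsRing) (V := C_NormedModule) (polyact p c)))).
    { intros [|n]; reflexivity. }
    apply (is_pseries_plus (K := C_AbsRing) (V := C_NormedModule)).
    + apply is_pseries_mul_scal, H.
    + apply (is_pseries_incr_1 (K := C_AbsRing) (V := C_NormedModule) (polyact p c) w
        (Cpoly_eval p w * l)%C), IH.
Qed.

Lemma polyact_ext (p : Cpoly) (c c' : nat -> C) (n : nat) :
  (forall k, (k <= n)%nat -> c k = c' k) -> polyact p c n = polyact p c' n.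
Proof.
  revert n. induction p as [|a p IH]; intros n H; [reflexivity|].
  simpl. rewrite (H n) by lia. destruct n as [|n]; [reflexivity|].
  rewrite (IH n) by (intros; apply H; lia). reflexivity.
Qed.

Fixpoint Cpoly_norm (p : Cpoly) : R :=
  match p with nil => 0 | (a :: p')%list => Cmod a + Cpoly_norm p' end.

Lemma Cpoly_norm_ge_0 (p : Cpoly) : 0 <= Cpoly_norm p.
Proof. induction p as [|a p IH]; simpl; [lra|]. pose proof (Cmod_ge_0 a). lra. Qed.

Lemma polyact_bound (p : Cpoly) (c : nat -> C) (n : nat) (X : R) : 0 <= X ->
  (forall k, (k <= n)%nat -> Cmod (c k) <= X) -> Cmod (polyact p c n) <= Cpoly_norm p * X.
Proof.
  intros HX. revert n. induction p as [|a p IH]; intros n H; simpl.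
  - rewrite Cmod_0. lra.
  - eapply Rle_trans; [apply Cmod_triangle|]. rewrite Cmod_mult.
    assert (Cmod a * Cmod (c n) <= Cmod a * X)
      by (apply Rmult_le_compat_l; [apply Cmod_ge_0|apply H; lia]).
    assert (Cmod (match n with O => 0%C | S m => polyact p c m end) <= Cpoly_norm p * X).
    { destruct n as [|n]; [|apply IH; intros; apply H; lia].
      rewrite Cmod_0. apply Rmult_le_pos; [apply Cpoly_norm_ge_0|exact HX]. }
    lra.
Qed.

(** The system is triangular with diagonal [c0]: each coefficient of the quotient is determined by
    the earlier ones. *)
Lemma polyact_solve (c0 : C) (q : Cpoly) (r : nat -> C) : c0 <> 0%C ->
  exists c, forall n, polyact (c0 :: q) c n = r n.
Proof.
  intros Hc0.
  set (T := fun (c : nat -> C) (n : nat) =>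
    ((r n - match n with O => 0 | S m => polyact q c m end) / c0)%C).
  assert (TE : forall c c' n, (forall k, (k < n)%nat -> c k = c' k) -> T c n = T c' n).
  { intros c c' n H. unfold T. destruct n as [|n]; [reflexivity|].
    rewrite (polyact_ext q c c' n) by (intros; apply H; lia). reflexivity. }
  (* Entry [n] of [T c] depends only on the entries of [c] before [n], so the iterate [I n] is
     already final below index [n]. The diagonal [I (S n) n] is then a fixed point of [T]. *)
  set (I := fun n => Nat.iter n T (fun _ => RtoC 0)).
  assert (IE : forall n k, (k < n)%nat -> I n k = I (S n) k).
  { induction n as [|n IH]; intros k Hk; [lia|].
    change (T (I n) k = T (I (S n)) k). apply TE. intros j Hj. apply IH. lia. }
  assert (IE' : forall n m k, (k < n)%nat -> I n k = I (n + m)%nat k).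
  { intros n m k Hk. induction m as [|m IH]; [now rewrite Nat.add_0_r|].
    rewrite IH, Nat.add_succ_r. apply IE. lia. }
  exists (fun n => I (S n) n). intros n.
  assert (F : I (S n) n = T (fun k => I (S k) k) n).
  { change (T (I n) n = T (fun k => I (S k) k) n). apply TE. intros k Hk.
    replace n with (S k + (n - S k))%nat by lia. symmetry. apply IE'. lia. }
  cbn [polyact]. rewrite F. unfold T. field. exact Hc0.
Qed.

Lemma polyact_solve_bound (c0 : C) (q : Cpoly) (r c : nat -> C) (M B : R) : c0 <> 0%C ->
  0 < M -> 0 < B -> (forall n, Cmod (r n) <= M * B ^ n) ->
  (forall n, polyact (c0 :: q) c n = r n) ->
  exists K D, 0 < K /\ 0 < D /\ forall n, Cmod (c n) <= K * D ^ n.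
Proof.
  intros Hc0 HM HB Hr Hc. apply Cmod_gt_0 in Hc0. set (m := Cmod c0) in *.
  pose proof (Cpoly_norm_ge_0 q) as HN. set (N := Cpoly_norm q) in *.
  (* The bound [m * K * D ^ n] is split into two halves. [K = 2 * M / m] and [D >= B] fit [r n] into
     one half; [D >= 2 * N / m] fits the contribution of the earlier coefficients into the other. *)
  set (D := 1 + B + 2 * N / m).
  assert (HNm : 0 <= 2 * N / m) by (apply Rdiv_le_0_compat; lra).
  assert (HD : 1 <= D) by (unfold D; lra).
  set (K := 2 * M / m).
  assert (HK : 0 < K) by (apply Rdiv_lt_0_compat; lra).
  exists K, D. repeat split; [exact HK|lra|]. intros n.
  induction n as [n IH] using lt_wf_ind.
  assert (E : (c0 * c n)%C = (r n - match n with O => 0 | S k => polyact q c k end)%C).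
  { rewrite <- (Hc n). simpl. ring. }
  apply Rmult_le_reg_l with m; [exact Hc0|].
  unfold m at 1. rewrite <- Cmod_mult, E.
  assert (Bd : Cmod (match n with O => 0%C | S k => polyact q c k end) <= m * K / 2 * D ^ n).
  { destruct n as [|k].
    - rewrite Cmod_0. simpl. apply Rmult_le_pos; [|lra].
      apply Rmult_le_pos; [|lra]. apply Rmult_le_pos; lra.
    - eapply Rle_trans; [apply (polyact_bound q c k (K * D ^ k))|].
      + apply Rmult_le_pos; [lra|apply pow_le; lra].
      + intros j Hj. eapply Rle_trans; [apply IH; lia|].
        apply Rmult_le_compat_l; [lra|]. apply Rle_pow; [exact HD|exact Hj].
      + fold N. simpl.
        replace (m * K / 2 * (D * D ^ k)) with (m * D / 2 * (K * D ^ k)) by field.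
        apply Rmult_le_compat_r; [apply Rmult_le_pos; [lra|apply pow_le; lra]|].
        assert (m * (2 * N / m) <= m * D) by (apply Rmult_le_compat_l; unfold D; lra).
        replace (m * (2 * N / m)) with (2 * N) in H by (field; lra). lra. }
  assert (Rd : Cmod (r n) <= m * K / 2 * D ^ n).
  { eapply Rle_trans; [apply Hr|]. replace (m * K / 2) with M by (unfold K; field; lra).
    apply Rmult_le_compat_l; [lra|]. apply pow_incr. unfold D. lra. }
  unfold Cminus. eapply Rle_trans; [apply Cmod_triangle|]. rewrite Cmod_opp. lra.
Qed.

Lemma pseries_converges (c : nat -> C) (K D : R) (w : C) : 0 < K -> 0 < D ->
  (forall n, Cmod (c n) <= K * D ^ n) -> D * Cmod w <= / 2 ->
  exists s : C, is_pseries (K := C_AbsRing) (V := C_NormedModule) c w s.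
Proof.
  intros HK HD Hc Hw.
  assert (HX : ex_series (K := C_AbsRing) (V := C_NormedModule)
    (fun k => scal (pow_n (K := C_AbsRing) w k) (c k : C_NormedModule))).
  { apply (ex_series_le (K := C_AbsRing) (V := C_CompleteNormedModule) _ (fun n => K * (/ 2) ^ n)).
    - intros n. change (Cmod (w ^ n * c n)%C <= K * (/ 2) ^ n). rewrite Cmod_mult, Cmod_pow.
      apply Rle_trans with (K * (D * Cmod w) ^ n).
      + rewrite Rpow_mult_distr.
        apply Rle_trans with (Cmod w ^ n * (K * D ^ n)); [|apply Req_le; ring].
        apply Rmult_le_compat_l; [apply pow_le, Cmod_ge_0|apply Hc].
      + apply Rmult_le_compat_l; [lra|]. apply pow_incr.
        split; [apply Rmult_le_pos; [lra|apply Cmod_ge_0]|exact Hw].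
    - apply (ex_series_scal (K := R_AbsRing) (V := R_NormedModule) K (fun n => (/ 2) ^ n)).
      apply ex_series_geom. rewrite Rabs_pos_eq; lra. }
  exact HX.
Qed.

Lemma hol_Cpoly (p : Cpoly) (z : C) : hol_at (Cpoly_eval p) z.
Proof.
  induction p as [|c p IH]; [apply hol_const|].
  apply (hol_plus (fun _ => c)); [apply hol_const|]. apply hol_mult; [apply hol_id|exact IH].
Qed.

(** The quotient series is found formally by [polyact_solve] and converges by its geometric bound.
    Multiplying it back by the polynomial gives the series of [h], so uniqueness of sums identifies
    its value where the denominator is nonzero. *)
Lemma analytic_div_poly (h : C -> C) (c0 : C) (q : Cpoly) : c0 <> 0%C ->
  analytic_at h 0%C -> analytic_at (fun z => h z / Cpoly_eval (c0 :: q) z)%C 0%C.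
Proof.
  intros Hc0 Hh. apply analytic_at_Cmod in Hh. destruct Hh as [r [del [Hdel Hr]]].
  destruct (analytic_coef_bound h 0%C r del Hdel Hr) as [M [B [HM [HB Hb]]]].
  destruct (polyact_solve c0 q r Hc0) as [c Hc].
  destruct (polyact_solve_bound c0 q r c M B Hc0 HM HB Hb Hc) as [K [D [HK [HD Hcb]]]].
  destruct (hol_cont _ _ (hol_Cpoly (c0 :: q) 0%C) (Cmod c0)) as [d1 [Hd1 H1]];
    [apply Cmod_gt_0, Hc0|].
  apply analytic_at_Cmod. exists c, (Rmin del (Rmin d1 (/ (2 * D)))).
  split; [repeat apply Rmin_glb_lt; try assumption; apply Rinv_0_lt_compat; lra|].
  intros z Hz. pose proof (Rmin_l del (Rmin d1 (/ (2 * D)))).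
  pose proof (Rmin_r del (Rmin d1 (/ (2 * D)))).
  pose proof (Rmin_l d1 (/ (2 * D))). pose proof (Rmin_r d1 (/ (2 * D))).
  destruct (pseries_converges c K D (z - 0)%C HK HD Hcb) as [s Hs].
  { apply Rle_trans with (D * / (2 * D)); [apply Rmult_le_compat_l; lra|].
    apply Req_le. field. lra. }
  assert (Hne : Cpoly_eval (c0 :: q) z <> 0%C).
  { intros Hq. specialize (H1 z ltac:(lra)). rewrite Hq in H1.
    replace (0 - Cpoly_eval (c0 :: q) 0)%C with (- c0)%C in H1
      by (simpl; unfold Cpoly_eval; ring).
    rewrite Cmod_opp in H1. lra. }
  assert (E : (Cpoly_eval (c0 :: q) z * s)%C = h z).
  { apply (is_pseries_unique_Cmod r (z - 0)%C); [|apply Hr; lra].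
    apply (is_pseries_ext (K := C_AbsRing) (V := C_NormedModule) (polyact (c0 :: q) c)).
    { exact Hc. }
    replace (Cpoly_eval (c0 :: q) z) with (Cpoly_eval (c0 :: q) (z - 0)%C) by (f_equal; ring).
    apply is_pseries_polyact, Hs. }
  replace (h z / Cpoly_eval (c0 :: q) z)%C with s; [exact Hs|].
  rewrite <- E. field. exact Hne.
Qed.

(** * Maximum modulus principle *)

(** The difference quotient of [F] between [u] and [u + t] is close to [D u] for small [t];
    strictness at [z] makes the same quotient close to [D z]. *)
Lemma sderiv_deriv_cont (F D : C -> C) (z : C) (r : R) : 0 < r ->
  (forall u, Cmod (u - z)%C < r -> sderiv F u (D u)) -> cont_at D z.
Proof.
  intros Hr H e He.
  assert (Hz : sderiv F z (D z)) by (apply H; rewrite Cmod_minus_self; exact Hr).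
  destruct (Hz (e / 4) ltac:(lra)) as [d1 [Hd1 H1]].
  exists (Rmin r (d1 / 2)). split; [apply Rmin_glb_lt; lra|].
  intros u Hu. pose proof (Rmin_l r (d1 / 2)) as G1. pose proof (Rmin_r r (d1 / 2)) as G2.
  destruct (H u ltac:(lra) (e / 4) ltac:(lra)) as [d2 [Hd2 H2]].
  set (t := Rmin (d1 / 4) (d2 / 2)).
  assert (Ht : 0 < t) by (apply Rmin_glb_lt; lra).
  assert (t <= d1 / 4) by apply Rmin_l. assert (t <= d2 / 2) by apply Rmin_r.
  assert (Ct : Cmod (RtoC t) = t) by (rewrite Cmod_R; apply Rabs_pos_eq; lra).
  assert (E1 : (u + RtoC t - u)%C = RtoC t) by ring.
  assert (K : Cmod (u + RtoC t - z)%C < d1).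
  { replace (u + RtoC t - z)%C with ((u - z) + RtoC t)%C by ring.
    eapply Rle_lt_trans; [apply Cmod_triangle|]. lra. }
  specialize (H1 _ u K ltac:(lra)).
  specialize (H2 (u + RtoC t)%C u). rewrite E1, Ct, Cmod_minus_self in H2.
  specialize (H2 ltac:(lra) ltac:(lra)). rewrite E1, Ct in H1.
  assert (Q : t * Cmod (D u - D z)%C <= t * (e / 2)).
  { rewrite <- Ct at 1. rewrite <- Cmod_mult.
    replace (RtoC t * (D u - D z))%C with
      ((F (u + RtoC t) - F u - D z * RtoC t) + - (F (u + RtoC t) - F u - D u * RtoC t))%C by ring.
    eapply Rle_trans; [apply Cmod_triangle|]. rewrite Cmod_opp. lra. }
  apply Rmult_le_reg_l in Q; lra.
Qed.

(** The parameter [re] stands for [Re] or [Im], and the direction [w] for 1 or [Ci], so one argument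
    yields all the partial derivatives used below. *)
Lemma sderiv_line (F : C -> C) (z d w : C) (re : C -> R) :
  (forall u v, re (u - v)%C = re u - re v) -> (forall u, Rabs (re u) <= Cmod u) ->
  (forall (t : R) u, re (RtoC t * u)%C = t * re u) ->
  sderiv F z d ->
  derivable_pt_lim (fun t => re (F (z + RtoC t * w)%C)) 0 (re (d * w)%C).
Proof.
  intros Hsub Hle Hscal H e He.
  set (k := e / (2 * (Cmod w + 1))).
  pose proof (Cmod_ge_0 w) as Hw.
  assert (Hk : 0 < k) by (apply Rdiv_lt_0_compat; lra).
  assert (Hkw : k * Cmod w < e).
  { assert (k * (Cmod w + 1) = e / 2) by (unfold k; field; lra). lra. }
  destruct (H k Hk) as [del [Hdel Hd]].
  exists (mkposreal (del / (Cmod w + 1)) ltac:(apply Rdiv_lt_0_compat; lra)).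
  intros h Hh Hhd. simpl in Hhd. rewrite Rplus_0_l.
  apply Rlt_div_r in Hhd; [|lra].
  assert (Ch : Cmod (RtoC h * w)%C = Rabs h * Cmod w) by now rewrite Cmod_mult, Cmod_R.
  assert (Hp : 0 < Rabs h) by (apply Rabs_pos_lt; exact Hh).
  specialize (Hd (z + RtoC h * w)%C z).
  replace (z + RtoC h * w - z)%C with (RtoC h * w)%C in Hd by ring.
  rewrite Cmod_minus_self in Hd.
  assert (Q := Hd ltac:(rewrite Ch; lra) Hdel). rewrite Ch in Q.
  replace (z + RtoC 0 * w)%C with z by ring.
  replace ((re (F (z + RtoC h * w)%C) - re (F z)) / h - re (d * w)%C)
    with (re (F (z + RtoC h * w) - F z - d * (RtoC h * w))%C / h).
  2:{ rewrite !Hsub. replace (d * (RtoC h * w))%C with (RtoC h * (d * w))%C by ring.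
      rewrite Hscal. field. exact Hh. }
  unfold Rdiv. rewrite Rabs_mult, Rabs_inv.
  apply Rle_lt_trans with (k * Cmod w); [|exact Hkw].
  apply Rle_div_l; [exact Hp|].
  eapply Rle_trans; [apply Hle|]. lra.
Qed.

Lemma derivable_pt_lim_shift (g : R -> R) (x l : R) :
  derivable_pt_lim (fun t => g (x + t)) 0 l -> is_derive g x l.
Proof.
  intros H. apply is_derive_Reals. intros e He. destruct (H e He) as [del Hd].
  exists del. intros h Hh Hhd. specialize (Hd h Hh Hhd).
  rewrite Rplus_0_l, Rplus_0_r in Hd. exact Hd.
Qed.

Lemma is_derive_ext_fun (g h : R -> R) (x l : R) :
  (forall t, g t = h t) -> is_derive g x l -> is_derive h x l.
Proof. intros E. apply is_derive_ext. exact E. Qed.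

Lemma Re_sub (u v : C) : Re (u - v)%C = Re u - Re v.
Proof. destruct u, v; simpl; ring. Qed.
Lemma Im_sub (u v : C) : Im (u - v)%C = Im u - Im v.
Proof. destruct u, v; simpl; ring. Qed.
Lemma Im_scal (t : R) (u : C) : Im (RtoC t * u)%C = t * Im u.
Proof. destruct u; simpl; ring. Qed.

Lemma sderiv_Re_dx (F : C -> C) (x y : R) (d : C) : sderiv F (x, y) d ->
  is_derive (fun s => Re (F (s, y))) x (Re d).
Proof.
  intros H. apply derivable_pt_lim_shift.
  pose proof (sderiv_line F (x, y) d 1%C Re Re_sub re_le_Cmod re_scal_l H) as Q.
  rewrite Cmult_1_r in Q. apply is_derive_Reals. apply is_derive_Reals in Q.
  revert Q. apply is_derive_ext_fun. intros t. do 2 f_equal.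
  unfold RtoC, Cplus, Cmult; simpl. f_equal; ring.
Qed.

(** Compared with [sderiv_Re_dx], this is the Cauchy-Riemann equation on which [mean_const]
    rests. *)
Lemma sderiv_Im_dy (F : C -> C) (x y : R) (d : C) : sderiv F (x, y) d ->
  is_derive (fun s => Im (F (x, s))) y (Re d).
Proof.
  intros H. apply derivable_pt_lim_shift.
  pose proof (sderiv_line F (x, y) d Ci Im Im_sub Im_le_Cmod Im_scal H) as Q.
  replace (Im (d * Ci)%C) with (Re d) in Q by (destruct d; simpl; ring).
  apply is_derive_Reals. apply is_derive_Reals in Q.
  revert Q. apply is_derive_ext_fun. intros t. do 2 f_equal.
  unfold RtoC, Ci, Cplus, Cmult; simpl. f_equal; ring.
Qed.

Lemma sderiv_Re_dy (F : C -> C) (x y : R) (d : C) : sderiv F (x, y) d ->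
  is_derive (fun s => Re (F (x, s))) y (- Im d).
Proof.
  intros H. apply derivable_pt_lim_shift.
  pose proof (sderiv_line F (x, y) d Ci Re Re_sub re_le_Cmod re_scal_l H) as Q.
  rewrite re_mult_Ci in Q.
  apply is_derive_Reals. apply is_derive_Reals in Q.
  revert Q. apply is_derive_ext_fun. intros t. do 2 f_equal.
  unfold RtoC, Ci, Cplus, Cmult; simpl. f_equal; ring.
Qed.

Lemma cexp_period (x : R) : cexp (x, 2 * PI) = cexp (x, 0).
Proof. unfold cexp; simpl. rewrite cos_2PI, sin_2PI, cos_0, sin_0. reflexivity. Qed.

(** Differentiation under the integral sign gives the integral of the [x]-derivative of [Re Phi]. By
    Cauchy-Riemann this is the [t]-derivative of [Im Phi], whose integral over a period is 0. *)
Lemma mean_const (Phi : C -> C) (b : R) :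
  (forall z, Re z < b -> hol_at Phi z) -> (forall x, Phi (x, 2 * PI) = Phi (x, 0)) ->
  forall x, x < b -> is_derive (fun x => RInt (fun t => Re (Phi (x, t))) 0 (2 * PI)) x 0.
Proof.
  intros H Hper x Hx.
  (* A derivative is chosen at every point to obtain a function whose continuity can be stated; the
     value is arbitrary where [Phi] is not differentiable. *)
  set (D := fun z => epsilon (inhabits (RtoC 0)) (fun d => sderiv Phi z d)).
  assert (HD : forall z, Re z < b -> sderiv Phi z (D z)) by (intros z Hz; apply epsilon_spec, H, Hz).
  assert (HDc : forall z, Re z < b -> cont_at D z).
  { intros z Hz. apply (sderiv_deriv_cont Phi D z (b - Re z)); [lra|].
    intros u Hu. apply HD. pose proof (re_le_Cmod (u - z)%C) as Q. rewrite Re_sub in Q.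
    pose proof (Rle_abs (Re u - Re z)). lra. }
  assert (HPI : 0 < PI) by apply PI_RGT_0.
  assert (L : forall e, 0 < e -> x + e <= b -> locally x (fun y => y < b)).
  { intros e He Hb. exists (mkposreal e He). intros y Hy.
    unfold ball in Hy; simpl in Hy. unfold AbsRing_ball, minus, plus, opp, abs in Hy; simpl in Hy.
    apply Rabs_def2 in Hy. lra. }
  assert (L' : locally x (fun y => y < b)) by (apply (L (b - x)); lra).
  assert (I0 : is_RInt (fun t => Re (D (x, t))) 0 (2 * PI) 0).
  { replace 0 with (minus (Im (Phi (x, 2 * PI))) (Im (Phi (x, 0)))) at 2
      by (rewrite Hper; unfold minus, plus, opp; simpl; ring).
    apply (is_RInt_derive (fun t => Im (Phi (x, t)))).
    - intros t _. apply sderiv_Im_dy, HD. exact Hx.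
    - intros t _. apply continuity_pt_filterlim. apply continuity_pt_locally.
      intros e. destruct (HDc (x, t) Hx e (cond_pos e)) as [del [Hdel Hc]].
      exists (mkposreal del Hdel). intros s Hs.
      unfold ball in Hs; simpl in Hs. unfold AbsRing_ball, minus, plus, opp, abs in Hs; simpl in Hs.
      rewrite <- Re_sub. eapply Rle_lt_trans; [apply re_le_Cmod|]. apply Hc.
      eapply Rle_lt_trans; [apply Cmod_le_Re_Im|]. simpl.
      replace (x + - x) with 0 by ring. rewrite Rabs_R0. lra. }
  assert (E : RInt (fun t => Derive (fun u => Re (Phi (u, t))) x) 0 (2 * PI) = 0).
  { apply is_RInt_unique. revert I0. apply is_RInt_ext. intros t _.
    symmetry. apply is_derive_unique, sderiv_Re_dx, HD. exact Hx. }
  evar_last; [|exact E].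
  apply (is_derive_RInt_param (fun x t => Re (Phi (x, t)))).
  - revert L'. apply filter_imp. intros y Hy t _. eexists. apply sderiv_Re_dx, HD. exact Hy.
  - intros t _. apply (continuity_2d_pt_ext_loc (fun u v => Re (D (u, v)))).
    + exists (mkposreal (b - x) ltac:(lra)). intros u v Hu _. simpl in Hu.
      symmetry. apply is_derive_unique, sderiv_Re_dx, HD. simpl.
      apply Rabs_def2 in Hu. lra.
    + intros e. destruct (HDc (x, t) Hx e (cond_pos e)) as [del [Hdel Hc]].
      exists (mkposreal (del / 2) ltac:(lra)). intros u v Hu Hv. simpl in Hu, Hv.
      rewrite <- Re_sub. eapply Rle_lt_trans; [apply re_le_Cmod|]. apply Hc.
      eapply Rle_lt_trans; [apply Cmod_le_Re_Im|]. simpl. unfold Rminus in *. lra.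
  - revert L'. apply filter_imp. intros y Hy.
    apply (ex_RInt_continuous (V := R_CompleteNormedModule)). intros t _.
    apply (ex_derive_continuous (V := R_NormedModule)). eexists. apply sderiv_Re_dy, HD. exact Hy.
Qed.

(* In the coordinate [z = z0 + exp zeta] circles become vertical segments, on which the
   Cauchy-Riemann equations make the mean value independent of the radius. *)
Lemma mean_value (F : C -> C) (z0 : C) (r0 : R) : 0 < r0 -> cont_at F z0 ->
  (forall u, u <> z0 -> Cmod (u - z0)%C < r0 -> hol_at F u) ->
  forall r, 0 < r < r0 ->
    is_RInt (fun t => Re (F (z0 + cexp (ln r, t))%C)) 0 (2 * PI) (2 * PI * Re (F z0)).
Proof.
  intros Hr0 Hc H r Hr.
  assert (HPI : 0 < PI) by apply PI_RGT_0.
  set (Phi := fun z => F (z0 + cexp z)%C).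
  assert (HP : forall z, Re z < ln r0 -> hol_at Phi z).
  { intros z Hz. apply (hol_comp F (fun z => z0 + cexp z)%C).
    - apply hol_plus; [apply hol_const|]. apply hol_cexp, hol_id.
    - apply H.
      + intros E. apply (cexp_neq_0 z). replace (cexp z) with (z0 + cexp z - z0)%C by ring.
        rewrite E. ring.
      + replace (z0 + cexp z - z0)%C with (cexp z) by ring. rewrite Cmod_cexp.
        rewrite <- (exp_ln r0) by exact Hr0. apply exp_increasing, Hz. }
  assert (Hlr : ln r < ln r0) by (apply ln_increasing; lra).
  assert (Hex : forall x, x < ln r0 -> ex_RInt (fun t => Re (Phi (x, t))) 0 (2 * PI)).
  { intros x Hx. apply (ex_RInt_continuous (V := R_CompleteNormedModule)). intros t _.
    apply (ex_derive_continuous (V := R_NormedModule)).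
    destruct (HP (x, t) Hx) as [d Hd]. eexists. apply sderiv_Re_dy, Hd. }
  set (I := fun x => RInt (fun t => Re (Phi (x, t))) 0 (2 * PI)).
  assert (HI : forall x, x < ln r -> I x = I (ln r)).
  { intros x Hx. apply (eq_is_derive (V := R_NormedModule)); [|exact Hx].
    intros t Ht. apply (mean_const Phi (ln r0)); [exact HP| |lra].
    intros s. unfold Phi. now rewrite cexp_period. }
  assert (E : I (ln r) = 2 * PI * Re (F z0)).
  { apply NNPP. intros Hne.
    (* As [x] decreases the circle shrinks to [z0]. With this [e], continuity at [z0] bounds the
       discrepancy of the integrals by [2 * PI * e], half of its own value. *)
    set (e := Rabs (I (ln r) - 2 * PI * Re (F z0)) / (4 * PI)).
    assert (Hpos : 0 < Rabs (I (ln r) - 2 * PI * Re (F z0))) by (apply Rabs_pos_lt; lra).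
    assert (He : 0 < e) by (apply Rdiv_lt_0_compat; lra).
    destruct (Hc e He) as [del [Hdel Hd]].
    set (x := Rmin (ln r) (ln del) - 1).
    assert (Hx1 : x < ln r) by (unfold x; pose proof (Rmin_l (ln r) (ln del)); lra).
    assert (Hx2 : x < ln del) by (unfold x; pose proof (Rmin_r (ln r) (ln del)); lra).
    assert (B : forall t, Rabs (Re (Phi (x, t)) - Re (F z0)) <= e).
    { intros t. rewrite <- Re_sub. left. eapply Rle_lt_trans; [apply re_le_Cmod|]. apply Hd.
      replace (z0 + cexp (x, t) - z0)%C with (cexp (x, t)) by ring. rewrite Cmod_cexp.
      rewrite <- (exp_ln del) by exact Hdel. apply exp_increasing, Hx2. }
    pose proof (RInt_correct _ _ _ (Hex x ltac:(lra))) as C1. fold (I x) in C1.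
    pose proof (is_RInt_const 0 (2 * PI) (Re (F z0) + e)) as C2.
    pose proof (is_RInt_const 0 (2 * PI) (Re (F z0) - e)) as C3.
    assert (U := is_RInt_le _ _ 0 (2 * PI) _ _ ltac:(lra) C1 C2).
    assert (V := is_RInt_le _ _ 0 (2 * PI) _ _ ltac:(lra) C3 C1).
    unfold scal in U, V; simpl in U, V. unfold mult in U, V; simpl in U, V.
    assert (U' := U ltac:(intros t _; pose proof (B t) as Bt; apply Rabs_le_between in Bt; lra)).
    assert (V' := V ltac:(intros t _; pose proof (B t) as Bt; apply Rabs_le_between in Bt; lra)).
    assert (W : Rabs (I x - 2 * PI * Re (F z0)) <= 2 * PI * e) by (apply Rabs_le; lra).
    assert (Ee : 2 * PI * e = Rabs (I (ln r) - 2 * PI * Re (F z0)) / 2).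
    { unfold e. field. lra. }
    rewrite (HI x Hx1) in W.
    lra. }
  rewrite <- E. apply (RInt_correct (V := R_CompleteNormedModule)), Hex, Hlr.
Qed.

(** A rotation makes [F z0] real and nonnegative. The real part on the circle never exceeds its
    mean, so a dip at angle 0 would make the mean too small. *)
Lemma max_circle (F : C -> C) (z0 : C) (r0 : R) : 0 < r0 -> cont_at F z0 ->
  (forall u, u <> z0 -> Cmod (u - z0)%C < r0 -> hol_at F u) ->
  (forall u, Cmod (u - z0)%C < r0 -> Cmod (F u) <= Cmod (F z0)) ->
  forall r, 0 < r < r0 -> Cmod (F (z0 + RtoC r)%C) = Cmod (F z0).
Proof.
  intros Hr0 Hc H Hmax r Hr.
  assert (HPI : 0 < PI) by apply PI_RGT_0.
  assert (Hin : forall t, Cmod (z0 + cexp (ln r, t) - z0)%C = r).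
  { intros t. replace (z0 + cexp (ln r, t) - z0)%C with (cexp (ln r, t)) by ring.
    rewrite Cmod_cexp. simpl. apply exp_ln. lra. }
  assert (E0 : cexp (ln r, 0) = RtoC r).
  { unfold cexp; simpl. rewrite exp_ln, cos_0, sin_0 by lra. unfold RtoC. f_equal; ring. }
  apply Rle_antisym.
  { apply Hmax. rewrite <- E0, Hin. lra. }
  apply Rnot_lt_le. intros Hlt.
  set (S := Cmod (F z0)) in *.
  assert (HS : 0 < S) by (pose proof (Cmod_ge_0 (F (z0 + RtoC r)%C)); lra).
  set (lam := (Cconj (F z0) / RtoC S)%C).
  assert (HS0 : RtoC S <> 0%C) by (intros Q; apply (f_equal Re) in Q; simpl in Q; lra).
  assert (Hlam : Cmod lam = 1).
  { unfold lam. rewrite Cmod_div by exact HS0. rewrite Cmod_conj, Cmod_R, Rabs_pos_eq by lra.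
    fold S. field. lra. }
  set (G := fun u => (lam * F u)%C).
  assert (HG0 : Re (G z0) = S).
  { unfold G, lam. replace (Cconj (F z0) / RtoC S * F z0)%C with (F z0 * Cconj (F z0) / RtoC S)%C
      by (field; exact HS0).
    rewrite <- Cmod2_conj. fold S. replace (RtoC (S ^ 2) / RtoC S)%C with (RtoC S); [reflexivity|].
    rewrite RtoC_pow. field. exact HS0. }
  assert (HGle : forall u, Cmod (u - z0)%C < r0 -> Re (G u) <= Cmod (F u)).
  { intros u _. eapply Rle_trans; [apply Rle_abs|]. eapply Rle_trans; [apply re_le_Cmod|].
    unfold G. rewrite Cmod_mult, Hlam. lra. }
  assert (HGh : forall u, u <> z0 -> Cmod (u - z0)%C < r0 -> hol_at G u).
  { intros u Hu Hur. apply hol_mult; [apply hol_const|apply H; assumption]. }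
  assert (HGc : cont_at G z0).
  { intros e He. destruct (Hc e He) as [del [Hdel Hd]]. exists del. split; [exact Hdel|].
    intros u Hu. replace (G u - G z0)%C with (lam * (F u - F z0))%C by (unfold G; ring).
    rewrite Cmod_mult, Hlam, Rmult_1_l. apply Hd, Hu. }
  pose proof (mean_value G z0 r0 Hr0 HGc HGh r Hr) as MV. rewrite HG0 in MV.
  set (phi := fun t => Re (G (z0 + cexp (ln r, t))%C)) in *.
  assert (Hphi : forall t, phi t <= S).
  { intros t. eapply Rle_trans; [apply HGle|apply Hmax]; rewrite Hin; lra. }
  assert (Hphi0 : phi 0 <= Cmod (F (z0 + RtoC r)%C)).
  { unfold phi. rewrite E0. apply HGle. rewrite <- E0, Hin. lra. }
  assert (Hphic : forall t, continuous phi t).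
  { intros t. apply (ex_derive_continuous (V := R_NormedModule)).
    assert (HH : hol_at (fun z => G (z0 + cexp z)%C) (ln r, t)).
    { apply (hol_comp G (fun z => z0 + cexp z)%C).
      - apply hol_plus; [apply hol_const|]. apply hol_cexp, hol_id.
      - apply HGh; [|rewrite Hin; lra]. intros Q. apply (cexp_neq_0 (ln r, t)).
        transitivity ((z0 + cexp (ln r, t)) - z0)%C; [ring|].
        etransitivity; [apply (f_equal (fun w => w - z0)%C), Q|ring]. }
    destruct HH as [d Hd]. eexists. apply (sderiv_Re_dy _ _ _ _ Hd). }
  (* Half the dip survives on a short arc [[0, s]] by continuity; the arc then costs the integral at
     least [s * eta]. *)
  set (eta := (S - phi 0) / 2). assert (Heta : 0 < eta) by (unfold eta; lra).
  assert (Hloc : locally 0 (fun t => Rabs (phi t - phi 0) < eta)).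
  { pose proof (Hphic 0) as Q. apply continuity_pt_filterlim in Q.
    rewrite continuity_pt_locally in Q. apply (Q (mkposreal eta Heta)). }
  destruct Hloc as [del Hd].
  set (s := Rmin (del / 2) PI).
  assert (Hs : 0 < s) by (apply Rmin_glb_lt; [pose proof (cond_pos del); lra|lra]).
  assert (Hs1 : s <= del / 2) by apply Rmin_l. assert (Hs2 : s <= PI) by apply Rmin_r.
  assert (X1 : ex_RInt phi 0 s).
  { apply (ex_RInt_continuous (V := R_CompleteNormedModule)). intros; apply Hphic. }
  assert (X2 : ex_RInt phi s (2 * PI)).
  { apply (ex_RInt_continuous (V := R_CompleteNormedModule)). intros; apply Hphic. }
  assert (Y1 : RInt phi 0 s <= s * (S - eta)).
  { pose proof (is_RInt_const 0 s (S - eta)) as C2.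
    unfold scal in C2; simpl in C2. unfold mult in C2; simpl in C2.
    replace (s * (S - eta)) with ((s - 0) * (S - eta)) by ring.
    apply (is_RInt_le _ _ 0 s _ _ ltac:(lra) (RInt_correct _ _ _ X1) C2).
    intros t Ht.
    assert (Q : Rabs (phi t - phi 0) < eta).
    { apply Hd. unfold ball; simpl. unfold AbsRing_ball, minus, plus, opp, abs; simpl.
      apply Rabs_def1; lra. }
    apply Rabs_def2 in Q. unfold eta in *. lra. }
  assert (Y2 : RInt phi s (2 * PI) <= (2 * PI - s) * S).
  { pose proof (is_RInt_const s (2 * PI) S) as C2.
    unfold scal in C2; simpl in C2. unfold mult in C2; simpl in C2.
    apply (is_RInt_le _ _ s (2 * PI) _ _ ltac:(lra) (RInt_correct _ _ _ X2) C2).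
    intros t Ht. apply Hphi. }
  pose proof (RInt_Chasles phi 0 s (2 * PI) X1 X2) as Ch.
  rewrite (is_RInt_unique (V := R_CompleteNormedModule) _ _ _ _ MV) in Ch.
  unfold plus in Ch; simpl in Ch.
  assert (0 < s * eta) by (apply Rmult_lt_0_compat; lra). lra.
Qed.

(** Compactness in the form of a Lebesgue number: every point is close to a centre whose radius is
    at least the common [e]. Because [P] mentions the radius, a local estimate stated in terms of
    [del] becomes a uniform one in terms of [e]. *)
Lemma rect_cover (a b c d : R) (P : R -> R -> R -> Prop) :
  (forall x y, a <= x <= b -> c <= y <= d -> exists del, 0 < del /\ P x y del) ->
  exists e, 0 < e /\ forall u v, a <= u <= b -> c <= v <= d ->
    exists x y del, a <= x <= b /\ c <= y <= d /\ P x y del /\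
      Rabs (u - x) < del /\ Rabs (v - y) < del /\ e <= del.
Proof.
  intros H.
  assert (H' : forall p : R * R, exists del : posreal,
    a <= fst p <= b -> c <= snd p <= d -> P (fst p) (snd p) del).
  { intros [x y]. simpl. destruct (classic (a <= x <= b /\ c <= y <= d)) as [[Hx Hy]|Hn].
    - destruct (H x y Hx Hy) as [del [Hdel HP]]. exists (mkposreal del Hdel). intros; exact HP.
    - exists (mkposreal 1 Rlt_0_1). intros; exfalso; apply Hn; split; assumption. }
  set (delta := fun x y => proj1_sig (constructive_indefinite_description _ (H' (x, y)))).
  assert (Hdelta : forall x y, a <= x <= b -> c <= y <= d -> P x y (delta x y)).
  { intros x y Hx Hy. unfold delta.
    destruct (constructive_indefinite_description _ (H' (x, y))) as [del Hdel]. simpl in *.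
    apply Hdel; assumption. }
  destruct (compactness_value_2d a b c d delta) as [e He].
  exists e. split; [apply cond_pos|]. intros u v Hu Hv.
  destruct (NNPP _ (He u v Hu Hv)) as [x [y [Hx [Hy [H1 [H2 H3]]]]]].
  exists x, y, (delta x y). repeat split; try apply Hx; try apply Hy; try assumption.
  apply Hdelta; assumption.
Qed.

(** Upper semicontinuity rather than continuity, because [max_modulus_rect] also maximises a
    function that jumps up on the closed set of maximum points. *)
Definition rect_usc (phi : R -> R -> R) (a b c d : R) : Prop :=
  forall x y, a <= x <= b -> c <= y <= d -> forall e, 0 < e ->
    exists del, 0 < del /\ forall u v, a <= u <= b -> c <= v <= d ->
      Rabs (u - x) < del -> Rabs (v - y) < del -> phi u v < phi x y + e.

Lemma rect_usc_max (phi : R -> R -> R) (a b c d : R) : a <= b -> c <= d ->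
  rect_usc phi a b c d ->
  exists x y, a <= x <= b /\ c <= y <= d /\
    forall u v, a <= u <= b -> c <= v <= d -> phi u v <= phi x y.
Proof.
  intros Hab Hcd H.
  assert (Hbd : exists K, forall u v, a <= u <= b -> c <= v <= d -> phi u v <= K).
  (* The radius is tied to the size of [phi] at the centre: with [e <= del], the local bound
     [phi x y + 1] is at most [/ e] everywhere. *)
  { destruct (rect_cover a b c d (fun x y del => del * (Rabs (phi x y) + 1) <= 1 /\
      forall u v, a <= u <= b -> c <= v <= d ->
      Rabs (u - x) < del -> Rabs (v - y) < del -> phi u v < phi x y + 1)) as [e [He Hcov]].
    - intros x y Hx Hy. destruct (H x y Hx Hy 1 Rlt_0_1) as [del [Hdel Hd]].
      pose proof (Rabs_pos (phi x y)).
      exists (Rmin del (/ (Rabs (phi x y) + 1))).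
      pose proof (Rmin_l del (/ (Rabs (phi x y) + 1))).
      pose proof (Rmin_r del (/ (Rabs (phi x y) + 1))).
      split; [apply Rmin_glb_lt; [exact Hdel|apply Rinv_0_lt_compat; lra]|]. split.
      + apply Rle_trans with (/ (Rabs (phi x y) + 1) * (Rabs (phi x y) + 1)).
        * apply Rmult_le_compat_r; lra.
        * rewrite Rinv_l; lra.
      + intros u v Hu Hv Hux Hvy. apply Hd; try assumption; lra.
    - exists (/ e). intros u v Hu Hv.
      destruct (Hcov u v Hu Hv) as [x [y [del [Hx [Hy [[Hdel Hd] [Hux [Hvy Hle]]]]]]]].
      left. eapply Rlt_le_trans; [apply Hd; assumption|].
      pose proof (Rle_abs (phi x y)). pose proof (Rabs_pos (phi x y)).
      apply Rmult_le_reg_l with e; [exact He|]. rewrite Rinv_r by lra.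
      eapply Rle_trans; [|exact Hdel].
      apply Rle_trans with (e * (Rabs (phi x y) + 1)).
      + apply Rmult_le_compat_l; lra.
      + apply Rmult_le_compat_r; lra. }
  destruct Hbd as [K HK].
  destruct (completeness (fun s => exists u v, a <= u <= b /\ c <= v <= d /\ s = phi u v))
    as [S [Hub Hlub]].
  { exists K. intros s [u [v [Hu [Hv ->]]]]. apply HK; assumption. }
  { exists (phi a c), a, c. repeat split; lra. }
  apply NNPP. intros Hno.
  assert (Hlt : forall x y, a <= x <= b -> c <= y <= d -> phi x y < S).
  { intros x y Hx Hy. apply Rnot_le_lt. intros Hge. apply Hno. exists x, y.
    split; [exact Hx|]. split; [exact Hy|]. intros u v Hu Hv.
    eapply Rle_trans; [|exact Hge]. apply Hub. exists u, v. repeat split; tauto. }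
  (* Nearby values stay below [S - (S - phi x y) / 2], hence below [S - del] and [S - e], which
     contradicts the supremum. *)
  destruct (rect_cover a b c d (fun x y del => del <= (S - phi x y) / 2 /\
      forall u v, a <= u <= b -> c <= v <= d ->
      Rabs (u - x) < del -> Rabs (v - y) < del -> phi u v < phi x y + (S - phi x y) / 2))
    as [e [He Hcov]].
  - intros x y Hx Hy. pose proof (Hlt x y Hx Hy).
    destruct (H x y Hx Hy ((S - phi x y) / 2) ltac:(lra)) as [del [Hdel Hd]].
    exists (Rmin del ((S - phi x y) / 2)).
    split; [apply Rmin_glb_lt; lra|]. split; [apply Rmin_r|].
    intros u v Hu Hv Hux Hvy. pose proof (Rmin_l del ((S - phi x y) / 2)).
    apply Hd; try assumption; lra.
  - assert (S <= S - e); [|lra]. apply Hlub. intros s [u [v [Hu [Hv ->]]]].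
    destruct (Hcov u v Hu Hv) as [x [y [del [Hx [Hy [[Hdel Hd] [Hux [Hvy Hle]]]]]]]].
    specialize (Hd u v Hu Hv Hux Hvy). lra.
Qed.

(** These are the local hypotheses of [mean_value]. They admit a removable singularity filled in by
    its limit, before differentiability there is known. *)
Definition qhol_at (F : C -> C) (z : C) : Prop :=
  cont_at F z /\ exists r, 0 < r /\ forall u, u <> z -> Cmod (u - z)%C < r -> hol_at F u.

(* Among the points where the modulus is maximal take one with the largest real part: the mean
   value property produces another one to its right unless it lies on the boundary. *)
Lemma max_modulus_rect (F : C -> C) (a b c d M : R) : a < b -> c < d ->
  (forall z, a <= Re z <= b -> c <= Im z <= d -> qhol_at F z) ->
  (forall z, a <= Re z <= b -> c <= Im z <= d ->
    Re z = a \/ Re z = b \/ Im z = c \/ Im z = d -> Cmod (F z) <= M) ->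
  forall z, a <= Re z <= b -> c <= Im z <= d -> Cmod (F z) <= M.
Proof.
  intros Hab Hcd HF Hbd.
  assert (HU : rect_usc (fun x y => Cmod (F (x, y))) a b c d).
  { intros x y Hx Hy e He. destruct (HF (x, y) Hx Hy) as [Hc _].
    destruct (Hc e He) as [del [Hdel Hd]]. exists (del / 2). split; [lra|].
    intros u v _ _ Hu Hv.
    assert (Q : Cmod (F (u, v) - F (x, y))%C < e).
    { apply Hd. eapply Rle_lt_trans; [apply Cmod_le_Re_Im|]. simpl. unfold Rminus in *. lra. }
    pose proof (Cmod_sub_ge (F (u, v)) (F (x, y))). lra. }
  destruct (rect_usc_max _ a b c d ltac:(lra) ltac:(lra) HU) as [xm [ym [Hxm [Hym Hm]]]].
  simpl in Hm. set (S := Cmod (F (xm, ym))) in *.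
  destruct (Rle_or_lt S M) as [HSM|HSM].
  { intros [x y] Hx Hy. simpl in Hx, Hy. specialize (Hm x y Hx Hy). lra. }
  exfalso.
  (* Maximising [phi] picks a rightmost maximum point: the default [a - 1] lies below every abscissa
     of the rectangle. *)
  set (phi := fun x y => if Req_EM_T (Cmod (F (x, y))) S then x else a - 1).
  assert (HU2 : rect_usc phi a b c d).
  { intros x y Hx Hy e He. unfold phi at 2.
    destruct (Req_EM_T (Cmod (F (x, y))) S) as [E|E].
    - exists e. split; [exact He|]. intros u v Hu _ Hux _. apply Rabs_def2 in Hux.
      unfold phi. destruct (Req_EM_T _ S); lra.
    - destruct (HU x y Hx Hy (S - Cmod (F (x, y)))) as [del [Hdel Hd]].
      { pose proof (Hm x y Hx Hy). lra. }
      exists del. split; [exact Hdel|]. intros u v Hu Hv Hux Hvy.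
      specialize (Hd u v Hu Hv Hux Hvy). simpl in Hd. unfold phi.
      destruct (Req_EM_T _ S); lra. }
  destruct (rect_usc_max _ a b c d ltac:(lra) ltac:(lra) HU2) as [x [y [Hx [Hy Hmax]]]].
  assert (Exy : Cmod (F (x, y)) = S).
  { specialize (Hmax xm ym Hxm Hym). unfold phi in Hmax. fold S in Hmax.
    destruct (Req_EM_T S S) as [_|]; [|lra].
    destruct (Req_EM_T (Cmod (F (x, y))) S) as [E|]; [exact E|lra]. }
  assert (Hint : a < x < b /\ c < y < d).
  { assert (Hb := Hbd (x, y) Hx Hy). simpl in Hb. rewrite Exy in Hb.
    destruct (Req_dec x a) as [->|]; [specialize (Hb ltac:(tauto)); lra|].
    destruct (Req_dec x b) as [->|]; [specialize (Hb ltac:(tauto)); lra|].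
    destruct (Req_dec y c) as [->|]; [specialize (Hb ltac:(tauto)); lra|].
    destruct (Req_dec y d) as [->|]; [specialize (Hb ltac:(tauto)); lra|]. lra. }
  destruct (HF (x, y) Hx Hy) as [Hc [r [Hr Hh]]].
  set (r0 := Rmin r (Rmin (Rmin (x - a) (b - x)) (Rmin (y - c) (d - y)))).
  assert (Hr0 : 0 < r0) by (repeat apply Rmin_glb_lt; lra).
  assert (R1 : r0 <= r) by apply Rmin_l.
  assert (R2 : r0 <= Rmin (Rmin (x - a) (b - x)) (Rmin (y - c) (d - y))) by apply Rmin_r.
  pose proof (Rmin_l (Rmin (x - a) (b - x)) (Rmin (y - c) (d - y))).
  pose proof (Rmin_r (Rmin (x - a) (b - x)) (Rmin (y - c) (d - y))).
  pose proof (Rmin_l (x - a) (b - x)). pose proof (Rmin_r (x - a) (b - x)).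
  pose proof (Rmin_l (y - c) (d - y)). pose proof (Rmin_r (y - c) (d - y)).
  assert (Q : Cmod (F ((x, y) + RtoC (r0 / 2))%C) = Cmod (F (x, y))).
  { apply (max_circle F (x, y) r0 Hr0 Hc); [| |lra].
    - intros u Hu Hur. apply Hh; [exact Hu|lra].
    - intros [u v] Hur. rewrite Exy.
      pose proof (re_le_Cmod ((u, v) - (x, y))%C) as A1.
      pose proof (Im_le_Cmod ((u, v) - (x, y))%C) as A2.
      simpl in A1, A2. apply Rabs_le_between in A1. apply Rabs_le_between in A2.
      apply Hm; lra. }
  rewrite Exy in Q.
  replace ((x, y) + RtoC (r0 / 2))%C with ((x + r0 / 2, y) : C) in Q
    by (unfold Cplus, RtoC; simpl; f_equal; ring).
  specialize (Hmax (x + r0 / 2) y ltac:(lra) ltac:(lra)). unfold phi in Hmax.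
  destruct (Req_EM_T (Cmod (F (x + r0 / 2, y))) S) as [_|]; [|contradiction].
  destruct (Req_EM_T (Cmod (F (x, y))) S) as [_|]; [lra|contradiction].
Qed.

(** * Phragmen-Lindelof in a quadrant; removable singularities of quotients *)

Lemma exp_le (x y : R) : x <= y -> exp x <= exp y.
Proof. intros [H| ->]; [left; apply exp_increasing, H|lra]. Qed.

Lemma hol_qhol (F : C -> C) (z : C) (r : R) : 0 < r ->
  (forall u, Cmod (u - z)%C < r -> hol_at F u) -> qhol_at F z.
Proof.
  intros Hr H. split.
  - apply hol_cont, H. rewrite Cmod_minus_self. exact Hr.
  - exists r. split; [exact Hr|]. intros u _ Hu. apply H, Hu.
Qed.

Lemma near_Re_Im (u z : C) (r : R) : Cmod (u - z)%C < r ->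
  Re z - r < Re u < Re z + r /\ Im z - r < Im u < Im z + r.
Proof.
  intros H. pose proof (re_le_Cmod (u - z)%C) as A. pose proof (Im_le_Cmod (u - z)%C) as B.
  rewrite Re_sub in A. rewrite Im_sub in B.
  apply Rabs_le_between in A. apply Rabs_le_between in B. lra.
Qed.

Lemma Re_clog (z : C) : Re (clog z) = ln (Cmod z).
Proof. reflexivity. Qed.

Lemma Im_clog_bound (z : C) : Rabs (Im (clog z)) <= PI / 2.
Proof. simpl. pose proof (atan_bound (Im z / Re z)). apply Rabs_le. lra. Qed.

(** The real part contains [- Im zt * arg (1 + zt)]. In this sector it is at least
    [- (PI / 2) * Re zt], and the added 2 compensates for it since [PI <= 4]. *)
Lemma mult_clog_lower (zt : C) : 0 <= Re zt -> Rabs (Im zt) <= Re zt ->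
  Re zt * ln (Cmod (1 + zt)%C) <= Re (zt * (clog (1 + zt) + 2))%C.
Proof.
  intros H1 H2. rewrite re_mult, re_plus, im_plus, Re_clog.
  change (Re (RtoC 2)) with 2. change (Im (RtoC 2)) with 0.
  pose proof (Im_clog_bound (1 + zt)%C) as H3. pose proof PI_4.
  set (t := Im (clog (1 + zt)%C)) in *.
  assert (Q : Rabs (Im zt * t) <= Re zt * 2).
  { rewrite Rabs_mult. apply Rmult_le_compat; try apply Rabs_pos; lra. }
  pose proof (Rle_abs (Im zt * t)). lra.
Qed.

(* The damping factor [exp (- delta zt (log (1 + zt) + 2))] with [zt = (1 - i) z] has modulus
   at most 1 on the quadrant and decays faster than any exponential. *)
Lemma phragmen_lindelof (F : C -> C) (K A : R) : 0 <= A ->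
  (forall z, - (1/2) < Re z -> - (1/2) < Im z -> hol_at F z) ->
  (forall z, 0 <= Re z -> 0 <= Im z -> Cmod (F z) <= K * exp (A * (Re z + Im z))) ->
  (forall z, 0 <= Re z -> 0 <= Im z -> Re z = 0 \/ Im z = 0 -> Cmod (F z) <= K) ->
  forall z, 0 <= Re z -> 0 <= Im z -> Cmod (F z) <= K.
Proof.
  intros HA HF Hg Hb z1 Hx1 Hy1.
  assert (HK : 0 <= K).
  { eapply Rle_trans; [apply (Cmod_ge_0 (F 0%C))|]. apply Hb; simpl; try lra. }
  (* Multiplication by [1 - i] turns the quadrant into the sector required by [mult_clog_lower], and
     the real part becomes [Re z + Im z]. *)
  set (w := (RtoC 1 - Ci)%C).
  assert (Rw : forall z, Re (w * z)%C = Re z + Im z).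
  { intros [x y]. unfold w, Ci, RtoC; simpl. ring. }
  assert (Iw : forall z, Im (w * z)%C = Im z - Re z).
  { intros [x y]. unfold w, Ci, RtoC; simpl. ring. }
  set (L := fun z => (w * z * (clog (1 + w * z) + 2))%C).
  assert (HL : forall z, 0 <= Re z -> 0 <= Im z ->
    (Re z + Im z) * ln (Cmod (1 + w * z)%C) <= Re (L z)).
  { intros z Hx Hy. unfold L. rewrite <- Rw. apply mult_clog_lower; rewrite Rw; [lra|].
    rewrite Iw. apply Rabs_le. lra. }
  assert (Hm : forall z, 1 + (Re z + Im z) <= Cmod (1 + w * z)%C).
  { intros z. rewrite <- Rw. eapply Rle_trans; [|apply re_le_Cmod].
    rewrite re_plus. change (Re (RtoC 1)) with 1. apply Rle_abs. }
  assert (HL0 : forall z, 0 <= Re z -> 0 <= Im z -> 0 <= Re (L z)).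
  { intros z Hx Hy. eapply Rle_trans; [|apply HL; assumption].
    apply Rmult_le_pos; [lra|]. rewrite <- ln_1. apply ln_le; [lra|].
    pose proof (Hm z). lra. }
  assert (Main : forall del, 0 < del -> Cmod (F z1) * exp (- (del * Re (L z1))) <= K).
  { intros del Hdel.
    set (G := fun z => (F z * cexp (- (RtoC del * L z)))%C).
    assert (GE : forall z, Cmod (G z) = Cmod (F z) * exp (- (del * Re (L z)))).
    { intros z. unfold G. rewrite Cmod_mult, Cmod_cexp. f_equal. f_equal.
      rewrite re_opp, re_scal_l. reflexivity. }
    (* On the far sides the logarithm is at least [A / del], so the damping cancels
       [exp (A * (Re z + Im z))]; the other summands put [z1] inside the square. *)
    set (X := exp (A / del) + Re z1 + Im z1 + 1).
    pose proof (exp_pos (A / del)) as He.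
    rewrite <- GE.
    apply (max_modulus_rect G 0 X 0 X K); try (unfold X; lra).
    - intros z Hx Hy. apply (hol_qhol G z (1 / 2)); [lra|]. intros u Hu.
      apply near_Re_Im in Hu. unfold G.
      assert (HW : hol_at (fun u => w * u)%C u) by (apply hol_mult; [apply hol_const|apply hol_id]).
      apply hol_mult; [apply HF; lra|]. apply hol_cexp, hol_opp.
      apply hol_mult; [apply hol_const|]. unfold L.
      apply hol_mult; [exact HW|]. apply hol_plus; [|apply hol_const].
      apply hol_clog; [apply hol_plus; [apply hol_const|exact HW]|].
      rewrite re_plus, Rw. change (Re (RtoC 1)) with 1. lra.
    - intros z Hx Hy Hbd. rewrite GE.
      pose proof (HL0 z ltac:(lra) ltac:(lra)) as P0.
      assert (Hcase : (Re z = 0 \/ Im z = 0) \/ X <= Re z + Im z)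
        by (destruct Hbd as [H|[H|[H|H]]]; [left; tauto|right; lra|left; tauto|right; lra]).
      destruct Hcase as [Hc|Hc].
      + apply Rle_trans with (K * 1); [|lra].
        apply Rmult_le_compat; [apply Cmod_ge_0|left; apply exp_pos| |].
        * apply Hb; [lra|lra|exact Hc].
        * rewrite <- exp_0. apply exp_le. assert (0 <= del * Re (L z)) by (apply Rmult_le_pos; lra). lra.
      + apply Rle_trans with (K * exp (A * (Re z + Im z)) * exp (- (del * Re (L z)))).
        * apply Rmult_le_compat_r; [left; apply exp_pos|]. apply Hg; lra.
        * rewrite Rmult_assoc, <- exp_plus. rewrite <- (Rmult_1_r K) at 2.
          apply Rmult_le_compat_l; [exact HK|]. rewrite <- exp_0. apply exp_le.
          assert (Q : A / del <= ln (Cmod (1 + w * z)%C)).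
          { rewrite <- (ln_exp (A / del)). apply ln_le; [exact He|].
            pose proof (Hm z). unfold X in Hc. lra. }
          assert (Q2 : del * ((Re z + Im z) * (A / del)) <= del * Re (L z)).
          { apply Rmult_le_compat_l; [lra|]. eapply Rle_trans; [|apply HL; lra].
            apply Rmult_le_compat_l; lra. }
          replace (del * ((Re z + Im z) * (A / del))) with (A * (Re z + Im z)) in Q2 by (field; lra).
          lra. }
  apply Rnot_lt_le. intros Hlt.
  pose proof (HL0 z1 Hx1 Hy1) as HC. set (c := Re (L z1)) in *.
  set (m := Cmod (F z1)) in *.
  (* An explicit form of letting [del] tend to 0: with [exp (- (del * c)) >= 1 - del * c], the
     damped modulus at [z1] still exceeds [K]. *)
  set (del := (m - K) / (2 * (m * (c + 1)))).
  assert (Hm1 : 0 < m * (c + 1)) by (apply Rmult_lt_0_compat; lra).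
  assert (Hdel : 0 < del) by (apply Rdiv_lt_0_compat; lra).
  specialize (Main del Hdel).
  assert (E1 : 1 - del * c <= exp (- (del * c))).
  { pose proof (exp_ineq1_le (- (del * c))). lra. }
  assert (E2 : m * (1 - del * c) <= m * exp (- (del * c))) by (apply Rmult_le_compat_l; lra).
  assert (E3 : del * (m * (c + 1)) = (m - K) / 2) by (unfold del; field; lra).
  assert (0 < del * m) by (apply Rmult_lt_0_compat; lra). lra.
Qed.

(** The factor [exp (- (p - i q) z)] has modulus [exp (- (p x + q y))], which reduces the claim to a
    function bounded by [K] on both edges. *)
Lemma quadrant_growth (g : C -> C) (K A p q : R) : 0 <= A -> 0 <= K ->
  (forall z, - (1/2) < Re z -> - (1/2) < Im z -> hol_at g z) ->
  (forall z, 0 <= Re z -> 0 <= Im z -> Cmod (g z) <= K * exp (A * (Re z + Im z))) ->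
  (forall z, 0 <= Re z -> Im z = 0 -> Cmod (g z) <= K * exp (p * Re z)) ->
  (forall z, Re z = 0 -> 0 <= Im z -> Cmod (g z) <= K * exp (q * Im z)) ->
  forall z, 0 <= Re z -> 0 <= Im z -> Cmod (g z) <= K * exp (p * Re z + q * Im z).
Proof.
  intros HA HK Hg H1 H2 H3.
  set (F := fun z => (g z * cexp (- ((RtoC p - Ci * RtoC q) * z)))%C).
  assert (FE : forall z, Cmod (F z) = Cmod (g z) * exp (- (p * Re z + q * Im z))).
  { intros z. unfold F. rewrite Cmod_mult, Cmod_cexp. f_equal. f_equal.
    destruct z as [x y]. unfold Ci, RtoC; simpl. ring. }
  assert (PL : forall z, 0 <= Re z -> 0 <= Im z -> Cmod (F z) <= K).
  { apply (phragmen_lindelof F K (A + Rabs p + Rabs q)).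
    - pose proof (Rabs_pos p). pose proof (Rabs_pos q). lra.
    - intros z Hx Hy. apply hol_mult; [apply Hg; assumption|]. apply hol_cexp, hol_opp.
      apply hol_mult; [apply hol_const|apply hol_id].
    - intros z Hx Hy. rewrite FE.
      eapply Rle_trans; [apply Rmult_le_compat_r; [left; apply exp_pos|apply H1; assumption]|].
      rewrite Rmult_assoc, <- exp_plus. apply Rmult_le_compat_l; [exact HK|]. apply exp_le.
      assert (- p * Re z <= Rabs p * Re z)
        by (apply Rmult_le_compat_r; [exact Hx|]; rewrite <- Rabs_Ropp; apply Rle_abs).
      assert (- q * Im z <= Rabs q * Im z)
        by (apply Rmult_le_compat_r; [exact Hy|]; rewrite <- Rabs_Ropp; apply Rle_abs).
      assert (0 <= Rabs p * Im z) by (apply Rmult_le_pos; [apply Rabs_pos|exact Hy]).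
      assert (0 <= Rabs q * Re z) by (apply Rmult_le_pos; [apply Rabs_pos|exact Hx]).
      lra.
    - intros z Hx Hy Hc. rewrite FE. rewrite <- (Rmult_1_r K).
      apply Rle_trans with (K * exp (p * Re z + q * Im z) * exp (- (p * Re z + q * Im z))).
      + apply Rmult_le_compat_r; [left; apply exp_pos|]. destruct Hc as [Hc|Hc].
        * eapply Rle_trans; [apply H3; assumption|]. rewrite Hc. apply Req_le. do 2 f_equal. ring.
        * eapply Rle_trans; [apply H2; assumption|]. rewrite Hc. apply Req_le. do 2 f_equal. ring.
      + rewrite Rmult_assoc, <- exp_plus. rewrite Rplus_opp_r, exp_0. lra. }
  intros z Hx Hy. specialize (PL z Hx Hy). rewrite FE in PL.
  apply Rmult_le_compat_r with (r := exp (p * Re z + q * Im z)) in PL; [|left; apply exp_pos].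
  rewrite Rmult_assoc, <- exp_plus, Rplus_opp_l, exp_0, Rmult_1_r in PL. exact PL.
Qed.

Lemma half_plane_growth (g : C -> C) (K alpha b : R) : 0 <= alpha -> 0 <= K ->
  (forall z, - (1/2) < Re z -> hol_at g z) ->
  (forall z, 0 <= Re z -> Cmod (g z) <= K * exp (alpha * Cmod z)) ->
  (forall z, Re z = 0 -> Cmod (g z) <= K * exp (b * Rabs (Im z))) ->
  forall z, 0 <= Re z -> Cmod (g z) <= K * exp (alpha * Re z + b * Rabs (Im z)).
Proof.
  intros Ha HK Hg H1 H2.
  assert (B : forall z, 0 <= Re z -> Cmod (g z) <= K * exp (alpha * (Re z + Rabs (Im z)))).
  { intros z Hx. eapply Rle_trans; [apply H1, Hx|]. apply Rmult_le_compat_l; [exact HK|].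
    apply exp_le. apply Rmult_le_compat_l; [exact Ha|].
    pose proof (Cmod_le_Re_Im z) as Q. rewrite (Rabs_pos_eq (Re z)) in Q by exact Hx. exact Q. }
  intros z Hx. destruct (Rle_or_lt 0 (Im z)) as [Hy|Hy].
  - rewrite (Rabs_pos_eq (Im z)) by exact Hy.
    apply (quadrant_growth g K alpha alpha b); try assumption.
    + intros; apply Hg; assumption.
    + intros u Hu Hv. rewrite <- (Rabs_pos_eq (Im u)) by exact Hv. apply B, Hu.
    + intros u Hu Hv. eapply Rle_trans; [apply B, Hu|]. rewrite Hv, Rabs_R0, Rplus_0_r. lra.
    + intros u Hu Hv. eapply Rle_trans; [apply H2, Hu|]. rewrite Rabs_pos_eq by exact Hv. lra.
  (* Multiplication by [i] carries the lower quadrant to the upper one and exchanges the two edges,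
     hence the rates [b] and [alpha] in swapped positions below. *)
  - set (g' := fun u => g (- Ci * u)%C).
    assert (Er : forall u, Re (- Ci * u)%C = Im u) by (intros [x y]; simpl; ring).
    assert (Ei : forall u, Im (- Ci * u)%C = - Re u) by (intros [x y]; simpl; ring).
    assert (Ez : g z = g' (Ci * z)%C).
    { unfold g'. f_equal. destruct z as [x y]. unfold Cmult, Ci, Copp; simpl. f_equal; ring. }
    assert (Rz : Re (Ci * z)%C = - Im z) by (destruct z; simpl; ring).
    assert (Iz : Im (Ci * z)%C = Re z) by (destruct z; simpl; ring).
    rewrite Ez, (Rabs_left (Im z)) by exact Hy.
    replace (alpha * Re z + b * - Im z) with (b * Re (Ci * z)%C + alpha * Im (Ci * z)%C)
      by (rewrite Rz, Iz; ring).
    apply (quadrant_growth g' K alpha b alpha); try assumption.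
    + intros u _ Hu. apply (hol_comp g (fun u => - Ci * u)%C).
      * apply hol_mult; [apply hol_const|apply hol_id].
      * apply Hg. rewrite Er. exact Hu.
    + intros u Hu Hv. unfold g'. eapply Rle_trans; [apply B; rewrite Er; exact Hv|].
      rewrite Er, Ei, Rabs_Ropp, Rabs_pos_eq by exact Hu. rewrite Rplus_comm. lra.
    + intros u Hu Hv. unfold g'. eapply Rle_trans; [apply H2; rewrite Er; exact Hv|].
      rewrite Ei, Rabs_Ropp, Rabs_pos_eq by exact Hu. lra.
    + intros u Hu Hv. unfold g'. eapply Rle_trans; [apply B; rewrite Er; exact Hv|].
      rewrite Er, Ei, Hu, Ropp_0, Rabs_R0, Rplus_0_r. lra.
    + rewrite Rz. lra.
    + rewrite Iz. exact Hx.
Qed.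

(** * Removable singularities of a quotient at simple zeros of the denominator *)

Definition quot_limit (H S : C -> C) (z l : C) : Prop :=
  forall e, 0 < e -> exists del, 0 < del /\
    forall u, u <> z -> Cmod (u - z)%C < del -> Cmod (H u / S u - l)%C < e.

(* The ratio [H / S], with its limit where [S] vanishes (junk if there is no limit). *)
Definition quot_ext (H S : C -> C) (z : C) : C :=
  if excluded_middle_informative (S z = 0%C)
  then epsilon (inhabits (RtoC 0)) (quot_limit H S z) else (H z / S z)%C.

Lemma sderiv_zero_lower (S : C -> C) (z d : C) : sderiv S z d -> S z = 0%C -> d <> 0%C ->
  exists del, 0 < del /\ forall u, Cmod (u - z)%C < del ->
    Cmod d / 2 * Cmod (u - z)%C <= Cmod (S u).
Proof.
  intros HS Hz Hd. apply Cmod_gt_0 in Hd.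
  destruct (HS (Cmod d / 2) ltac:(lra)) as [del [Hdel H]]. exists del. split; [exact Hdel|].
  intros u Hu. specialize (H u z Hu ltac:(rewrite Cmod_minus_self; exact Hdel)).
  rewrite Hz in H. replace (S u - 0 - d * (u - z))%C with (S u - d * (u - z))%C in H by ring.
  pose proof (Cmod_sub_ge (d * (u - z))%C (S u)) as Q. rewrite (Cmod_sub_sym (d * (u - z))%C) in Q.
  rewrite Cmod_mult in Q. lra.
Qed.

(** L'Hopital's rule at a simple zero: both functions are replaced by their linear parts, and [S] is
    bounded below by [sderiv_zero_lower]. *)
Lemma quot_limit_exists (H S : C -> C) (z d d' : C) :
  sderiv H z d -> sderiv S z d' -> H z = 0%C -> S z = 0%C -> d' <> 0%C ->
  quot_limit H S z (d / d')%C.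
Proof.
  intros HH HS Hz Sz Hd' e He.
  destruct (sderiv_zero_lower S z d' HS Sz Hd') as [d1 [Hd1 Low]].
  assert (Hd'0 : 0 < Cmod d') by (apply Cmod_gt_0; exact Hd').
  set (m := Cmod d') in *. pose proof (Cmod_ge_0 d) as Hd0.
  (* The numerator of the error is at most [k * (m + Cmod d) * t], the denominator at least
     [m / 2 * t * m]; this [k] gives a ratio of [e / 2]. *)
  set (k := e * (m * m) / (4 * (m + Cmod d))).
  assert (Hmm : 0 < m * m) by (apply Rmult_lt_0_compat; lra).
  assert (Hk : 0 < k) by (apply Rdiv_lt_0_compat; [apply Rmult_lt_0_compat|]; lra).
  assert (Ek : k * (m + Cmod d) = e * (m * m) / 4) by (unfold k; field; lra).
  destruct (HH k Hk) as [d2 [Hd2 H2]]. destruct (HS k Hk) as [d3 [Hd3 H3]].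
  exists (Rmin d1 (Rmin d2 d3)). split; [repeat apply Rmin_glb_lt; assumption|].
  intros u Hu Hur.
  pose proof (Rmin_l d1 (Rmin d2 d3)). pose proof (Rmin_r d1 (Rmin d2 d3)).
  pose proof (Rmin_l d2 d3). pose proof (Rmin_r d2 d3).
  assert (Hw : 0 < Cmod (u - z)%C).
  { apply Cmod_gt_0. intros Q. apply Hu. replace u with ((u - z) + z)%C by ring. rewrite Q. ring. }
  specialize (H2 u z ltac:(lra) ltac:(rewrite Cmod_minus_self; lra)).
  specialize (H3 u z ltac:(lra) ltac:(rewrite Cmod_minus_self; lra)).
  specialize (Low u ltac:(lra)). rewrite Hz in H2. rewrite Sz in H3.
  set (t := Cmod (u - z)%C) in *.
  assert (HS1 : 0 < Cmod (S u)).
  { eapply Rlt_le_trans; [|exact Low]. apply Rmult_lt_0_compat; lra. }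
  assert (HS0 : S u <> 0%C) by (apply Cmod_gt_0; exact HS1).
  replace (H u / S u - d / d')%C with
    ((d' * (H u - 0 - d * (u - z)) + - (d * (S u - 0 - d' * (u - z)))) / (S u * d'))%C
    by (field; split; assumption).
  rewrite Cmod_div by (apply Cmult_neq_0; assumption).
  rewrite (Cmod_mult (S u)). fold m.
  apply Rlt_div_l; [apply Rmult_lt_0_compat; lra|].
  eapply Rle_lt_trans; [apply Cmod_triangle|]. rewrite Cmod_opp, !Cmod_mult. fold m.
  assert (A1 : m * Cmod (H u - 0 - d * (u - z))%C <= m * (k * t)) by (apply Rmult_le_compat_l; lra).
  assert (A2 : Cmod d * Cmod (S u - 0 - d' * (u - z))%C <= Cmod d * (k * t))
    by (apply Rmult_le_compat_l; lra).
  apply Rle_lt_trans with (e * (m * m) / 4 * t); [rewrite <- Ek; lra|].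
  apply Rlt_le_trans with (e * (m / 2 * t * m)).
  - assert (0 < e * (m * m) * t) by (repeat apply Rmult_lt_0_compat; lra). lra.
  - apply Rmult_le_compat_l; [lra|]. apply Rmult_le_compat_r; lra.
Qed.

Lemma quot_ext_hol (H S : C -> C) (z : C) :
  hol_at H z -> hol_at S z -> S z <> 0%C ->
  (exists r, 0 < r /\ forall u, Cmod (u - z)%C < r -> S u <> 0%C) /\ hol_at (quot_ext H S) z.
Proof.
  intros HH HS Hz.
  destruct (hol_cont S z HS (Cmod (S z))) as [del [Hdel Hd]]; [apply Cmod_gt_0, Hz|].
  assert (N : forall u, Cmod (u - z)%C < del -> S u <> 0%C).
  { intros u Hu Q. specialize (Hd u Hu). rewrite Q in Hd.
    replace (0 - S z)%C with (- S z)%C in Hd by ring. rewrite Cmod_opp in Hd. lra. }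
  split; [exists del; split; assumption|].
  apply (hol_local (fun u => H u / S u)%C _ z del Hdel).
  - intros u Hu. unfold quot_ext. destruct (excluded_middle_informative _) as [Q|]; [|reflexivity].
    exfalso. exact (N u Hu Q).
  - apply hol_div; assumption.
Qed.

(** A zero of [S] with nonzero derivative is isolated, so around it the extension is an honest
    quotient, while at the zero the existence of the limit gives continuity. *)
Lemma quot_ext_qhol (H S : C -> C) (z d' : C) (r : R) : 0 < r ->
  (forall u, Cmod (u - z)%C < r -> hol_at H u) -> (forall u, Cmod (u - z)%C < r -> hol_at S u) ->
  sderiv S z d' -> (S z = 0%C -> H z = 0%C /\ d' <> 0%C) -> qhol_at (quot_ext H S) z.
Proof.
  intros Hr HH HS HSd Hz.
  assert (Hzz : Cmod (z - z)%C < r) by (rewrite Cmod_minus_self; exact Hr).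
  destruct (classic (S z = 0%C)) as [E|E].
  - destruct (Hz E) as [EH Hd'].
    destruct (sderiv_zero_lower S z d' HSd E Hd') as [d1 [Hd1 Low]].
    assert (N : forall u, u <> z -> Cmod (u - z)%C < d1 -> S u <> 0%C).
    { intros u Hu Hur Q. specialize (Low u Hur). rewrite Q, Cmod_0 in Low.
      assert (0 < Cmod (u - z)%C).
      { apply Cmod_gt_0. intros Q'. apply Hu. replace u with ((u - z) + z)%C by ring.
        rewrite Q'. ring. }
      apply Cmod_gt_0 in Hd'.
      assert (0 < Cmod d' / 2 * Cmod (u - z)%C) by (apply Rmult_lt_0_compat; lra). lra. }
    split.
    + assert (L : quot_limit H S z (quot_ext H S z)).
      { unfold quot_ext. destruct (excluded_middle_informative _) as [_|]; [|contradiction].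
        apply epsilon_spec. destruct (HH z Hzz) as [d Hd]. exists (d / d')%C.
        apply quot_limit_exists; assumption. }
      intros e He. destruct (L e He) as [d2 [Hd2 H2]].
      exists (Rmin d1 d2). split; [apply Rmin_glb_lt; assumption|]. intros u Hu.
      pose proof (Rmin_l d1 d2). pose proof (Rmin_r d1 d2).
      destruct (classic (u = z)) as [->|Hn]; [rewrite Cmod_minus_self; exact He|].
      assert (Eu : quot_ext H S u = (H u / S u)%C).
      { unfold quot_ext at 1. destruct (excluded_middle_informative _) as [Q|]; [|reflexivity].
        exfalso. exact (N u Hn ltac:(lra) Q). }
      rewrite Eu. apply H2; [exact Hn|lra].
    + exists (Rmin r d1). split; [apply Rmin_glb_lt; assumption|]. intros u Hu Hur.
      pose proof (Rmin_l r d1). pose proof (Rmin_r r d1).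
      apply quot_ext_hol; [apply HH; lra|apply HS; lra|apply N; [exact Hu|lra]].
  - destruct (quot_ext_hol H S z (HH z Hzz) (HS z Hzz) E) as [[d1 [Hd1 N]] _].
    apply (hol_qhol _ z (Rmin r d1)); [apply Rmin_glb_lt; assumption|]. intros u Hu.
    pose proof (Rmin_l r d1). pose proof (Rmin_r r d1).
    apply quot_ext_hol; [apply HH; lra|apply HS; lra|apply N; lra].
Qed.

(** * Carlson's theorem *)

(* [2 i sin (pi z)] *)
Definition csin_pi (z : C) : C :=
  (cexp (RtoC PI * Ci * z) - cexp (- (RtoC PI * Ci) * z))%C.

Lemma csin_pi_pair (x y : R) : csin_pi (x, y) =
  (cos (PI * x) * (exp (- (PI * y)) - exp (PI * y)),
   sin (PI * x) * (exp (- (PI * y)) + exp (PI * y))).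
Proof.
  unfold csin_pi.
  replace (RtoC PI * Ci * (x, y))%C with ((- (PI * y))%R, (PI * x)%R)
    by (unfold Cmult, RtoC, Ci; simpl; f_equal; ring).
  replace (- (RtoC PI * Ci) * (x, y))%C with ((PI * y)%R, (- (PI * x))%R)
    by (unfold Cmult, Copp, RtoC, Ci; simpl; f_equal; ring).
  unfold cexp, Cminus, Cplus, Copp; simpl. rewrite cos_neg, sin_neg. f_equal; ring.
Qed.

Lemma sderiv_csin_pi (z : C) : sderiv csin_pi z
  (RtoC PI * Ci * (cexp (RtoC PI * Ci * z) + cexp (- (RtoC PI * Ci) * z)))%C.
Proof.
  assert (H : forall c, sderiv (fun u => cexp (c * u)%C) z (cexp (c * z) * (0 * z + c * 1))%C).
  { intros c. apply (sderiv_comp cexp (fun u => c * u)%C); [|apply sderiv_cexp].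
    apply (sderiv_mult (fun _ => c) (fun u => u)); [apply sderiv_const|apply sderiv_id]. }
  pose proof (sderiv_plus _ _ z _ _ (H (RtoC PI * Ci)%C)
    (sderiv_mult (fun _ => (- (1))%C) _ z _ _ (sderiv_const _ z) (H (- (RtoC PI * Ci))%C))) as Q.
  match type of Q with sderiv _ _ ?d => replace
    (RtoC PI * Ci * (cexp (RtoC PI * Ci * z) + cexp (- (RtoC PI * Ci) * z)))%C with d
    by (cbv beta; ring) end.
  revert Q. apply (sderiv_local _ _ _ _ 1 Rlt_0_1). intros u _. unfold csin_pi. ring.
Qed.

(** At a zero the two exponentials coincide, so the derivative is [2 pi i] times a nonzero
    exponential: all zeros are simple. *)
Lemma csin_pi_deriv_neq_0 (z : C) : csin_pi z = 0%C ->
  (RtoC PI * Ci * (cexp (RtoC PI * Ci * z) + cexp (- (RtoC PI * Ci) * z)))%C <> 0%C.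
Proof.
  intros H. unfold csin_pi in H.
  assert (E : cexp (- (RtoC PI * Ci) * z)%C = cexp (RtoC PI * Ci * z)%C).
  { set (a := cexp (RtoC PI * Ci * z)%C) in *. set (b := cexp (- (RtoC PI * Ci) * z)%C) in *.
    replace b with (a - (a - b))%C by ring. rewrite H. ring. }
  rewrite E. set (a := cexp (RtoC PI * Ci * z)%C).
  replace (a + a)%C with (RtoC 2 * a)%C by ring.
  pose proof PI_RGT_0.
  repeat apply Cmult_neq_0.
  - intros Q. apply RtoC_inj in Q. lra.
  - intros Q. apply (f_equal Im) in Q. simpl in Q. lra.
  - intros Q. apply RtoC_inj in Q. lra.
  - apply cexp_neq_0.
Qed.

Lemma csin_pi_zero (z : C) : 0 < Re z -> csin_pi z = 0%C ->
  exists n, (1 <= n)%nat /\ z = RtoC (INR n).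
Proof.
  destruct z as [x y]. simpl. intros Hx. rewrite csin_pi_pair. intros H.
  pose proof (f_equal Re H) as H1. pose proof (f_equal Im H) as H2. simpl in H1, H2.
  pose proof (exp_pos (PI * y)). pose proof (exp_pos (- (PI * y))). pose proof PI_RGT_0.
  assert (Hs : sin (PI * x) = 0) by (apply Rmult_integral in H2; destruct H2; lra).
  assert (Hc : cos (PI * x) <> 0).
  { intros Q. pose proof (sin2_cos2 (PI * x)) as T. rewrite Hs, Q in T. unfold Rsqr in T. lra. }
  assert (Hy : exp (- (PI * y)) = exp (PI * y)).
  { apply Rmult_integral in H1. destruct H1; [contradiction|lra]. }
  apply exp_inv in Hy.
  assert (Hy0 : y = 0).
  { assert (Q : PI * y = 0) by lra. apply Rmult_integral in Q. destruct Q; lra. }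
  destruct (sin_eq_0_0 _ Hs) as [k Hk].
  assert (Ex : x = IZR k) by (apply Rmult_eq_reg_l with PI; lra).
  assert (Hk0 : (0 < k)%Z) by (apply lt_IZR; lra).
  exists (Z.to_nat k). split; [lia|].
  rewrite INR_IZR_INZ, Z2Nat.id by lia. unfold RtoC. now rewrite Ex, Hy0.
Qed.

(** Over a half-integer the cosine vanishes and the sine is 1 or -1, so the modulus is
    [2 cosh (pi y)]. This serves the vertical sides of the rectangle in [carlson]. *)
Lemma csin_pi_lower_half (n : nat) (y : R) :
  exp (PI * Rabs y) <= Cmod (csin_pi (INR n + 1 / 2, y)).
Proof.
  rewrite csin_pi_pair.
  assert (Hc : cos (PI * (INR n + 1 / 2)) = 0).
  { apply cos_eq_0_1. exists (Z.of_nat n). rewrite <- INR_IZR_INZ. field. }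
  assert (Hs : Rabs (sin (PI * (INR n + 1 / 2))) = 1).
  { pose proof (sin2_cos2 (PI * (INR n + 1 / 2))) as T. rewrite Hc in T.
    assert (T' : (sin (PI * (INR n + 1 / 2)))² = 1²) by (unfold Rsqr in *; lra).
    apply Rsqr_eq_abs_0 in T'. rewrite T'. apply Rabs_R1. }
  eapply Rle_trans; [|apply Im_le_Cmod]. simpl. rewrite Rabs_mult, Hs, Rmult_1_l.
  pose proof (exp_pos (PI * y)). pose proof (exp_pos (- (PI * y))).
  rewrite (Rabs_pos_eq (exp (- (PI * y)) + exp (PI * y))) by lra.
  destruct (Rle_or_lt 0 y) as [H1|H1].
  - rewrite Rabs_pos_eq by exact H1. lra.
  - rewrite Rabs_left by exact H1. replace (PI * - y) with (- (PI * y)) by ring. lra.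
Qed.

(** The modulus is at least the difference of the moduli of the two exponentials, whatever [x] is.
    This serves the horizontal sides of the rectangle. *)
Lemma csin_pi_lower (x y : R) : 1 <= Rabs y ->
  exp (PI * Rabs y) / 2 <= Cmod (csin_pi (x, y)).
Proof.
  intros Hy.
  assert (Hpi : 1 <= PI * Rabs y).
  { pose proof PI2_1. assert (PI * 1 <= PI * Rabs y) by (apply Rmult_le_compat_l; lra). lra. }
  assert (Q : exp (PI * Rabs y) - exp (- (PI * Rabs y)) <= Cmod (csin_pi (x, y))).
  { unfold csin_pi. set (a := (RtoC PI * Ci * (x, y))%C). set (b := (- (RtoC PI * Ci) * (x, y))%C).
    assert (Ra : Re a = - (PI * y)) by (unfold a, Cmult, RtoC, Ci; simpl; ring).
    assert (Rb : Re b = PI * y) by (unfold b, Cmult, Copp, RtoC, Ci; simpl; ring).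
    pose proof (Cmod_sub_ge (cexp a) (cexp b)) as A.
    pose proof (Cmod_sub_ge (cexp b) (cexp a)) as B. rewrite (Cmod_sub_sym (cexp b)) in B.
    rewrite !Cmod_cexp, Ra, Rb in A. rewrite !Cmod_cexp, Ra, Rb in B.
    destruct (Rle_or_lt 0 y) as [H1|H1].
    - rewrite Rabs_pos_eq by exact H1. exact B.
    - rewrite Rabs_left by exact H1. replace (- (PI * - y)) with (PI * y) by ring.
      replace (PI * - y) with (- (PI * y)) by ring. exact A. }
  assert (E1 : 2 <= exp (PI * Rabs y)) by (pose proof (exp_ineq1_le (PI * Rabs y)); lra).
  assert (E2 : exp (- (PI * Rabs y)) <= 1) by (rewrite <- exp_0; apply exp_le; lra).
  lra.
Qed.

(* [H / sin (pi z)] is multiplied by [exp (omega zt - c zt log (1 + zt))], [zt = z - 1/2]: with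
   [c = 2 (pi - b) / pi] the product is bounded independently of [omega] on the line
   [Re z = 1/2] and, far out, on the other sides of a rectangle; then [omega] tends to infinity. *)
Lemma carlson (H : C -> C) (K A b : R) : 0 <= K -> b < PI ->
  (forall z, 0 < Re z -> hol_at H z) ->
  (forall z, 1 / 2 <= Re z -> Cmod (H z) <= K * exp (A * Re z + b * Rabs (Im z))) ->
  (forall n : nat, (1 <= n)%nat -> H (RtoC (INR n)) = 0%C) ->
  forall z, 1 / 2 < Re z -> H z = 0%C.
Proof.
  intros HK Hb HH Hg Hn z1 Hz1.
  assert (HPI : 0 < PI) by apply PI_RGT_0.
  (* The argument of [1 + zt] contributes at most [c * (PI / 2) * Rabs (Im z)], and this [c] makes
     it equal to the decay [a * Rabs (Im z)] gained from the sine. *)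
  set (a := PI - b). set (c := 2 * a / PI).
  assert (Ha : 0 < a) by (unfold a; lra).
  assert (Hc : 0 < c) by (apply Rdiv_lt_0_compat; lra).
  assert (Hca : c * (PI / 2) = a) by (unfold c; field; lra).
  set (Q := quot_ext H csin_pi).
  assert (HQ : forall z, 1 / 2 <= Re z -> qhol_at Q z).
  { intros z Hz. eapply (quot_ext_qhol H csin_pi z _ (1 / 2)); [lra| | |apply sderiv_csin_pi|].
    - intros u Hu. apply near_Re_Im in Hu. apply HH. lra.
    - intros u _. eexists. apply sderiv_csin_pi.
    - intros Hs. split; [|apply csin_pi_deriv_neq_0, Hs].
      destruct (csin_pi_zero z ltac:(lra) Hs) as [n [Hn1 ->]]. apply Hn, Hn1. }
  set (zt := fun z : C => (z - RtoC (1 / 2))%C).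
  assert (Rzt : forall z, Re (zt z) = Re z - 1 / 2) by (intros [x y]; simpl; ring).
  assert (Izt : forall z, Im (zt z) = Im z) by (intros [x y]; simpl; ring).
  assert (HZ : forall u, hol_at zt u) by (intros u; apply hol_minus; [apply hol_id|apply hol_const]).
  set (E := fun om z => cexp (zt z * (RtoC om - RtoC c * clog (1 + zt z)))%C).
  assert (EE : forall om z, Cmod (E om z) =
    exp (Re (zt z) * (om - c * ln (Cmod (1 + zt z)%C)) + c * (Im z * Im (clog (1 + zt z)%C)))).
  { intros om z. unfold E. rewrite Cmod_cexp, re_mult. f_equal.
    rewrite Re_sub, Im_sub, re_scal_l, Im_scal, Re_clog, Izt.
    change (Re (RtoC om)) with om. change (Im (RtoC om)) with 0. ring. }
  assert (Ele : forall om z, Cmod (E om z) <=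
    exp (Re (zt z) * (om - c * ln (Cmod (1 + zt z)%C)) + a * Rabs (Im z))).
  { intros om z. rewrite EE. apply exp_le, Rplus_le_compat_l. rewrite <- Hca, Rmult_assoc.
    apply Rmult_le_compat_l; [lra|]. eapply Rle_trans; [apply Rle_abs|]. rewrite Rabs_mult.
    rewrite Rmult_comm. apply Rmult_le_compat_r; [apply Rabs_pos|]. apply Im_clog_bound. }
  (* The 2 comes from the lower bound of the sine by half an exponential. In the exponent
     [A * Re z = A / 2 + A * Re (zt z)], and the second part is absorbed by the logarithm. *)
  set (M := 2 * K * exp (A / 2)).
  assert (HM : 0 <= M) by (apply Rmult_le_pos; [lra|left; apply exp_pos]).
  assert (Main : forall om, Cmod (Q z1) * Cmod (E om z1) <= M).
  { intros om.
    (* The rectangle is chosen after [om]: it must contain [z1], and [c * ln N] must exceed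
       [A + om]. Its vertical sides lie over half-integers, away from the zeros of the sine. *)
    destruct (nfloor_ex (exp ((Rabs A + Rabs om) / c) + Rabs (Re z1) + Rabs (Im z1) + 1)) as [n0 Hn0].
    { pose proof (exp_pos ((Rabs A + Rabs om) / c)). pose proof (Rabs_pos (Re z1)).
      pose proof (Rabs_pos (Im z1)). lra. }
    set (n := S n0). set (N := INR n).
    assert (HN : exp ((Rabs A + Rabs om) / c) + Rabs (Re z1) + Rabs (Im z1) + 1 < N)
      by (unfold N, n; rewrite S_INR; lra).
    pose proof (exp_pos ((Rabs A + Rabs om) / c)) as He. pose proof (Rabs_pos (Re z1)) as Hr1.
    pose proof (Rabs_pos (Im z1)) as Hi1. pose proof (Rle_abs (Re z1)) as Hr2.
    assert (Hi2 : - Rabs (Im z1) <= Im z1 <= Rabs (Im z1))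
      by (apply Rabs_le_between; lra).
    assert (HlnN : A + om <= c * ln N).
    { assert (L : (Rabs A + Rabs om) / c <= ln N).
      { rewrite <- (ln_exp ((Rabs A + Rabs om) / c)). apply ln_le; [exact He|lra]. }
      apply Rle_div_l in L; [|exact Hc]. pose proof (Rle_abs A). pose proof (Rle_abs om). lra. }
    rewrite <- Cmod_mult.
    apply (max_modulus_rect (fun z => Q z * E om z)%C (1 / 2) (N + 1 / 2) (- N) N M);
      try lra.
    - intros z Hx Hy. destruct (HQ z ltac:(lra)) as [Qc [r [Hr Qh]]].
      assert (HE : forall u, Cmod (u - z)%C < 1 -> hol_at (E om) u).
      { intros u Hu. apply near_Re_Im in Hu. apply hol_cexp. apply hol_mult; [apply HZ|].
        apply hol_minus; [apply hol_const|]. apply hol_mult; [apply hol_const|].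
        apply hol_clog; [apply hol_plus; [apply hol_const|apply HZ]|].
        rewrite re_plus, Rzt. change (Re (RtoC 1)) with 1. lra. }
      split.
      + apply cont_mult; [exact Qc|]. apply hol_cont, HE. rewrite Cmod_minus_self. lra.
      + exists (Rmin r 1). split; [apply Rmin_glb_lt; lra|]. intros u Hu Hur.
        pose proof (Rmin_l r 1). pose proof (Rmin_r r 1).
        apply hol_mult; [apply Qh; [exact Hu|lra]|apply HE; lra].
    - intros z Hx Hy Hbd. rewrite Cmod_mult.
      assert (HS : exp (PI * Rabs (Im z)) / 2 <= Cmod (csin_pi z)).
      { destruct z as [x y]. simpl in Hx, Hy, Hbd |- *.
        pose proof (exp_pos (PI * Rabs y)).
        destruct Hbd as [Hbd|[Hbd|[Hbd|Hbd]]].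
        - pose proof (csin_pi_lower_half 0 y) as T.
          replace (INR 0 + 1 / 2) with x in T by (rewrite Hbd; simpl; lra). lra.
        - pose proof (csin_pi_lower_half n y) as T. fold N in T. rewrite <- Hbd in T. lra.
        - apply csin_pi_lower. rewrite Hbd, Rabs_Ropp, Rabs_pos_eq; lra.
        - apply csin_pi_lower. rewrite Hbd, Rabs_pos_eq; lra. }
      pose proof (exp_pos (PI * Rabs (Im z))) as Hp.
      assert (S0 : csin_pi z <> 0%C) by (apply Cmod_gt_0; lra).
      assert (EQ : Q z = (H z / csin_pi z)%C).
      { unfold Q, quot_ext. destruct (excluded_middle_informative _); [contradiction|reflexivity]. }
      assert (QB : Cmod (Q z) <= 2 * K * exp (A * Re z + b * Rabs (Im z) - PI * Rabs (Im z))).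
      { rewrite EQ, Cmod_div by exact S0. apply Rle_div_l; [lra|].
        eapply Rle_trans; [apply Hg; lra|].
        apply Rle_trans with (2 * K * exp (A * Re z + b * Rabs (Im z) - PI * Rabs (Im z))
          * (exp (PI * Rabs (Im z)) / 2)).
        - replace (A * Re z + b * Rabs (Im z)) with
            ((A * Re z + b * Rabs (Im z) - PI * Rabs (Im z)) + PI * Rabs (Im z)) at 1 by ring.
          rewrite exp_plus. lra.
        - apply Rmult_le_compat_l; [|exact HS].
          apply Rmult_le_pos; [lra|left; apply exp_pos]. }
      eapply Rle_trans.
      { apply Rmult_le_compat; [apply Cmod_ge_0|apply Cmod_ge_0|exact QB|apply Ele]. }
      rewrite Rmult_assoc, <- exp_plus. unfold M. apply Rmult_le_compat_l; [lra|].
      apply exp_le.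
      assert (Hxi : 0 <= Re (zt z)) by (rewrite Rzt; lra).
      (* On the left side [Re (zt z) = 0], whatever [om] is; on the three others
         [Cmod (1 + zt z) >= N], so the second factor is nonpositive. *)
      assert (G : Re (zt z) * (A + om - c * ln (Cmod (1 + zt z)%C)) <= 0).
      { destruct Hbd as [Hbd|Hbd].
        - rewrite Rzt, Hbd. lra.
        - assert (Big : N <= Cmod (1 + zt z)%C).
          { destruct Hbd as [Hbd|Hbd].
            - eapply Rle_trans; [|apply re_le_Cmod]. rewrite re_plus, Rzt.
              change (Re (RtoC 1)) with 1. eapply Rle_trans; [|apply Rle_abs]. lra.
            - eapply Rle_trans; [|apply Im_le_Cmod]. rewrite im_plus, Izt.
              change (Im (RtoC 1)) with 0. rewrite Rplus_0_l.
              destruct Hbd as [-> | ->]; [rewrite Rabs_Ropp|]; apply Rle_abs. }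
          assert (L : ln N <= ln (Cmod (1 + zt z)%C)) by (apply ln_le; lra).
          apply Rmult_le_compat_l with (r := c) in L; [|lra].
          rewrite <- (Rmult_0_r (Re (zt z))). apply Rmult_le_compat_l; lra. }
      rewrite Rzt in *. unfold a. lra. }
  set (xi := Re (zt z1)). assert (Hxi : 0 < xi) by (unfold xi; rewrite Rzt; lra).
  set (t := Cmod (Q z1) * Cmod (E 0 z1)).
  assert (Ht : 0 <= t) by (apply Rmult_le_pos; apply Cmod_ge_0).
  assert (Main2 : forall om, t * exp (xi * om) <= M).
  { intros om. eapply Rle_trans; [|apply (Main om)]. apply Req_le.
    unfold t. rewrite !EE, Rmult_assoc, <- exp_plus. do 2 f_equal. fold xi. ring. }
  assert (Ht0 : t = 0).
  { apply Rle_antisym; [|exact Ht]. apply Rnot_lt_le. intros Hlt.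
    (* At this [om] the inequality [exp x >= 1 + x] gives [t + M <= M], impossible for [t > 0]. *)
    specialize (Main2 (M / (t * xi))).
    assert (E1 : xi * (M / (t * xi)) = M / t) by (field; lra).
    rewrite E1 in Main2. pose proof (exp_ineq1_le (M / t)) as E2.
    apply Rmult_le_compat_l with (r := t) in E2; [|lra].
    replace (t * (1 + M / t)) with (t + M) in E2 by (field; lra). lra. }
  apply Rmult_integral in Ht0.
  assert (Q0 : Q z1 = 0%C).
  { destruct Ht0 as [Ht0|Ht0]; [apply Cmod_eq_0, Ht0|].
    exfalso. apply Cmod_eq_0 in Ht0. exact (cexp_neq_0 _ Ht0). }
  destruct (classic (csin_pi z1 = 0%C)) as [Hs|Hs].
  - destruct (csin_pi_zero z1 ltac:(lra) Hs) as [n [Hn1 ->]]. apply Hn, Hn1.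
  - unfold Q, quot_ext in Q0. destruct (excluded_middle_informative _) as [|_]; [contradiction|].
    replace (H z1) with (H z1 / csin_pi z1 * csin_pi z1)%C by (field; exact Hs).
    rewrite Q0. ring.
Qed.

(** * Holonomic recurrences *)

(** Each Horner step spends half of the available rate on the factor [z], through
    [|z| <= (2 / eta) exp (eta |z| / 2)]. *)
Lemma Cpoly_growth (p : Cpoly) (eta : R) : 0 < eta ->
  exists B, 0 <= B /\ forall z, Cmod (Cpoly_eval p z) <= B * exp (eta * Cmod z).
Proof.
  revert eta. induction p as [|c p IH]; intros eta Heta.
  - exists 0. split; [lra|]. intros z. simpl. rewrite Cmod_0. lra.
  - destruct (IH (eta / 2) ltac:(lra)) as [B [HB HBz]].
    exists (Cmod c + 2 / eta * B).
    assert (H2 : 0 < 2 / eta) by (apply Rdiv_lt_0_compat; lra).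
    split; [pose proof (Cmod_ge_0 c); assert (0 <= 2 / eta * B) by (apply Rmult_le_pos; lra); lra|].
    intros z. specialize (HBz z). pose proof (Cmod_ge_0 z) as Hz.
    change (Cpoly_eval (c :: p) z) with (c + z * Cpoly_eval p z)%C.
    eapply Rle_trans; [apply Cmod_triangle|]. rewrite Cmod_mult.
    set (E := exp (eta / 2 * Cmod z)) in *.
    assert (EE : exp (eta * Cmod z) = E * E)
      by (unfold E; rewrite <- exp_plus; f_equal; field).
    assert (E1 : 1 <= E).
    { rewrite <- exp_0. apply exp_le. apply Rmult_le_pos; lra. }
    assert (E2 : Cmod z <= 2 / eta * E).
    { pose proof (exp_ineq1_le (eta / 2 * Cmod z)) as Q. fold E in Q.
      apply Rmult_le_reg_l with (eta / 2); [lra|].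
      replace (eta / 2 * (2 / eta * E)) with E by (field; lra). lra. }
    rewrite EE.
    assert (A1 : Cmod c * 1 <= Cmod c * (E * E)).
    { apply Rmult_le_compat_l; [apply Cmod_ge_0|]. rewrite <- (Rmult_1_l 1).
      apply Rmult_le_compat; lra. }
    assert (A2 : Cmod z * Cmod (Cpoly_eval p z) <= 2 / eta * E * (B * E))
      by (apply Rmult_le_compat; try apply Cmod_ge_0; assumption).
    lra.
Qed.

Lemma Cpoly_eval_cons (c : C) (p : Cpoly) (z : C) :
  Cpoly_eval (c :: p) z = (c + z * Cpoly_eval p z)%C.
Proof. reflexivity. Qed.

(** Coefficients of [a + (x + c) p(x)], one Horner step of the substitution of [x + c]; the argument
    [a] carries the previous coefficient of [p] along. *)
Fixpoint Cpoly_lin (a c : C) (p : Cpoly) : Cpoly :=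
  match p with
  | nil => (a :: nil)%list
  | (b :: q)%list => ((a + c * b)%C :: Cpoly_lin b c q)%list
  end.

Lemma Cpoly_lin_eval (a c : C) (p : Cpoly) (z : C) :
  Cpoly_eval (Cpoly_lin a c p) z = (a + (z + c) * Cpoly_eval p z)%C.
Proof.
  revert a. induction p as [|b q IH]; intros a.
  - simpl. ring.
  - cbn [Cpoly_lin]. rewrite !Cpoly_eval_cons, IH. ring.
Qed.

Lemma Cpoly_translate (p : Cpoly) (c : C) :
  exists p', forall z, Cpoly_eval p' z = Cpoly_eval p (z + c)%C.
Proof.
  induction p as [|a p [p' IH]].
  - exists nil. reflexivity.
  - exists (Cpoly_lin a c p'). intros z. rewrite Cpoly_lin_eval, IH. reflexivity.
Qed.

Lemma Cpoly_eval_zero (p : Cpoly) : ~ Cpoly_nonzero p -> forall z, Cpoly_eval p z = 0%C.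
Proof.
  induction p as [|c p IH]; intros H z; [reflexivity|].
  rewrite Cpoly_eval_cons, IH.
  - replace c with (RtoC 0); [ring|]. apply NNPP. intros Hc. apply H. exists c.
    split; [left; reflexivity|]. intros Q. apply Hc. symmetry. exact Q.
  - intros [b [Hb Hb0]]. apply H. exists b. split; [right; exact Hb|exact Hb0].
Qed.

(** The constant coefficient is the value at 0. The remaining polynomial vanishes off 0 after
    division by [z], and at 0 by continuity. *)
Lemma Cpoly_nonzero_eval (p : Cpoly) : (forall z, Cpoly_eval p z = 0%C) -> ~ Cpoly_nonzero p.
Proof.
  induction p as [|c p IH]; intros H [b [Hb Hb0]]; [destruct Hb|].
  assert (Hc : c = 0%C).
  { rewrite <- (H 0%C), Cpoly_eval_cons. ring. }
  assert (Hp : forall z : C, z <> 0%C -> Cpoly_eval p z = 0%C).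
  { intros z Hz. pose proof (H z) as Q. rewrite Cpoly_eval_cons, Hc in Q.
    replace (Cpoly_eval p z) with ((0 + z * Cpoly_eval p z) / z)%C by (field; exact Hz).
    rewrite Q. field. exact Hz. }
  destruct Hb as [Hb|Hb]; [apply Hb0; rewrite <- Hb; exact Hc|].
  apply IH; [|exists b; split; assumption]. intros z.
  destruct (classic (z = 0%C)) as [->|Hz]; [|apply Hp, Hz].
  apply NNPP. intros Hn.
  destruct (hol_cont _ _ (hol_Cpoly p 0%C) (Cmod (Cpoly_eval p 0%C))) as [del [Hdel Hd]];
    [apply Cmod_gt_0, Hn|].
  assert (Ct : Cmod (RtoC (del / 2)) = del / 2) by (rewrite Cmod_R; apply Rabs_pos_eq; lra).
  specialize (Hd (RtoC (del / 2))). rewrite Hp in Hd.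
  - replace (RtoC (del / 2) - 0)%C with (RtoC (del / 2)) in Hd by ring.
    replace (0 - Cpoly_eval p 0)%C with (- Cpoly_eval p 0)%C in Hd by ring.
    rewrite Cmod_opp in Hd. specialize (Hd ltac:(lra)). lra.
  - apply Cmod_gt_0. lra.
Qed.

Lemma Cpoly_factor (p : Cpoly) : Cpoly_nonzero p ->
  exists m (c0 : C) (q : Cpoly), c0 <> 0%C /\ forall z, Cpoly_eval p z = (z ^ m * Cpoly_eval (c0 :: q) z)%C.
Proof.
  induction p as [|c p IH]; intros [b [Hb Hb0]]; [destruct Hb|].
  destruct (classic (c = 0%C)) as [Hc|Hc].
  - destruct Hb as [Hb|Hb]; [exfalso; apply Hb0; rewrite <- Hb; exact Hc|].
    destruct IH as [m [c0 [q [Hc0 Hq]]]]; [exists b; split; assumption|].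
    exists (S m), c0, q. split; [exact Hc0|]. intros z.
    rewrite Cpoly_eval_cons, Hq, Hc, Cpow_S. ring.
  - exists 0%nat, c, p. split; [exact Hc|]. intros z. simpl Cpow. ring.
Qed.

Lemma least_nat (P : nat -> Prop) : (exists n, P n) ->
  exists n, P n /\ forall m, (m < n)%nat -> ~ P m.
Proof.
  intros [n Hn]. apply NNPP. intros H. revert Hn.
  induction n as [n IH] using lt_wf_ind. intros Hn. apply H. exists n. split; [exact Hn|].
  intros m Hm HP. exact (IH m Hm HP).
Qed.

Lemma sum_n_extract (F : nat -> C) (j0 d : nat) : (j0 <= d)%nat ->
  sum_n F d = (F j0 + sum_n (fun j => if Nat.eqb j j0 then RtoC 0 else F j) d)%C.
Proof.
  assert (Z : forall k, (k < j0)%nat ->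
    sum_n (fun j => if Nat.eqb j j0 then RtoC 0 else F j) k = sum_n F k).
  { intros k Hk. apply sum_n_ext_loc. intros n Hn.
    destruct (Nat.eqb_spec n j0); [lia|reflexivity]. }
  induction d as [|d IH]; intros H.
  - assert (j0 = 0%nat) as -> by lia. rewrite !sum_O. simpl. ring.
  - rewrite !sum_Sn. destruct (Nat.eqb_spec (S d) j0) as [E|E].
    + rewrite Z by lia. subst j0. unfold plus; simpl. ring.
    + rewrite IH by lia. unfold plus; simpl. ring.
Qed.

(** * Growth and analyticity of the function defined by the recurrence *)

Lemma sum_n_growth (T : nat -> C -> C) (D : C -> Prop) (w : C -> R) (d : nat) :
  (forall j, exists B, 0 <= B /\ forall z, D z -> Cmod (T j z) <= B * w z) ->
  exists B, 0 <= B /\ forall z, D z -> Cmod (sum_n (fun j => T j z) d) <= B * w z.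
Proof.
  intros H. induction d as [|d [B [HB IH]]].
  - destruct (H 0%nat) as [B [HB Hz]]. exists B. split; [exact HB|]. intros z Dz.
    rewrite sum_O. apply Hz, Dz.
  - destruct (H (S d)) as [B' [HB' Hz]]. exists (B + B'). split; [lra|]. intros z Dz.
    rewrite sum_Sn. eapply Rle_trans; [apply Cmod_triangle|].
    specialize (IH z Dz). specialize (Hz z Dz). lra.
Qed.

(** This is the function [H] of the overview. *)
Definition rec_op (p : nat -> Cpoly) (f : C -> C) (d : nat) (z : C) : C :=
  sum_n (fun j => (Cpoly_eval (p j) z * f (z + RtoC (INR j)))%C) d.

Lemma growth_of_bounds (f : C -> C) (alpha eps : R) :
  (forall z : C, 0 < Re z -> analytic_at f z) -> 0 < alpha -> 0 < eps ->
  big_O_on (fun z : C => 0 <= Re z) (fun z => f (z + RtoC 1)%C) (fun z : C => exp (alpha * Cmod z)) ->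
  big_O_on (fun x : R => 0 < x) (fun x : R => f (Ci * RtoC x + RtoC 1)%C)
    (fun x : R => exp ((PI - eps) * x)) ->
  big_O_on (fun x : R => 0 < x) (fun x : R => f (- (Ci * RtoC x) + RtoC 1)%C)
    (fun x : R => exp ((PI - eps) * x)) ->
  exists K b, 0 <= K /\ 0 <= b < PI /\ forall z, 0 <= Re z ->
    Cmod (f (z + RtoC 1)%C) <= K * exp (alpha * Re z + b * Rabs (Im z)).
Proof.
  intros Hf Ha He [K1 H1] [K2 H2] [K3 H3].
  (* As [eps] may exceed [PI], the rate is truncated at 0 to stay in [[0, PI)]. *)
  set (b := Rmax (PI - eps) 0). pose proof PI_RGT_0.
  set (K := Rabs K1 + Rabs K2 + Rabs K3).
  pose proof (Rabs_pos K1). pose proof (Rabs_pos K2). pose proof (Rabs_pos K3).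
  pose proof (Rle_abs K1). pose proof (Rle_abs K2). pose proof (Rle_abs K3).
  assert (HK : 0 <= K) by (unfold K; lra).
  assert (Hb0 : 0 <= b) by apply Rmax_r.
  exists K, b. split; [exact HK|]. split.
  { split; [exact Hb0|]. apply Rmax_lub_lt; lra. }
  assert (Up : forall k x y, k <= K -> x <= y -> k * exp x <= K * exp y).
  { intros k x y Hk Hxy. apply Rle_trans with (K * exp x).
    - apply Rmult_le_compat_r; [left; apply exp_pos|exact Hk].
    - apply Rmult_le_compat_l; [exact HK|apply exp_le, Hxy]. }
  apply (half_plane_growth (fun z => f (z + RtoC 1)%C)); [lra|exact HK| | |].
  - intros z Hz. apply (hol_comp f (fun z => z + RtoC 1)%C).
    + apply hol_plus; [apply hol_id|apply hol_const].
    + apply analytic_hol, Hf. rewrite re_plus. change (Re (RtoC 1)) with 1. lra.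
  - intros z Hz. eapply Rle_trans; [apply H1, Hz|]. apply Up; [unfold K; lra|lra].
  - intros [x y] Hx. simpl in Hx. subst x. simpl Im.
    assert (Hb : forall t, 0 <= t -> (PI - eps) * t <= b * t)
      by (intros t Ht; apply Rmult_le_compat_r; [exact Ht|apply Rmax_l]).
    destruct (Rtotal_order y 0) as [Hy|[Hy|Hy]].
    + replace ((0, y) : C) with (- (Ci * RtoC (- y)))%C
        by (unfold Copp, Cmult, Ci, RtoC; simpl; f_equal; ring).
      eapply Rle_trans; [apply H3; lra|]. rewrite Rabs_left by exact Hy.
      apply Up; [unfold K; lra|apply Hb; lra].
    (* The bounds on the imaginary axis are given for [x > 0], so the origin is covered by the bound
       on the half-plane. *)
    + subst y. eapply Rle_trans; [apply H1; simpl; lra|].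
      apply Up; [unfold K; lra|]. rewrite Rabs_R0. change ((0, 0) : C) with (RtoC 0).
      rewrite Cmod_0. lra.
    + replace ((0, y) : C) with (Ci * RtoC y)%C
        by (unfold Cmult, Ci, RtoC; simpl; f_equal; ring).
      eapply Rle_trans; [apply H2; lra|]. rewrite Rabs_pos_eq by lra.
      apply Up; [unfold K; lra|apply Hb; lra].
Qed.

(** The shifts by [j] are real, so they cost only constants [exp (alpha * INR j)] and leave the
    vertical rate [b] untouched; the polynomials cost an arbitrarily small [eta] in both
    directions. *)
Lemma rec_op_growth (p : nat -> Cpoly) (f : C -> C) (d : nat) (K alpha b eta : R) :
  0 <= K -> 0 <= b -> 0 < eta -> 0 <= alpha ->
  (forall z, 0 <= Re z ->
    Cmod (f (z + RtoC 1)%C) <= K * exp (alpha * Re z + b * Rabs (Im z))) ->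
  exists B, 0 <= B /\ forall z, 1 / 2 <= Re z -> Cmod (rec_op p f d (z + RtoC 1)%C)
    <= B * exp ((alpha + eta) * Re z + (b + eta) * Rabs (Im z)).
Proof.
  intros HK Hb Heta Ha Hf.
  apply (sum_n_growth (fun j z => Cpoly_eval (p j) (z + RtoC 1) * f (z + RtoC 1 + RtoC (INR j)))%C
    (fun z => 1 / 2 <= Re z)).
  intros j. destruct (Cpoly_growth (p j) eta Heta) as [B [HB HBz]].
  exists (B * exp eta * (K * exp (alpha * INR j))).
  split.
  { repeat apply Rmult_le_pos; try assumption; left; apply exp_pos. }
  intros z Hz. rewrite Cmod_mult.
  assert (A1 : Cmod (Cpoly_eval (p j) (z + RtoC 1)%C) <= B * exp eta * exp (eta * (Re z + Rabs (Im z)))).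
  { eapply Rle_trans; [apply HBz|]. rewrite Rmult_assoc, <- exp_plus.
    apply Rmult_le_compat_l; [exact HB|]. apply exp_le.
    replace (eta + eta * (Re z + Rabs (Im z))) with (eta * (1 + (Re z + Rabs (Im z)))) by ring.
    apply Rmult_le_compat_l; [lra|].
    eapply Rle_trans; [apply Cmod_triangle|]. rewrite Cmod_1.
    pose proof (Cmod_le_Re_Im z) as Q. rewrite (Rabs_pos_eq (Re z)) in Q by lra. lra. }
  assert (A2 : Cmod (f (z + RtoC 1 + RtoC (INR j))%C)
    <= K * exp (alpha * INR j) * exp (alpha * Re z + b * Rabs (Im z))).
  { replace (z + RtoC 1 + RtoC (INR j))%C with (z + RtoC (INR j) + RtoC 1)%C by ring.
    eapply Rle_trans; [apply Hf|].
    - rewrite re_plus. change (Re (RtoC (INR j))) with (INR j). pose proof (pos_INR j). lra.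
    - rewrite re_plus, im_plus. change (Re (RtoC (INR j))) with (INR j).
      change (Im (RtoC (INR j))) with 0. rewrite Rplus_0_r, Rmult_assoc, <- exp_plus.
      apply Req_le. do 2 f_equal. ring. }
  eapply Rle_trans; [apply Rmult_le_compat; try apply Cmod_ge_0; eassumption|].
  apply Req_le.
  replace ((alpha + eta) * Re z + (b + eta) * Rabs (Im z))
    with (eta * (Re z + Rabs (Im z)) + (alpha * Re z + b * Rabs (Im z))) by ring.
  rewrite (exp_plus (eta * (Re z + Rabs (Im z)))). ring.
Qed.

(** The first alternative handles the indices below [j0]: there [f] may be evaluated outside the
    half-plane, where it is arbitrary, but the polynomial factor is identically 0. *)
Lemma rec_term_analytic (p : Cpoly) (f : C -> C) (j : nat) (z : C) :
  (forall z : C, 0 < Re z -> analytic_at f z) -> ~ Cpoly_nonzero p \/ 0 < Re z + INR j ->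
  analytic_at (fun z => Cpoly_eval p z * f (z + RtoC (INR j)))%C z.
Proof.
  intros Hf [Hp|Hz].
  - apply (analytic_at_ext (fun _ => RtoC 0) _ z 1 Rlt_0_1); [|apply analytic_0].
    intros u _. rewrite Cpoly_eval_zero by exact Hp. ring.
  - apply (analytic_Cpoly_mul p (fun z => f (z + RtoC (INR j))%C)). apply analytic_translate, Hf.
    rewrite re_plus. exact Hz.
Qed.

(** At [z - j0] the recurrence isolates [p_j0 (z - j0) * f z]. The other terms are identically 0 for
    [j < j0] and involve [f] near [j - j0 >= 1] for [j > j0], so their sum [Rm] is analytic at 0. *)
Lemma extension_of_recurrence (f : C -> C) (p : nat -> Cpoly) (d j0 : nat) :
  (forall z : C, 0 < Re z -> analytic_at f z) -> (j0 <= d)%nat ->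
  Cpoly_nonzero (p j0) -> (forall j, (j < j0)%nat -> ~ Cpoly_nonzero (p j)) ->
  (forall z, - INR j0 < Re z -> rec_op p f d z = 0%C) ->
  has_meromorphic_extension_at_0 f.
Proof.
  intros Hf Hd Hnz Hmin Hrec.
  set (s := RtoC (- INR j0)).
  destruct (Cpoly_translate (p j0) s) as [q Hq].
  assert (Hqnz : Cpoly_nonzero q).
  { apply NNPP. intros Hn. apply (Cpoly_nonzero_eval (p j0)); [|exact Hnz]. intros z.
    replace z with (z - s + s)%C by ring. rewrite <- Hq. apply Cpoly_eval_zero, Hn. }
  (* The exponent [m] is the multiplicity of [- j0] as a root of [p j0], and bounds the order of the
     pole at 0. *)
  destruct (Cpoly_factor q Hqnz) as [m [c0 [q1 [Hc0 Hq1]]]].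
  set (T := fun j z => (Cpoly_eval (p j) z * f (z + RtoC (INR j)))%C).
  set (Rm := fun z => sum_n (fun j => if Nat.eqb j j0 then RtoC 0 else T j (z + s)%C) d).
  assert (HRm : analytic_at Rm 0%C).
  { apply (analytic_sum_n (fun j z => if Nat.eqb j j0 then RtoC 0 else T j (z + s)%C)).
    intros j Hj. destruct (Nat.eqb_spec j j0) as [E|E]; [apply analytic_0|].
    apply (analytic_translate (T j)). apply rec_term_analytic; [exact Hf|].
    destruct (Nat.lt_ge_cases j j0) as [Hl|Hl]; [left; apply Hmin, Hl|right].
    rewrite re_plus. unfold s. simpl.
    assert (INR j0 < INR j) by (apply lt_INR; lia). lra. }
  set (e := Cpoly_eval (c0 :: q1)).
  set (h := fun z => ((- (1)) * Rm z / e z)%C).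
  assert (Hh : analytic_at h 0%C).
  { apply (analytic_div_poly (fun z => (- (1)) * Rm z)%C c0 q1 Hc0). apply analytic_scal, HRm. }
  destruct (hol_cont _ _ (hol_Cpoly (c0 :: q1) 0%C) (Cmod c0)) as [del [Hdel Hcont]];
    [apply Cmod_gt_0, Hc0|].
  assert (Hene : forall z, Cmod (z - 0)%C < del -> e z <> 0%C).
  { intros z Hz Q. specialize (Hcont z Hz). fold e in Hcont. rewrite Q in Hcont.
    replace (0 - e 0)%C with (- c0)%C in Hcont by (unfold e; rewrite Cpoly_eval_cons; ring).
    rewrite Cmod_opp in Hcont. lra. }
  (* Defined by cases, the extension agrees with [f] on the entire half-plane by construction; the
     recurrence shows that near 0 both branches are given by [h z / z ^ m]. *)
  exists (fun z => if Rlt_dec 0 (Re z) then f z else (h z / z ^ m)%C). split.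
  { intros z Hz. destruct (Rlt_dec 0 (Re z)); [reflexivity|contradiction]. }
  exists m, h. split; [exact Hh|].
  apply (locally_Cmod 0%C (fun z => z <> RtoC 0 ->
    ((z - 0) ^ m * (if Rlt_dec 0 (Re z) then f z else h z / z ^ m))%C = h z)).
  exists del. split; [exact Hdel|]. intros z Hz Hz0.
  replace (z - 0)%C with z by ring.
  destruct (Rlt_dec 0 (Re z)) as [Hre|Hre]; [|field; apply Cpow_nz, Hz0].
  assert (Rec : rec_op p f d (z + s)%C = 0%C).
  { apply Hrec. rewrite re_plus. unfold s. simpl. lra. }
  unfold rec_op in Rec. rewrite (sum_n_extract _ j0 d Hd) in Rec.
  change (sum_n (fun j => if Nat.eqb j j0 then RtoC 0 else
    (Cpoly_eval (p j) (z + s) * f (z + s + RtoC (INR j)))%C) d) with (Rm z) in Rec.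
  replace (z + s + RtoC (INR j0))%C with z in Rec
    by (unfold s; rewrite RtoC_opp; ring).
  rewrite <- Hq, Hq1 in Rec. fold (e z) in Rec.
  unfold h.
  replace (- (1) * Rm z)%C with (z ^ m * e z * f z)%C.
  - field. apply Hene, Hz.
  - replace (z ^ m * e z * f z)%C with ((z ^ m * e z * f z + Rm z) + - (1) * Rm z)%C by ring.
    rewrite Rec. ring.
Qed.

Theorem theorem7 (f : C -> C) (alpha eps : R)
  (f_analytic : forall z : C, 0 < Re z -> analytic_at f z)
  (f_no_ext : ~ has_meromorphic_extension_at_0 f)
  (alpha_gt0 : 0 < alpha) (eps_gt0 : 0 < eps) :
  let g := fun z : C => f (z + RtoC 1)%C in
  big_O_on (fun z : C => 0 <= Re z) g (fun z : C => exp (alpha * Cmod z)) ->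
  big_O_on (fun x : R => 0 < x) (fun x : R => g (Ci * RtoC x)%C)
    (fun x : R => exp ((PI - eps) * x)) ->
  big_O_on (fun x : R => 0 < x) (fun x : R => g (- (Ci * RtoC x))%C)
    (fun x : R => exp ((PI - eps) * x)) ->
  ~ holonomic (fun n : nat => f (RtoC (INR n))).
Proof.
  intros g Hg1 Hg2 Hg3 [d [p [[j [Hj Hjnz]] Hrec]]].
  destruct (growth_of_bounds f alpha eps f_analytic alpha_gt0 eps_gt0 Hg1 Hg2 Hg3)
    as [K [b [HK [Hb Hgr]]]].
  destruct (least_nat (fun j => (j <= d)%nat /\ Cpoly_nonzero (p j))) as [j0 [[Hj0 Hnz] Hmin]].
  { exists j. split; assumption. }
  apply f_no_ext, (extension_of_recurrence f p d j0 f_analytic Hj0 Hnz).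
  { intros k Hk Hk'. apply (Hmin k Hk). split; [lia|exact Hk']. }
  assert (Han : forall z, - INR j0 < Re z -> analytic_at (rec_op p f d) z).
  { intros z Hz. apply (analytic_sum_n (fun j z => Cpoly_eval (p j) z * f (z + RtoC (INR j)))%C).
    intros k Hk. apply rec_term_analytic; [exact f_analytic|].
    destruct (Nat.lt_ge_cases k j0) as [Hl|Hl].
    - left. intros Hk'. apply (Hmin k Hl). split; assumption.
    - right. assert (INR j0 <= INR k) by (apply le_INR; exact Hl). lra. }
  (* Carlson's theorem, applied to the function translated by 1, gives zeros for [Re z - 1 > 1 / 2],
     hence the threshold [3 / 2]. *)
  apply (identity_half_plane _ (- INR j0) (3 / 2) Han).
  (* Half of the gap below [PI] is given to the polynomials, so the vertical rate [b + eta] stays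
     below [PI]. *)
  set (eta := (PI - b) / 2). assert (Heta : 0 < eta) by (unfold eta; lra).
  destruct (rec_op_growth p f d K alpha b eta HK (proj1 Hb) Heta ltac:(lra) Hgr) as [B [HB HBz]].
  intros z Hz. replace z with ((z - RtoC 1) + RtoC 1)%C by ring.
  apply (carlson (fun z => rec_op p f d (z + RtoC 1)%C) B (alpha + eta) (b + eta)).
  - exact HB.
  - unfold eta. lra.
  - intros u Hu. apply (hol_comp (rec_op p f d) (fun u => u + RtoC 1)%C).
    + apply hol_plus; [apply hol_id|apply hol_const].
    + apply analytic_hol, Han. rewrite re_plus. change (Re (RtoC 1)) with 1.
      pose proof (pos_INR j0). lra.
  - exact HBz.
  (* Because of the translation by 1, the value at [n] is the left-hand side of the recurrence at
     index [S n]. *)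
  - intros n _. rewrite <- RtoC_plus, <- S_INR. unfold rec_op.
    rewrite <- (Hrec (S n)) by lia. apply sum_n_ext. intros k.
    rewrite <- RtoC_plus, <- plus_INR. reflexivity.
  - rewrite Re_sub. change (Re (RtoC 1)) with 1. lra.
Qed.
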